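(* There is a polynomial-time $\min(k,2u_{\max})$-approximation algorithm for the Capacitated $k$-Connected Subgraph problem: given any feasible instance $(G=(V,E),u,c,k)$, it outputs a feasible edge-set $F\subseteq E$ with $c(F)\le\min(k,2u_{\max})\cdot\mathrm{OPT}$, where $u_{\max}=\max_{e\in E}u_e$ and $\mathrm{OPT}$ is the minimum cost of a feasible edge-set.
   Context: An instance of the Capacitated $k$-Connected Subgraph problem consists of an undirected connected graph $G=(V,E)$ (multiedges allowed, no self-loops), nonnegative integer edge capacities $u:E\to\mathbb{Z}_{\ge0}$, nonnegative edge costs $c:E\to\mathbb{R}_{\ge0}$, and a positive integer $k$. An edge-set $F\subseteq E$ is feasible if for every nonempty $R\subsetneq V$, $\sum_{e\in\delta_G(R)\cap F}u_e\ge k$, where $\delta_G(R)$ is the set of edges of $G$ with exactly one endpoint in $R$. The goal is to minimize $c(F)=\sum_{e\in F}c_e$ over feasible $F$. *)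

(* Defs.v *)
From Corelib Require Import BinNums.
From mathcomp Require Import all_boot all_order all_algebra.

Set Implicit Arguments.
Unset Strict Implicit.
Unset Printing Implicit Defensive.

Import Order.TTheory GRing.Theory Num.Theory.
Local Open Scope ring_scope.

(** * Capacitated k-connected subgraph *)

(* The multigraph has vertex set 'I_nv and edge set 'I_ne; the orientation
   given by [src] and [tgt] is immaterial, and distinct edges may have the same
   ends. *)
Record instance (R : realFieldType) := Instance {
  nv : nat;
  ne : nat;
  src : 'I_ne -> 'I_nv;
  tgt : 'I_ne -> 'I_nv;
  cap : 'I_ne -> nat;
  ecost : 'I_ne -> R;
  kconn : nat;
  _ : forall e, src e != tgt e;
  _ : (0 < nv)%N;
  _ : forall x y : 'I_nv,
        connect [rel a b | [exists e, ((src e == a) && (tgt e == b))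
                                   || ((src e == b) && (tgt e == a))]] x y;
  _ : forall e, 0 <= ecost e;
  _ : (0 < kconn)%N }.

Section Problem.
Variables (R : realFieldType) (I : instance R).

Definition delta (S : {set 'I_(nv I)}) : {set 'I_(ne I)} :=
  [set e | (src e \in S) (+) (tgt e \in S)].

Definition feasible (F : {set 'I_(ne I)}) : bool :=
  [forall S : {set 'I_(nv I)}, (S != set0) ==> (S \proper setT) ==>
     (kconn I <= \sum_(e in delta S :&: F) cap e)%N].

Definition cost (F : {set 'I_(ne I)}) : R := \sum_(e in F) ecost e.

(* The default [setT] of the arg min is feasible as soon as the instance is. *)
Definition OPT : R := cost [arg min_(F < setT | feasible F) cost F]%O.

Definition umax : nat := (\max_(e < ne I) cap e)%N.

Lemma feasibleT F : feasible F -> feasible setT.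
Proof.
move=> /forallP fF; apply/forallP => S; apply/implyP => S0; apply/implyP => ST.
have := fF S; rewrite S0 ST /= => /leq_trans; apply.
rewrite setIT [leqRHS](bigID (mem F)) /=.
apply: leq_trans (leq_addr _ _); apply: eq_leq.
by apply: eq_bigl => e; rewrite in_setI.
Qed.

Lemma OPT_min : (exists F, feasible F) ->
  (exists2 F, feasible F & cost F = OPT) /\
  (forall F, feasible F -> OPT <= cost F).
Proof.
case=> F0 /feasibleT fT; rewrite /OPT.
by case: arg_minP => // F fF minF; split=> //; exists F.
Qed.

End Problem.

(** * Model of computation

   A deterministic imperative language over binary trees (the WHILE language of
   N. Jones, Computability and Complexity, 1997), whose leaves may in addition
   hold numbers of R.  All discrete data are trees built from [Leaf] and
   [Node]; the elements of R are atomic, of size 1, and the only operations on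
   them are addition, subtraction and comparison.  Programs do not mention R,
   and contain no constant of R.

   Evaluating an expression costs the total size of the values of all its
   subexpressions, so that even copying a tree is charged its full size; on
   discrete data the running time is therefore polynomially related to that of
   Turing machines.  As there is no multiplication on R, every number obtained
   in time t is an integer combination of the input numbers with coefficients
   of at most t bits, so that on rational inputs written in binary the same
   holds. *)

Inductive tree (R : Type) := Leaf | Atom of R | Node of tree R & tree R.
Arguments Leaf {R}.

Inductive expr :=
| Var of nat
| ELeaf
| ENode of expr & expr
| Left of expr
| Right of expr
| Add of expr & expr
| Sub of expr & expr
| Le of expr & expr.

Inductive prog :=
| Assign of nat & expr
| Seq of prog & prog
| If of expr & prog & prog
| While of expr & prog.

Section Semantics.
Local Open Scope nat_scope.
Variable R : realFieldType.
Implicit Types (s : nat -> tree R) (e : expr) (a b : tree R).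

Fixpoint tree_size a : nat :=
  if a is Node a1 a2 then (tree_size a1 + tree_size a2).+1 else 1.

Definition tbool (x : bool) : tree R := if x then Node Leaf Leaf else Leaf.

Definition truthy a : bool := if a is Leaf then false else true.

Fixpoint eval s e : tree R :=
  match e with
  | Var x => s x
  | ELeaf => Leaf
  | ENode e1 e2 => Node (eval s e1) (eval s e2)
  | Left e1 => if eval s e1 is Node a _ then a else Leaf
  | Right e1 => if eval s e1 is Node _ b then b else Leaf
  | Add e1 e2 =>
      if (eval s e1, eval s e2) is (Atom x, Atom y) then Atom (x + y)%R else Leaf
  | Sub e1 e2 =>
      if (eval s e1, eval s e2) is (Atom x, Atom y) then Atom (x - y)%R else Leaf
  | Le e1 e2 =>
      if (eval s e1, eval s e2) is (Atom x, Atom y) then tbool (x <= y)%R else Leaf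
  end.

Fixpoint eval_time s e : nat :=
  tree_size (eval s e) +
  match e with
  | Var _ | ELeaf => 0
  | Left e1 | Right e1 => eval_time s e1
  | ENode e1 e2 | Add e1 e2 | Sub e1 e2 | Le e1 e2 =>
      eval_time s e1 + eval_time s e2
  end.

Definition update s (x : nat) a : nat -> tree R :=
  fun y => if y == x then a else s y.

(* [exec p s s' t]: started in store s, p halts in store s' after time t. *)
Inductive exec : prog -> (nat -> tree R) -> (nat -> tree R) -> nat -> Prop :=
| ExecAssign x e s :
    exec (Assign x e) s (update s x (eval s e)) (eval_time s e)
| ExecSeq p q s1 s2 s3 t u :
    exec p s1 s2 t -> exec q s2 s3 u -> exec (Seq p q) s1 s3 (t + u)
| ExecIfTrue e p q s s' t :
    truthy (eval s e) -> exec p s s' t ->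
    exec (If e p q) s s' (eval_time s e + t)
| ExecIfFalse e p q s s' t :
    ~~ truthy (eval s e) -> exec q s s' t ->
    exec (If e p q) s s' (eval_time s e + t)
| ExecWhileTrue e p s1 s2 s3 t u :
    truthy (eval s1 e) -> exec p s1 s2 t -> exec (While e p) s2 s3 u ->
    exec (While e p) s1 s3 (eval_time s1 e + t + u)
| ExecWhileFalse e p s :
    ~~ truthy (eval s e) -> exec (While e p) s s (eval_time s e).

(* Input and output are both in variable 0. *)
Definition computes (p : prog) (inp out : tree R) (t : nat) : Prop :=
  exists2 s, exec p (update (fun=> Leaf) 0 inp) s t & s 0 = out.

Lemma exec_det p s s1 s2 t1 t2 :
  exec p s s1 t1 -> exec p s s2 t2 -> s1 = s2 /\ t1 = t2.
Proof.
move=> ex1; elim: ex1 s2 t2 => {p s s1 t1}; intros;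
  match goal with H : exec _ _ _ _ |- _ /\ _ => inversion H; subst end;
  repeat match goal with
  | IH : forall s' t', exec ?p ?s s' t' -> _, H : exec ?p ?s _ _ |- _ =>
      case: (IH _ _ H) => ? ?; subst; clear IH
  | T : is_true (truthy ?a), N : is_true (~~ truthy ?a) |- _ =>
      by rewrite T in N
  end; by [].
Qed.

End Semantics.

(** * Encoding of instances and edge sets *)

Section Encoding.
Variable R : realFieldType.

Definition tlist (l : seq (tree R)) : tree R := foldr (@Node R) Leaf l.

(* Natural numbers in binary, least significant bit first, no trailing 0. *)
Fixpoint tpos (n : positive) : tree R :=
  match n with
  | xH => tlist [:: tbool R true]
  | xO n' => Node (tbool R false) (tpos n')
  | xI n' => Node (tbool R true) (tpos n')
  end.

Definition tnat (n : nat) : tree R :=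
  if bin_of_nat n is Npos q then tpos q else Leaf.

Definition tinstance (I : instance R) : tree R :=
  tlist [:: tnat (nv I); tnat (kconn I);
    tlist [seq tlist [:: tnat (src e); tnat (tgt e); tnat (cap e);
                         Atom (ecost e)] | e <- enum 'I_(ne I)]].

(* The characteristic vector of F, in the order of the edges of the input. *)
Definition tset (m : nat) (F : {set 'I_m}) : tree R :=
  tlist [seq tbool R (e \in F) | e <- enum 'I_m].

End Encoding.

(* Main.v *)
From Corelib Require Import BinNums.
Require Import Defs.
From mathcomp Require Import all_boot all_order all_algebra zify.

Set Implicit Arguments.
Unset Strict Implicit.
Unset Printing Implicit Defensive.

Import Order.TTheory GRing.Theory Num.Theory.

(** Replace every edge by two opposite arcs of the same cost and capacity, and
    fix a root.  A cheapest family of [k] spanning trees, in which every vertex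
    other than the root is the head of exactly [k] arcs and every arc is used at
    most as often as its capacity allows, is a minimum-cost common base of two
    matroids, and its edges form a feasible set: inside a vertex set [S] avoiding
    the root there is room for [k (|S| - 1)] of the [k |S|] arcs with head in
    [S], so [k] arcs enter [S].  Conversely Edmonds' theorem packs [k]
    arborescences in the arcs of an optimal solution; each arborescence uses an
    edge at most once, and each arc is used at most [umax] times, so that the
    packing costs at most [k OPT] and at most [2 umax OPT].

    The common base is found by Frank's weight-splitting algorithm, which only
    adds, subtracts and compares costs.  It runs on [k] copies of the arcs, which
    are polynomially many unless [min (k, 2 umax)] is at least the number [m] of
    edges.  In that case the cheapest edges, up to the least threshold that makes
    them feasible, cost at most [m OPT]; feasibility is tested with maximum
    adjacency orders (Stoer and Wagner).

    If some cost [c0] is positive, every number [n] of the input can be replaced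
    by the atom [n c0], so that no arithmetic on binary numbers is needed; if all
    the costs vanish, the whole edge set is optimal. *)

(** * Polynomial-time relations between tree-valued families *)

(** No program is written out. The language has neither procedures nor arithmetic on discrete data,
    so the algorithms are ordinary functions, and [pt] asserts that one program realises such a
    function on a whole family of inputs. Its closure properties (composition, pairing, branching,
    loops along a list) do the programming. The index type is arbitrary because a loop body is again
    a family, indexed by the inputs together with a list element, and a branch is a family over the
    inputs that pass the test.

    The case distinction comes from [kconn] and the capacities being binary: one copy of every arc
    per colour may be exponentially many. If [kconn < ne], the copies are few. If twice every
    capacity is less than [ne], the cut around one vertex shows [kconn <= ne * ne] as soon as the
    instance is feasible. In the remaining case both terms of the minimum are at least [ne].

    Augmenting paths must have no shortcuts. They are found by deleting vertices as long as a sink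
    stays reachable, so that reachability is the only graph search. *)

Definition pw (n c : nat) : nat := n.+2 ^ c.

Lemma pw_gt0 n c : 0 < pw n c. Proof. by rewrite expn_gt0. Qed.

Lemma leq_expl m n c : m <= n -> m ^ c <= n ^ c.
Proof. by case: c => [|c] mn; rewrite ?expn0 ?leq_exp2r. Qed.

Lemma pw_leq m n a b : m <= n -> a <= b -> pw m a <= pw n b.
Proof.
move=> mn ab; apply: (@leq_trans (pw m b)); first by rewrite leq_pexp2l.
exact: leq_expl.
Qed.

Lemma pw1 n : pw n 1 = n.+2. Proof. by rewrite /pw expn1. Qed.

Lemma pwM n a b : pw n a * pw n b = pw n (a + b).
Proof. by rewrite /pw expnD. Qed.

(** The base [n.+2] is at least 2 even for [n = 0]; constant factors and sums are therefore absorbed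
    by the exponent, and all bounds below have the single form [pw n c]. *)
Lemma pw_mul2 n a : 2 * pw n a <= pw n a.+1.
Proof. by rewrite /pw expnS leq_mul2r; lia. Qed.

Lemma pw_mulX n a d : 2 ^ d * pw n a <= pw n (a + d).
Proof.
elim: d => [|d IHd]; first by rewrite addn0 mul1n.
rewrite addnS expnS -mulnA; apply: leq_trans (pw_mul2 _ _).
by rewrite leq_mul2l IHd.
Qed.

Lemma leq_pw n c : 0 < c -> n <= pw n c.
Proof. by move=> c0; have := pw_leq (leqnn n) c0; rewrite pw1; lia. Qed.

Lemma pwD n a b c : a <= c -> b <= c -> pw n a + pw n b <= pw n c.+1.
Proof.
move=> ac bc; apply: leq_trans (pw_mul2 n c).
by rewrite mul2n -addnn leq_add // pw_leq.
Qed.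

(** Two more units of the inner exponent absorb the shift by 2 in the base [(pw n a).+2]. *)
Lemma pw_pw n a b : pw (pw n a) b <= pw n (a.+2 * b).
Proof.
rewrite /pw expnM; apply: leq_expl.
have := pw_mul2 n a; have := pw_mul2 n a.+1; have := pw_gt0 n a.
by rewrite /pw; lia.
Qed.

Lemma tree_size_gt0 (R : realFieldType) (a : tree R) : 0 < tree_size a.
Proof. by case: a. Qed.

Fixpoint evars e : seq nat :=
  match e with
  | Var x => [:: x]
  | ELeaf => [::]
  | ENode a b | Add a b | Defs.Sub a b | Le a b => evars a ++ evars b
  | Left a | Right a => evars a
  end.

Lemma size_eval_time (R : realFieldType) (s : nat -> tree R) e :
  tree_size (eval s e) <= eval_time s e.
Proof. by case: e => *; apply: leq_addr. Qed.

(** A value is larger than the time spent on its operands by at most a constant, whence the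
    recurrence [3 + 2 * (t1 + t2)] for every operator. The exponent depends on the expression only,
    neither on the store nor on the field. *)
Lemma eval_time_poly e : exists c, forall (R : realFieldType) (s : nat -> tree R) B,
  (forall y, y \in evars e -> tree_size (s y) <= B) -> eval_time s e <= pw B c.
Proof.
suff H e1 e2 e0 : (exists c, forall (R : realFieldType) (s : nat -> tree R) B,
    (forall y, y \in evars e1 -> tree_size (s y) <= B) -> eval_time s e1 <= pw B c) ->
  (exists c, forall (R : realFieldType) (s : nat -> tree R) B,
    (forall y, y \in evars e2 -> tree_size (s y) <= B) -> eval_time s e2 <= pw B c) ->
  (forall (R : realFieldType) (s : nat -> tree R),
     eval_time s e0 <= 3 + 2 * (eval_time s e1 + eval_time s e2)) ->
  {subset evars e1 <= evars e0} -> {subset evars e2 <= evars e0} ->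
  exists c, forall (R : realFieldType) (s : nat -> tree R) B,
    (forall y, y \in evars e0 -> tree_size (s y) <= B) -> eval_time s e0 <= pw B c.
  elim: e => [x||a IHa b IHb|a IHa|a IHa|a IHa b IHb|a IHa b IHb|a IHa b IHb].
  - exists 1 => R s B hB; rewrite /= addn0 pw1.
    by apply: leq_trans (hB x _) _; rewrite ?mem_head //; lia.
  - by exists 0 => R s B hB.
  - apply: (H a b) => // [R s|y yA|y yB] /=; rewrite ?mem_cat ?yA ?yB ?orbT //.
    by have := size_eval_time s a; have := size_eval_time s b; lia.
  (* Unary operators are treated as binary ones with equal operands. *)
  - apply: (H a a) => // R s /=.
    have := size_eval_time s a.
    by case: (eval s a) => [|?|? ?] /=; lia.
  - apply: (H a a) => // R s /=.
    have := size_eval_time s a.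
    by case: (eval s a) => [|?|? ?] /=; lia.
  - apply: (H a b) => // [R s|y yA|y yB] /=; rewrite ?mem_cat ?yA ?yB ?orbT //.
    by case: (eval s a) => [|?|? ?] /=; case: (eval s b) => [|?|? ?] /=; lia.
  - apply: (H a b) => // [R s|y yA|y yB] /=; rewrite ?mem_cat ?yA ?yB ?orbT //.
    by case: (eval s a) => [|?|? ?] /=; case: (eval s b) => [|?|? ?] /=; lia.
  - apply: (H a b) => // [R s|y yA|y yB] /=; rewrite ?mem_cat ?yA ?yB ?orbT //.
    case: (eval s a) => [|?|? ?] /=; case: (eval s b) => [|?|? ?] /=; try lia.
    by case: (_ <= _)%R => /=; lia.
move=> [c1 h1] [c2 h2] h0 s1 s2; exists (maxn c1 c2 + 3) => R s B hB.
apply: leq_trans (h0 R s) _.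
have {}h1 := leq_trans (h1 R s B (fun y yE => hB y (s1 _ yE)))
  (pw_leq (leqnn B) (leq_maxl c1 c2)).
have {}h2 := leq_trans (h2 R s B (fun y yE => hB y (s2 _ yE)))
  (pw_leq (leqnn B) (leq_maxr c1 c2)).
rewrite !addnS addn0.
have := pw_mul2 B (maxn c1 c2); have := pw_mul2 B (maxn c1 c2).+1.
have := pw_mul2 B (maxn c1 c2).+2; have := pw_gt0 B (maxn c1 c2).
lia.
Qed.

Lemma eq_eval (R : realFieldType) (s s' : nat -> tree R) e :
  (forall y, y \in evars e -> s y = s' y) -> eval s e = eval s' e.
Proof.
elim: e => //= [x|a IHa b IHb|a IHa|a IHa|a IHa b IHb|a IHa b IHb|a IHa b IHb] h;
  try (by rewrite h ?mem_head); try (by rewrite IHa);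
  by rewrite IHa ?IHb // => y yE; apply: h; rewrite mem_cat yE ?orbT.
Qed.

Lemma eval_time_node (R : realFieldType) (s : nat -> tree R) a b :
  eval_time s (ENode a b) = tree_size (eval s a) + tree_size (eval s b) + 1
     + (eval_time s a + eval_time s b).
Proof. by rewrite [in RHS]addn1. Qed.

(* [pt i o]: a single program, independent of [x] and of the field [R x], turns
   [i x] into [o x] in polynomial time.  It uses the variables below [n] as
   scratch space, so that the callers can keep their own data above [n]. *)
Definition pt (X : Type) (R : X -> realFieldType) (i o : forall x, tree (R x)) : Prop :=
  exists (P : prog) (n c : nat), forall x (s : nat -> tree (R x)), s 0 = i x ->
    exists s' t, [/\ exec P s s' t, s' 0 = o x, forall y, n <= y -> s' y = s y,
       t <= pw (tree_size (i x)) c & tree_size (o x) <= pw (tree_size (i x)) c].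

Section Basic.
Variables (X : Type) (R : X -> realFieldType).
Implicit Types (i o a b m : forall x, tree (R x)).

Lemma pt_ext i o o' : (forall x, o x = o' x) -> pt i o -> pt i o'.
Proof.
move=> eo [P [n [c h]]]; exists P, n, c => x s si.
by have [s' [t [h1 h2 h3 h4 h5]]] := h x s si; exists s', t; rewrite -eo.
Qed.

Lemma pt_exti i i' o : (forall x, i x = i' x) -> pt i o -> pt i' o.
Proof.
move=> eo [P [n [c h]]]; exists P, n, c => x s si.
have [|s' [t [h1 h2 h3 h4 h5]]] := h x s; first by rewrite eo.
by exists s', t; rewrite -eo.
Qed.

Lemma pt_conv i i' o o' : (forall x, i x = i' x) -> (forall x, o x = o' x) ->
  pt i o -> pt i' o'.
Proof. by move=> ei eo h; apply: pt_exti ei _; apply: pt_ext eo h. Qed.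

Lemma pt_reindex (Y : Type) (g : Y -> X) i o : pt i o ->
  @pt Y (fun y => R (g y)) (fun y => i (g y)) (fun y => o (g y)).
Proof.
by move=> [P [n [c h]]]; exists P, n, c => y s si; apply: h.
Qed.

Lemma pt_size i o : pt i o -> exists c, forall x, tree_size (o x) <= pw (tree_size (i x)) c.
Proof.
move=> [P [n [c h]]]; exists c => x.
by have [s' [t [_ _ _ _ ?]]] := h x (fun=> i x) erefl.
Qed.

Lemma pt_expr i (e : expr) : all (pred1 0) (evars e) ->
  pt i (fun x => eval (fun=> i x) e).
Proof.
move=> /allP e0; have [c hc] := eval_time_poly e.
exists (Assign 0 e), 1, c => x s si.
have E : eval s e = eval (fun=> i x) e by apply: eq_eval => y /e0 /eqP->.
exists (update s 0 (eval s e)), (eval_time s e); split.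
- exact: ExecAssign.
- by rewrite /update eqxx E.
- by move=> [|y].
- by apply: hc => y /e0 /eqP->; rewrite si.
- rewrite -E; apply: leq_trans (size_eval_time _ _) _.
  by apply: hc => y /e0 /eqP->; rewrite si.
Qed.

Lemma pt_id i : pt i i. Proof. exact: (pt_expr i (e := Var 0)). Qed.

Lemma pt_comp i m o : pt i m -> pt m o -> pt i o.
Proof.
move=> [P [n [c hP]]] [Q [n' [c' hQ]]].
exists (Seq P Q), (maxn n n'), ((c.+2 * c' + c).+1) => x s si.
have [s1 [t1 [e1 o1 k1 b1 z1]]] := hP x s si.
have [s2 [t2 [e2 o2 k2 b2 z2]]] := hQ x s1 o1.
have E d : d <= pw (tree_size (m x)) c' -> d <= pw (tree_size (i x)) (c.+2 * c').
  move=> h; apply: leq_trans h _; apply: leq_trans (pw_pw _ _ _).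
  exact: pw_leq.
exists s2, (t1 + t2); split=> //.
- exact: ExecSeq e1 e2.
- by move=> y; rewrite geq_max => /andP[? ?]; rewrite k2 ?k1.
- apply: leq_trans (pwD _ (leq_addl (c.+2 * c') c) (leq_addr _ _)).
  by rewrite leq_add // E.
- by apply: leq_trans (E _ z2) _; apply: pw_leq => //; rewrite -addnS leq_addr.
Qed.

Lemma pt_leaf i : pt i (fun x => Leaf). Proof. exact: (pt_expr i (e := ELeaf)). Qed.

(** Variable [N] keeps the input and [N.+1] the first result; both lie above the scratch space of
    the two programs, which therefore leave them alone. *)
Lemma pt_pair i a b : pt i a -> pt i b -> pt i (fun x => Node (a x) (b x)).
Proof.
move=> [P [n1 [c1 hP]]] [Q [n2 [c2 hQ]]].
pose N := (maxn n1 n2).+1.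
pose c := (maxn c1 c2).+1.
exists (Seq (Assign N (Var 0)) (Seq P (Seq (Assign N.+1 (Var 0)) (Seq (Assign 0 (Var N))
  (Seq Q (Assign 0 (ENode (Var N.+1) (Var 0)))))))), N.+2, (c + 4) => x s si.
have [C1 C2 CI] : [/\ pw (tree_size (i x)) c1 <= pw (tree_size (i x)) c,
    pw (tree_size (i x)) c2 <= pw (tree_size (i x)) c &
    tree_size (i x) <= pw (tree_size (i x)) c].
  by rewrite leq_pw // !pw_leq // /c; lia.
pose s1 := update s N (i x).
have [|s2 [t2 [e2 o2 k2 b2 z2]]] := hP x s1; first by rewrite /s1 /update.
pose s3 := update s2 N.+1 (a x).
pose s4 := update s3 0 (i x).
have [|s5 [t5 [e5 o5 k5 b5 z5]]] := hQ x s4; first by rewrite /s4 /update.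
have N1 : n1 <= N by rewrite /N ltnW // ltnS leq_maxl.
have N2 : n2 <= N by rewrite /N ltnW // ltnS leq_maxr.
have s2N : s2 N = i x by rewrite k2 // /s1 /update eqxx.
have s5N : s5 N.+1 = a x.
  rewrite k5; last by rewrite leqW.
  by rewrite /s4 /update /= /s3 /update eqxx.
eexists; eexists; split.
- apply: ExecSeq; first exact: ExecAssign.
  apply: ExecSeq; first by rewrite /= si; exact: e2.
  apply: ExecSeq; first by apply: ExecAssign.
  apply: ExecSeq; first by apply: ExecAssign.
  apply: ExecSeq; last by apply: ExecAssign.
  have -> : update (update s2 N.+1 (eval s2 (Var 0))) 0
     (eval (update s2 N.+1 (eval s2 (Var 0))) (Var N)) = s4 :> (nat -> tree (R x)).
    have E1 : update s2 N.+1 (s2 0) N = i x by rewrite /update ltn_eqF // s2N.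
    by rewrite [eval _ (Var N)]E1 /= o2.
  exact: e5.
- by rewrite /update /= s5N o5.
- move=> y hy; have hy1 : N < y by rewrite ltnW.
  have hy0 : N <= y by rewrite ltnW.
  have y0 : (y == 0) = false by case: y hy {hy1 hy0}.
  rewrite /update y0 k5 ?(leq_trans N2 hy0) //.
  rewrite /s4 /s3 /update y0 [y == N.+1]gtn_eqF //.
  by rewrite k2 ?(leq_trans N1 hy0) // /s1 /update gtn_eqF.
- rewrite eval_time_node /= !addn0 si /update /= s5N o5 [N == N.+1]ltn_eqF // s2N o2.
  by have := pw_gt0 (tree_size (i x)) c; have := pw_mulX (tree_size (i x)) c 4; lia.
- have : pw (tree_size (i x)) (c + 2) <= pw (tree_size (i x)) (c + 4) by apply: pw_leq; lia.
  have := pw_mulX (tree_size (i x)) c 2; have := pw_gt0 (tree_size (i x)) c.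
  by rewrite /=; lia.
Qed.

Lemma pt_fst i a b : pt i (fun x => Node (a x) (b x)) -> pt i a.
Proof. by move/pt_comp; apply; apply: (pt_expr _ (e := Left (Var 0))). Qed.

Lemma pt_snd i a b : pt i (fun x => Node (a x) (b x)) -> pt i b.
Proof. by move/pt_comp; apply; apply: (pt_expr _ (e := Right (Var 0))). Qed.

Lemma pt_left i a : pt i a -> pt i (fun x => if a x is Node l _ then l else Leaf).
Proof. by move/pt_comp; apply; apply: (pt_expr _ (e := Left (Var 0))). Qed.

Lemma pt_add i (u v : forall x, R x) : pt i (fun x => Atom (u x)) -> pt i (fun x => Atom (v x)) ->
  pt i (fun x => Atom (u x + v x)%R).
Proof.
move=> hu hv; apply: pt_comp (pt_pair hu hv) _.
exact: (pt_expr _ (e := Add (Left (Var 0)) (Right (Var 0)))).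
Qed.

Lemma pt_sub i (u v : forall x, R x) : pt i (fun x => Atom (u x)) -> pt i (fun x => Atom (v x)) ->
  pt i (fun x => Atom (u x - v x)%R).
Proof.
move=> hu hv; apply: pt_comp (pt_pair hu hv) _.
exact: (pt_expr _ (e := Defs.Sub (Left (Var 0)) (Right (Var 0)))).
Qed.

Lemma pt_le i (u v : forall x, R x) : pt i (fun x => Atom (u x)) -> pt i (fun x => Atom (v x)) ->
  pt i (fun x => tbool (R x) (u x <= v x)%R).
Proof.
move=> hu hv; apply: pt_comp (pt_pair hu hv) _.
exact: (pt_expr _ (e := Le (Left (Var 0)) (Right (Var 0)))).
Qed.

(** Each branch is only required to be correct on inputs with the right outcome of the test. The
    subtypes make facts such as the existence of a positive cost available inside a branch. *)
Lemma pt_if i (q : X -> bool) o : pt i (fun x => tbool (R x) (q x)) ->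
  pt (fun y : {x | q x} => i (sval y)) (fun y => o (sval y)) ->
  pt (fun y : {x | ~~ q x} => i (sval y)) (fun y => o (sval y)) -> pt i o.
Proof.
move=> [P [n1 [c1 hP]]] [Q [n2 [c2 hQ]]] [Q' [n3 [c3 hQ']]].
pose N := (maxn n1 (maxn n2 n3)).+1.
pose c := (maxn c1 (maxn c2 c3)).+1.
have N1 : n1 <= N by rewrite /N; lia.
have N2 : n2 <= N by rewrite /N; lia.
have N3 : n3 <= N by rewrite /N; lia.
exists (Seq (Assign N (Var 0)) (Seq P (Seq (Assign N.+1 (Var 0)) (Seq (Assign 0 (Var N))
  (If (Var N.+1) Q Q'))))), N.+2, (c + 4) => x s si.
pose s1 := update s N (i x).
have [|s2 [t2 [e2 o2 k2 b2 z2]]] := hP x s1; first by rewrite /s1 /update.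
pose s3 := update s2 N.+1 (tbool (R x) (q x)).
pose s4 := update s3 0 (i x).
have s2N : s2 N = i x by rewrite k2 // /s1 /update eqxx.
have s40 : s4 0 = i x by rewrite /s4 /update.
have s4N : s4 N.+1 = tbool (R x) (q x) by rewrite /s4 /s3 /update eqxx.
have [C1 C2 C3 CI] : [/\ pw (tree_size (i x)) c1 <= pw (tree_size (i x)) c,
    pw (tree_size (i x)) c2 <= pw (tree_size (i x)) c,
    pw (tree_size (i x)) c3 <= pw (tree_size (i x)) c &
    tree_size (i x) <= pw (tree_size (i x)) c].
  by rewrite leq_pw // !pw_leq // /c; lia.
have [s5 [t5 [e5 o5 k5 b5 z5]]] : exists s5 t5, [/\ exec (If (Var N.+1) Q Q') s4 s5 t5,
    s5 0 = o x, forall y, N <= y -> s5 y = s4 y,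
    t5 <= tree_size (tbool (R x) (q x)) + pw (tree_size (i x)) c
    & tree_size (o x) <= pw (tree_size (i x)) c].
  case: (boolP (q x)) => qx.
  - have [s5 [t5 [e5 o5 k5 b5 z5]]] := hQ (exist _ x qx) s4 s40.
    exists s5, (eval_time s4 (Var N.+1) + t5); split=> //.
    + by apply: ExecIfTrue e5; rewrite /= s4N qx.
    + by move=> y hy; apply: k5; apply: leq_trans hy.
    + by rewrite /= s4N qx /= addn0 leq_add2l (leq_trans b5).
    + exact: leq_trans z5 C2.
  - have [s5 [t5 [e5 o5 k5 b5 z5]]] := hQ' (exist _ x qx) s4 s40.
    exists s5, (eval_time s4 (Var N.+1) + t5); split=> //.
    + by apply: ExecIfFalse e5; rewrite /= s4N (negbTE qx).
    + by move=> y hy; apply: k5; apply: leq_trans hy.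
    + by rewrite /= s4N (negbTE qx) /= addn0 leq_add2l (leq_trans b5).
    + exact: leq_trans z5 C3.
eexists; eexists; split.
- apply: ExecSeq; first exact: ExecAssign.
  apply: ExecSeq; first by rewrite /= si; exact: e2.
  apply: ExecSeq; first by apply: ExecAssign.
  apply: ExecSeq; first by apply: ExecAssign.
  have -> : update (update s2 N.+1 (eval s2 (Var 0))) 0
     (eval (update s2 N.+1 (eval s2 (Var 0))) (Var N)) = s4 :> (nat -> tree (R x)).
    have E1 : update s2 N.+1 (s2 0) N = i x by rewrite /update ltn_eqF // s2N.
    by rewrite [eval _ (Var N)]E1 /= o2.
  exact: e5.
- exact: o5.
- move=> y hy; have hy1 : N < y by rewrite ltnW.
  have hy0 : N <= y by rewrite ltnW.
  have y0 : (y == 0) = false by case: y hy {hy1 hy0}.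
  rewrite k5 // /s4 /s3 /update y0 [y == N.+1]gtn_eqF //.
  by rewrite k2 ?(leq_trans N1 hy0) // /s1 /update gtn_eqF.
- rewrite /= !addn0 si /update /= [N == N.+1]ltn_eqF // s2N o2.
  have : tree_size (tbool (R x) (q x)) <= 3 by case: (q x).
  have := pw_mulX (tree_size (i x)) c 4; have := pw_gt0 (tree_size (i x)) c.
  lia.
- by apply: leq_trans z5 (pw_leq _ _) => //; apply: leq_addr.
Qed.

End Basic.

(** * Boolean connectives and equality tests *)

Section Boolean.
Variables (X : Type) (R : X -> realFieldType).
Implicit Types (i o a b : forall x, tree (R x)).

Lemma pt_ite i (q : X -> bool) o o' : pt i (fun x => tbool (R x) (q x)) -> pt i o -> pt i o' ->
  pt i (fun x => if q x then o x else o' x).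
Proof.
move=> hq ho ho'; apply: (pt_if hq).
  by refine (pt_ext _ (pt_reindex (@sval _ _) ho)) => -[x /= ->].
by refine (pt_ext _ (pt_reindex (@sval _ _) ho')) => -[x /= /negbTE->].
Qed.

Lemma pt_true i : pt i (fun x => tbool (R x) true).
Proof. exact: pt_pair (pt_leaf i) (pt_leaf i). Qed.

Lemma pt_false i : pt i (fun x => tbool (R x) false).
Proof. exact: pt_leaf. Qed.

Lemma pt_and i (q r : X -> bool) : pt i (fun x => tbool (R x) (q x)) ->
  pt i (fun x => tbool (R x) (r x)) -> pt i (fun x => tbool (R x) (q x && r x)).
Proof.
move=> hq hr; apply: pt_ext (pt_ite hq hr (pt_false i)) => x.
by case: (q x).
Qed.

Lemma pt_or i (q r : X -> bool) : pt i (fun x => tbool (R x) (q x)) ->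
  pt i (fun x => tbool (R x) (r x)) -> pt i (fun x => tbool (R x) (q x || r x)).
Proof.
move=> hq hr; apply: pt_ext (pt_ite hq (pt_true i) hr) => x.
by case: (q x).
Qed.

Lemma pt_not i (q : X -> bool) : pt i (fun x => tbool (R x) (q x)) ->
  pt i (fun x => tbool (R x) (~~ q x)).
Proof.
move=> hq; apply: pt_ext (pt_ite hq (pt_false i) (pt_true i)) => x.
by case: (q x).
Qed.

Lemma pt_eq i (u v : forall x, R x) : pt i (fun x => Atom (u x)) -> pt i (fun x => Atom (v x)) ->
  pt i (fun x => tbool (R x) (u x == v x)).
Proof.
move=> hu hv; apply: pt_ext (pt_and (pt_le hu hv) (pt_le hv hu)) => x.
by rewrite eq_le.
Qed.

Lemma pt_eqb i (q r : X -> bool) : pt i (fun x => tbool (R x) (q x)) ->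
  pt i (fun x => tbool (R x) (r x)) -> pt i (fun x => tbool (R x) (q x == r x)).
Proof.
move=> hq hr; apply: pt_ext (pt_ite hq hr (pt_not hr)) => x.
by case: (q x); case: (r x).
Qed.

End Boolean.

Lemma tree_size_tlist_cons (R : realFieldType) (a : tree R) l :
  tree_size (tlist (a :: l)) = tree_size a + tree_size (tlist l) + 1.
Proof. by rewrite addn1. Qed.

Lemma tree_size_tlist (R : realFieldType) (l : seq (tree R)) :
  tree_size (tlist l) = \sum_(a <- l) (tree_size a).+1 + 1.
Proof.
elim: l => [|a l IHl]; first by rewrite big_nil.
by rewrite tree_size_tlist_cons IHl big_cons; lia.
Qed.

Lemma size_tlist (R : realFieldType) (l : seq (tree R)) : size l < tree_size (tlist l).
Proof.
elim: l => [|a l IHl] //; rewrite tree_size_tlist_cons /=.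
by have := tree_size_gt0 a; lia.
Qed.

Lemma tree_size_nth (R : realFieldType) (l : seq (tree R)) j : j < size l ->
  tree_size (nth Leaf l j) <= tree_size (tlist l).
Proof.
elim: l j => //= a l IHl [|j] /= jl; first by lia.
by have := IHl j jl; lia.
Qed.

Lemma tree_size_drop (R : realFieldType) (l : seq (tree R)) j :
  tree_size (tlist (drop j l)) <= tree_size (tlist l).
Proof.
elim: l j => //= a l IHl [|j] /=; first by [].
by have := IHl j; lia.
Qed.

(** * Loops along a list *)

Section Iter.
Variables (X : Type) (R : X -> realFieldType).
Variables (i : forall x, tree (R x)) (l : forall x, seq (tree (R x))).
Variable (st : forall x, nat -> tree (R x)).

(** [st x j] is the state after [j] rounds. The loop walks down the tails of the list, and its body
    sees the input, the current element and the state. The bound on all intermediate states is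
    essential: a polynomial body may double the size of its state in every round. *)
Lemma pt_iter :
  pt i (fun x => tlist (l x)) -> pt i (fun x => st x 0) ->
  pt (fun p : {x & 'I_(size (l x))} =>
        Node (Node (i (tag p)) (nth Leaf (l (tag p)) (tagged p))) (st (tag p) (tagged p)))
     (fun p => st (tag p) (tagged p).+1) ->
  (exists c, forall x j, j <= size (l x) -> tree_size (st x j) <= pw (tree_size (i x)) c) ->
  pt i (fun x => st x (size (l x))).
Proof.
move=> [P [n1 [c1 hP]]] [Q [n2 [c2 hQ]]] [S [n3 [c3 hS]]] [c4 hc4].
pose N := (maxn n1 (maxn n2 n3)).+1.
have N1 : n1 <= N by rewrite /N; lia.
have N2 : n2 <= N by rewrite /N; lia.
have N3 : n3 <= N by rewrite /N; lia.
pose body := Seq (Assign 0 (ENode (ENode (Var N) (Left (Var N.+1))) (Var N.+2)))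
  (Seq S (Seq (Assign N.+2 (Var 0)) (Assign N.+1 (Right (Var N.+1))))).
pose cc := (maxn (maxn c1 c2) c4).+1.
pose C := maxn cc (cc.+2.+2 * c3).
have hB x : [/\ tree_size (i x) <= pw (tree_size (i x)) cc,
    pw (tree_size (i x)) c1 <= pw (tree_size (i x)) cc,
    pw (tree_size (i x)) c2 <= pw (tree_size (i x)) cc &
    pw (tree_size (i x)) c4 <= pw (tree_size (i x)) cc].
  by rewrite leq_pw // !pw_leq // /cc; lia.
have hl x : tree_size (tlist (l x)) <= pw (tree_size (i x)) cc.
  have [s' [t [_ _ _ _ z]]] := hP x (fun=> i x) erefl.
  by have [_ h _ _] := hB x; apply: leq_trans z h.
have hst x j : j <= size (l x) -> tree_size (st x j) <= pw (tree_size (i x)) cc.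
  by move=> h; have [_ _ _ h4] := hB x; apply: leq_trans (hc4 x j h) h4.
(* Induction on the number [d] of remaining rounds; each one is charged the same bound, hence the
   factor [d.+1]. *)
have loop x d : forall (s : nat -> tree (R x)) j, size (l x) - j = d -> j <= size (l x) ->
    s N = i x -> s N.+1 = tlist (drop j (l x)) -> s N.+2 = st x j ->
    exists s' t, [/\ exec (While (Var N.+1) body) s s' t, s' N.+2 = st x (size (l x)),
      forall y, N.+2 < y -> s' y = s y &
      t <= (d.+1) * pw (tree_size (i x)) (C + 5)].
  elim: d => [|d IHd] s j hd hj sN sN1 sN2.
    have jE : j = size (l x) by lia.
    exists s, (eval_time s (Var N.+1)); split=> //.
    - by apply: ExecWhileFalse; rewrite /= sN1 jE drop_size.
    - by rewrite sN2 jE.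
    - by rewrite /= sN1 jE drop_size /= addn0 mul1n pw_gt0.
  have jl : j < size (l x) by lia.
  pose p : {x & 'I_(size (l x))} := Tagged (fun x => 'I_(size (l x))) (Ordinal jl).
  have sN1' : s N.+1 = Node (nth Leaf (l x) j) (tlist (drop j.+1 (l x))).
    by rewrite sN1 (drop_nth Leaf jl).
  pose inp := Node (Node (i x) (nth Leaf (l x) j)) (st x j).
  pose s1 := update s 0 inp.
  have [|s2 [t2 [e2 o2 k2 b2 z2]]] := hS p s1; first by rewrite /s1 /update.
  rewrite /= in o2 b2.
  pose s3 := update (update s2 N.+2 (st x j.+1)) N.+1 (tlist (drop j.+1 (l x))).
  have E0 y : N <= y -> s2 y = s y.
    by move=> hy; rewrite k2 ?(leq_trans N3) // /s1 /update gtn_eqF // (leq_trans _ hy).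
  have [s4 [t4 [e4 o4 k4 b4]]] := IHd s3 j.+1 ltac:(lia) jl
    ltac:(by rewrite /s3 /update (ltn_eqF (ltnSn N)) (@ltn_eqF N N.+2) ?E0)
    ltac:(by rewrite /s3 /update eqxx) ltac:(by rewrite /s3 /update eqxx gtn_eqF).
  eexists; eexists; split.
  - apply: ExecWhileTrue; first by rewrite /= sN1'.
      apply: ExecSeq; first exact: ExecAssign.
      have -> : eval s (ENode (ENode (Var N) (Left (Var N.+1))) (Var N.+2)) = inp.
        by rewrite /= sN sN1' sN2.
      apply: ExecSeq; first exact: e2.
      apply: ExecSeq; first exact: ExecAssign.
      exact: ExecAssign.
    have -> : eval (update s2 N.+2 (eval s2 (Var 0))) (Right (Var N.+1)) =
        tlist (drop j.+1 (l x)).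
      by rewrite /= /update (ltn_eqF (ltnSn N.+1)) E0 ?sN1'.
    rewrite [eval s2 (Var 0)]o2; exact: e4.
  - exact: o4.
  - move=> y hy; rewrite k4 // /s3 /update (@gtn_eqF N.+1) ?(@gtn_eqF N.+2) ?E0 //; lia.
  - rewrite [X in _ <= X]mulSn [X in X <= _]addnC.
    rewrite [X in _ <= X]addnC; apply: leq_add; first exact: b4.
    rewrite !eval_time_node /= /update ltn_eqF // [s2 N.+1]E0 // sN sN1' sN2 o2 /=.
    rewrite !addn0.
    have [I1 I2 I3 I4] := hB x.
    have Hl := hl x; have Hd := tree_size_drop (l x) j.
    rewrite (drop_nth Leaf jl) /= in Hd.
    have Hs := hst x j hj; have Hs1 := hst x j.+1 jl.
    have Ht : t2 <= pw (tree_size (i x)) (cc.+2.+2 * c3).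
      apply: leq_trans b2 _; apply: leq_trans (pw_pw _ _ _).
      apply: pw_leq => //=.
      have := pw_mulX (tree_size (i x)) cc 2; rewrite addn2.
      have := pw_gt0 (tree_size (i x)) cc.
      have := tree_size_nth jl. lia.
    have := pw_leq (leqnn (tree_size (i x))) (leq_maxl cc (cc.+2.+2 * c3)).
    have := pw_leq (leqnn (tree_size (i x))) (leq_maxr cc (cc.+2.+2 * c3)).
    rewrite -/C => ? ?.
    have := pw_mulX (tree_size (i x)) C 5; have := pw_gt0 (tree_size (i x)) C.
    lia.
exists (Seq (Assign N (Var 0)) (Seq P (Seq (Assign N.+1 (Var 0)) (Seq (Assign 0 (Var N))
  (Seq Q (Seq (Assign N.+2 (Var 0)) (Seq (While (Var N.+1) body) (Assign 0 (Var N.+2))))))))),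
  N.+3, (cc + (C + 5) + 4) => x s si.
pose s1 := update s N (i x).
have [|s2 [t2 [e2 o2 k2 b2 z2]]] := hP x s1; first by rewrite /s1 /update.
pose s3 := update s2 N.+1 (tlist (l x)).
pose s4 := update s3 0 (i x).
have s2N : s2 N = i x by rewrite k2 // /s1 /update eqxx.
have s40 : s4 0 = i x by rewrite /s4 /update.
have s4N : s4 N = i x by rewrite /s4 /s3 /update (ltn_eqF (ltnSn N)).
have s4N1 : s4 N.+1 = tlist (l x) by rewrite /s4 /s3 /update eqxx.
have [s5 [t5 [e5 o5 k5 b5 z5]]] := hQ x s4 s40.
pose s6 := update s5 N.+2 (st x 0).
have s6N : s6 N = i x.
  by rewrite /s6 /update (@ltn_eqF N N.+2) // k5 // s4N.
have s6N1 : s6 N.+1 = tlist (drop 0 (l x)).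
  by rewrite /s6 /update (ltn_eqF (ltnSn N.+1)) k5 ?drop0 // (leq_trans N2).
have s6N2 : s6 N.+2 = st x 0 by rewrite /s6 /update eqxx.
have [s7 [t7 [e7 o7 k7 b7]]] :=
  loop x (size (l x)) s6 0 (subn0 _) (leq0n _) s6N s6N1 s6N2.
eexists; eexists; split.
- apply: ExecSeq; first exact: ExecAssign.
  apply: ExecSeq; first by rewrite /= si; exact: e2.
  apply: ExecSeq; first by apply: ExecAssign.
  apply: ExecSeq; first by apply: ExecAssign.
  have -> : update (update s2 N.+1 (eval s2 (Var 0))) 0
     (eval (update s2 N.+1 (eval s2 (Var 0))) (Var N)) = s4 :> (nat -> tree (R x)).
    have E1 : update s2 N.+1 (s2 0) N = i x by rewrite /update ltn_eqF // s2N.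
    by rewrite [eval _ (Var N)]E1 /= o2.
  apply: ExecSeq; first exact: e5.
  apply: ExecSeq; first exact: ExecAssign.
  rewrite [eval _ _]o5.
  apply: ExecSeq; first exact: e7.
  exact: ExecAssign.
- exact: o7.
- move=> y hy; rewrite /update gtn_eqF; last by lia.
  rewrite k7; last by lia.
  rewrite /s6 /s4 /s3 /update gtn_eqF; last by lia.
  rewrite k5; last by lia.
  rewrite /s4 /s3 /update !gtn_eqF; [|lia..].
  rewrite k2; last by lia.
  by rewrite /s1 /update gtn_eqF; last by lia.
- rewrite /= !addn0 si /update /= [N == N.+1]ltn_eqF // s2N o2 o5 o7.
  have [I1 I2 I3 I4] := hB x.
  have Hl := hl x; have Hs := hst x _ (leqnn _); have H0 := hst x _ (leq0n _).
  have b7' : t7 <= pw (tree_size (i x)) (cc + (C + 5)).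
    apply: leq_trans b7 _; rewrite -(pwM _ cc) leq_mul2r; apply/orP; right.
    exact: leq_trans (size_tlist _) Hl.
  have : pw (tree_size (i x)) cc <= pw (tree_size (i x)) (cc + (C + 5)).
    by apply: pw_leq; lia.
  have := pw_mulX (tree_size (i x)) (cc + (C + 5)) 4.
  by have := pw_gt0 (tree_size (i x)) (cc + (C + 5)); lia.
- apply: leq_trans (hst x _ (leqnn _)) _; apply: pw_leq => //; lia.
Qed.

End Iter.

(** * Folds, maps, filters and sums over lists *)

Section Lists.
Variables (X : Type) (R : X -> realFieldType) (Y : X -> Type).
Variables (i : forall x, tree (R x)) (ys : forall x, seq (Y x)) (e : forall x, Y x -> tree (R x)).
Hypothesis ptys : pt i (fun x => tlist [seq e y | y <- ys x]).

(** The step function must be computable on arbitrary accumulators, but the size bound concerns only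
    the accumulators that occur, which are the folds of the prefixes [take j]. *)
Lemma pt_foldl (A : X -> Type) (eA : forall x, A x -> tree (R x))
    (f : forall x, A x -> Y x -> A x) (a0 : forall x, A x) :
  pt i (fun x => eA x (a0 x)) ->
  pt (fun p : {x & (A x * Y x)%type} =>
        Node (Node (i (tag p)) (e (tagged p).2)) (eA (tag p) (tagged p).1))
     (fun p => eA (tag p) (f (tag p) (tagged p).1 (tagged p).2)) ->
  (exists c, forall x j, tree_size (eA x (foldl (f x) (a0 x) (take j (ys x))))
     <= pw (tree_size (i x)) c) ->
  pt i (fun x => eA x (foldl (f x) (a0 x) (ys x))).
Proof.
move=> h0 hf [c hc].
pose st x j := eA x (foldl (f x) (a0 x) (take j (ys x))).
have := @pt_iter X R i (fun x => [seq e y | y <- ys x]) st ptys.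
have E0 x : st x 0 = eA x (a0 x) by rewrite /st take0.
move=> /(_ (pt_ext (fun x => esym (E0 x)) h0)) H.
apply: pt_ext (H _ _) => [x||].
- by rewrite /st size_map take_size.
(* [tnth] avoids a default element, which the arbitrary type [Y x] need not have. *)
- pose y (p : {x & 'I_(size [seq e y | y <- ys x])}) :=
    tnth (in_tuple (ys (tag p))) (cast_ord (size_map _ _) (tagged p)).
  pose g (p : {x & 'I_(size [seq e y | y <- ys x])}) : {x & (A x * Y x)%type} :=
    Tagged _ (foldl (f (tag p)) (a0 (tag p)) (take (tagged p) (ys (tag p))), y p).
  refine (@pt_conv _ (fun p : {x & 'I_(size [seq e y | y <- ys x])} => R (tag p)) _ _ _ _
    _ _ (pt_reindex g hf)) => -[x j] /=.
  + congr (Node (Node _ _) _).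
    have jl : j < size (ys x) by rewrite -(size_map (@e x)); apply: ltn_ord.
    have Y0 d : y (Tagged _ j) = nth d (ys x) j by rewrite /y (tnth_nth d).
    by rewrite (nth_map (y (Tagged _ j))) // -Y0.
  + rewrite /st; congr (eA x _).
    have jl : j < size (ys x) by rewrite -(size_map (@e x)); apply: ltn_ord.
    have Y0 d : y (Tagged _ j) = nth d (ys x) j by rewrite /y (tnth_nth d).
    by rewrite (take_nth (y (Tagged _ j))) // -cats1 foldl_cat /= -Y0.
- by exists c => x j _; apply: hc.
Qed.

End Lists.

Lemma size_take_leq (T : Type) (s : seq T) j : size (take j s) <= size s.
Proof. by rewrite size_take; case: ltnP => // /ltnW. Qed.

Lemma tlist_rev_size (R : realFieldType) (l : seq (tree R)) :
  tree_size (tlist (rev l)) = tree_size (tlist l).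
Proof.
rewrite !tree_size_tlist; congr (_ + _).
elim: l => //= a l IHl.
by rewrite rev_cons -cats1 big_cat /= !big_cons big_nil IHl addn0 addnC.
Qed.

Lemma tlist_cat_size (R : realFieldType) (l l' : seq (tree R)) :
  tree_size (tlist (l ++ l')) <= tree_size (tlist l) + tree_size (tlist l').
Proof. by rewrite !tree_size_tlist big_cat /=; lia. Qed.

Lemma tlist_catl_size (R : realFieldType) (l l' : seq (tree R)) :
  tree_size (tlist l) <= tree_size (tlist (l ++ l')).
Proof. by rewrite !tree_size_tlist big_cat /=; lia. Qed.

Lemma tlist_take_size (R : realFieldType) (l : seq (tree R)) j :
  tree_size (tlist (take j l)) <= tree_size (tlist l).
Proof. by rewrite -{2}(cat_take_drop j l) tlist_catl_size. Qed.

Lemma tlist_filter_size (R : realFieldType) Y (e : Y -> tree R) (q : pred Y) l :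
  tree_size (tlist [seq e y | y <- l & q y]) <= tree_size (tlist [seq e y | y <- l]).
Proof. by elim: l => //= y l IHl; case: (q y) => /=; lia. Qed.

Lemma foldl_rev_map A B (g : A -> B) l a :
  foldl (fun a y => g y :: a) a l = rev (map g l) ++ a.
Proof. by elim: l a => //= y l IHl a; rewrite IHl rev_cons cat_rcons. Qed.

Section Lists2.
Variables (X : Type) (R : X -> realFieldType).

Lemma pt_rev (i : forall x, tree (R x)) (l : forall x, seq (tree (R x))) :
  pt i (fun x => tlist (l x)) -> pt i (fun x => tlist (rev (l x))).
Proof.
move=> hl; have [c hc] := pt_size hl.
have hl' : pt i (fun x => tlist [seq y | y <- l x]).
  by apply: pt_ext hl => x; rewrite map_id.
have E x m : foldl (fun a y => y :: a) [::] m = rev m :> seq (tree (R x)).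
  by rewrite (foldl_rev_map id) map_id cats0.
have := @pt_foldl X R _ i _ _ hl' (fun x => seq (tree (R x))) (fun x => @tlist (R x))
  (fun x a y => y :: a) (fun x => [::]) (pt_leaf _).
move=> H; apply: pt_ext (H _ _) => [x||].
- by rewrite E.
- apply: pt_pair.
    exact: (pt_expr _ (e := Right (Left (Var 0)))).
  exact: (pt_expr _ (e := Right (Var 0))).
- exists c => x j; rewrite E tlist_rev_size.
  by apply: leq_trans (tlist_take_size _ _) (hc x).
Qed.

Variables (Y : X -> Type).
Variables (i : forall x, tree (R x)) (ys : forall x, seq (Y x)) (e : forall x, Y x -> tree (R x)).
Hypothesis ptys : pt i (fun x => tlist [seq e y | y <- ys x]).

Notation inp := (fun p : {x & Y x} => Node (i (tag p)) (e (tagged p))).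

Lemma step_inp (A : X -> Type) (eA : forall x, A x -> tree (R x)) (g : forall x, Y x -> tree (R x)) :
  pt inp (fun p => g (tag p) (tagged p)) ->
  pt (fun p : {x & (A x * Y x)%type} =>
        Node (Node (i (tag p)) (e (tagged p).2)) (eA (tag p) (tagged p).1))
     (fun p => g (tag p) (tagged p).2).
Proof.
move=> hg; pose h (p : {x & (A x * Y x)%type}) : {x & Y x} := Tagged _ (tagged p).2.
apply: pt_comp (pt_reindex h hg).
exact: (pt_expr _ (e := Left (Var 0))).
Qed.

Lemma step_acc (A : X -> Type) (eA : forall x, A x -> tree (R x)) :
  pt (fun p : {x & (A x * Y x)%type} =>
        Node (Node (i (tag p)) (e (tagged p).2)) (eA (tag p) (tagged p).1))
     (fun p => eA (tag p) (tagged p).1).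
Proof. exact: (pt_expr _ (e := Right (Var 0))). Qed.

Lemma step_elt (A : X -> Type) (eA : forall x, A x -> tree (R x)) :
  pt (fun p : {x & (A x * Y x)%type} =>
        Node (Node (i (tag p)) (e (tagged p).2)) (eA (tag p) (tagged p).1))
     (fun p => e (tagged p).2).
Proof. exact: (pt_expr _ (e := Right (Left (Var 0)))). Qed.

(** Every [e y] is part of the encoded list, so each [g x y] is polynomial in the size of [i x], and
    the number of elements is bounded as well. Stated for prefixes, since these bound the
    accumulators of a fold. *)
Lemma sum_poly (g : forall x, Y x -> tree (R x)) : pt inp (fun p => g (tag p) (tagged p)) ->
  exists c, forall x j, tree_size (tlist [seq g x y | y <- take j (ys x)])
    <= pw (tree_size (i x)) c.
Proof.
move=> /pt_size [c hc]; have [d hd] := pt_size ptys.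
exists ((d.+3).+2 * c + d + 2) => x j.
have B y l : (exists k1 k2, l = k1 ++ y :: k2) -> tree_size (tlist [seq e y | y <- l]) <= pw (tree_size (i x)) d ->
    tree_size (g x y) <= pw (tree_size (i x)) ((d.+3).+2 * c).
  move=> [k1 [k2 ->]] hl; apply: leq_trans (hc (Tagged Y y)) _.
  apply: leq_trans (pw_pw _ _ _); apply: pw_leq => //=.
  rewrite map_cat tree_size_tlist big_cat /= big_cons in hl.
  have h1 : tree_size (i x) <= pw (tree_size (i x)) 1 by apply: leq_pw.
  have h2 : pw (tree_size (i x)) 1 <= pw (tree_size (i x)) d.+1 by apply: pw_leq.
  have := pw_mulX (tree_size (i x)) d 1; have := pw_mulX (tree_size (i x)) d.+1 2.
  rewrite addn1 addn2; have := pw_gt0 (tree_size (i x)) d; lia.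
have H (l : seq (Y x)) : tree_size (tlist [seq e y | y <- l]) <= pw (tree_size (i x)) d ->
    tree_size (tlist [seq g x y | y <- l]) <= (size l) * (pw (tree_size (i x)) ((d.+3).+2 * c)).+1 + 1.
  move=> hl; have {}B y k1 k2 : l = k1 ++ y :: k2 -> tree_size (g x y) <= pw (tree_size (i x)) ((d.+3).+2 * c).
    by move=> E; apply: (B y l) => //; exists k1, k2.
  elim: l B {hl} => //= y l IHl B.
  have IH := IHl (fun z k1 k2 E => B z (y :: k1) k2 ltac:(by rewrite E)).
  by have := B y [::] l erefl; lia.
apply: leq_trans (H _ _) _.
  by rewrite map_take; apply: leq_trans (tlist_take_size _ _) (hd x).
have sl : size (take j (ys x)) < pw (tree_size (i x)) d.
  apply: leq_ltn_trans (size_take_leq _ _) _.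
  by rewrite -(size_map (@e x)); apply: leq_trans (size_tlist _) (hd x).
set z := size _ in sl *; set m := (d.+3).+2 * c.
have: z.+1 * pw (tree_size (i x)) m <= pw (tree_size (i x)) d * pw (tree_size (i x)) m.
  by rewrite leq_mul2r sl orbT.
rewrite pwM [d + m]addnC.
have := pw_mulX (tree_size (i x)) (m + d) 2.
have := pw_gt0 (tree_size (i x)) m.
have : pw (tree_size (i x)) d <= pw (tree_size (i x)) (m + d) by apply: pw_leq; lia.
lia.
Qed.

(** The fold pushes results in front, so it produces the list backwards and a reversal follows. *)
Lemma pt_map (g : forall x, Y x -> tree (R x)) : pt inp (fun p => g (tag p) (tagged p)) ->
  pt i (fun x => tlist [seq g x y | y <- ys x]).
Proof.
move=> hg; have [c hc] := sum_poly hg.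
suff: pt i (fun x => tlist (rev [seq g x y | y <- ys x])).
  by move/pt_rev; apply: pt_ext => x; rewrite revK.
have := @pt_foldl X R _ i _ _ ptys (fun x => seq (tree (R x))) (fun x => @tlist (R x))
  (fun x a y => g x y :: a) (fun x => [::]) (pt_leaf _).
move=> H; apply: pt_ext (H _ _) => [x||].
- by rewrite foldl_rev_map cats0.
- apply: pt_pair; first exact: (@step_inp (fun x => seq (tree (R x))) (fun x => @tlist (R x)) g hg).
  exact: (@step_acc (fun x => seq (tree (R x))) (fun x => @tlist (R x))).
- by exists c => x j; rewrite foldl_rev_map cats0 tlist_rev_size.
Qed.

Lemma pt_filter (q : forall x, Y x -> bool) :
  pt inp (fun p => tbool (R (tag p)) (q (tag p) (tagged p))) ->
  pt i (fun x => tlist [seq e y | y <- ys x & q x y]).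
Proof.
move=> hq; have [c hc] := pt_size ptys.
suff: pt i (fun x => tlist (rev [seq e y | y <- ys x & q x y])).
  by move/pt_rev; apply: pt_ext => x; rewrite revK.
have := @pt_foldl X R _ i _ _ ptys (fun x => seq (tree (R x))) (fun x => @tlist (R x))
  (fun x a y => if q x y then e y :: a else a) (fun x => [::]) (pt_leaf _).
have E x a l : foldl (fun a y => if q x y then e y :: a else a) a l =
     rev [seq e y | y <- l & q x y] ++ a.
  by elim: l a => //= y l IHl a; rewrite IHl; case: (q x y); rewrite //= rev_cons cat_rcons.
move=> H; apply: pt_ext (H _ _) => [x||].
- by rewrite E cats0.
- apply: (@pt_ext _ _ _ (fun p => if q (tag p) (tagged p).2
    then Node (e (tagged p).2) (tlist (tagged p).1) else tlist (tagged p).1)).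
    by move=> p; case: ifP.
  apply: pt_ite; last exact: (@step_acc (fun x => seq (tree (R x))) (fun x => @tlist (R x))).
    exact: (@step_inp (fun x => seq (tree (R x))) (fun x => @tlist (R x))
      (fun x y => tbool (R x) (q x y)) hq).
  apply: pt_pair; first exact: (@step_elt (fun x => seq (tree (R x))) (fun x => @tlist (R x))).
  exact: (@step_acc (fun x => seq (tree (R x))) (fun x => @tlist (R x))).
- exists c => x j; rewrite E cats0 tlist_rev_size.
  apply: leq_trans (tlist_filter_size _ _ _) _.
  by rewrite map_take; apply: leq_trans (tlist_take_size _ _) (hc x).
Qed.

Lemma bool_size_poly (q : forall x, nat -> bool) :
  exists c, forall x j, tree_size (tbool (R x) (q x j)) <= pw (tree_size (i x)) c.
Proof.
exists 2 => x j; apply: (@leq_trans 3); first by case: (q x j).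
by rewrite /pw; have := tree_size_gt0 (i x); case: (tree_size (i x)) => // n _; lia.
Qed.

Lemma pt_has (q : forall x, Y x -> bool) :
  pt inp (fun p => tbool (R (tag p)) (q (tag p) (tagged p))) ->
  pt i (fun x => tbool (R x) (has (q x) (ys x))).
Proof.
move=> hq.
have E x a l : foldl (fun a y => a || q x y) a l = a || has (q x) l.
  by elim: l a => /= [a|y l IHl a]; rewrite ?orbF // IHl orbA.
have := @pt_foldl X R _ i _ _ ptys (fun x => bool) (fun x => tbool (R x))
  (fun x a y => a || q x y) (fun x => false) (pt_leaf _).
move=> H; apply: pt_ext (H _ _) => [x||].
- by rewrite E.
- apply: pt_or; first exact: (@step_acc (fun x => bool) (fun x => tbool (R x))).
  exact: (@step_inp (fun x => bool) (fun x => tbool (R x)) (fun x y => tbool (R x) (q x y)) hq).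
- exact: (bool_size_poly (fun x j => foldl _ _ (take j _))).
Qed.

Lemma pt_all (q : forall x, Y x -> bool) :
  pt inp (fun p => tbool (R (tag p)) (q (tag p) (tagged p))) ->
  pt i (fun x => tbool (R x) (all (q x) (ys x))).
Proof.
move=> hq; apply: pt_ext (pt_not (@pt_has (fun x y => ~~ q x y) (pt_not hq))) => x.
rewrite -all_predC; congr (tbool _ _); apply: eq_all => y /=; exact: negbK.
Qed.

Lemma pt_sum (g : forall x, Y x -> R x) : pt i (fun x => Atom 0%R) ->
  pt inp (fun p => Atom (g (tag p) (tagged p))) ->
  pt i (fun x => Atom (\sum_(y <- ys x) g x y)%R).
Proof.
move=> h0 hg.
have E x a l : foldl (fun a y => a + g x y)%R a l = (a + \sum_(y <- l) g x y)%R.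
  by elim: l a => /= [a|y l IHl a]; rewrite ?big_nil ?addr0 // IHl big_cons addrA.
have := @pt_foldl X R _ i _ _ ptys (fun x => R x) (fun x a => Atom a)
  (fun x a y => a + g x y)%R (fun x => 0%R) h0.
move=> H; apply: pt_ext (H _ _) => [x||].
- by rewrite E add0r.
- apply: pt_add; first exact: (@step_acc (fun x => R x) (fun x a => Atom a)).
  exact: (@step_inp (fun x => R x) (fun x a => Atom a) (fun x y => Atom (g x y)) hg).
(* An atom has size 1 whatever number it holds. *)
- by exists 0.
Qed.

Lemma pt_head (d : forall x, Y x) : pt i (fun x => e (d x)) ->
  pt i (fun x => e (head (d x) (ys x))).
Proof.
move=> hd; have hn : pt i (fun x => tbool (R x) (has predT (ys x))).
  by apply: pt_has; apply: pt_true.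
apply: pt_ext (pt_ite hn (pt_left ptys) hd) => x.
by case: (ys x).
Qed.

Lemma pt_cat (l : forall x, seq (Y x)) : pt i (fun x => tlist [seq e y | y <- l x]) ->
  pt i (fun x => tlist [seq e y | y <- ys x ++ l x]).
Proof.
move=> hl; have [c hc] := pt_size ptys; have [c' hc'] := pt_size hl.
have hr : pt i (fun x => tlist [seq e y | y <- rev (ys x)]).
  by apply: pt_ext (pt_rev ptys) => x; rewrite map_rev.
have E x (a m : seq (Y x)) : foldl (fun a y => y :: a) a m = rev m ++ a.
  by rewrite (foldl_rev_map id) map_id.
have := @pt_foldl X R _ i _ _ hr (fun x => seq (Y x)) (fun x l => tlist [seq e y | y <- l])
  (fun x a y => y :: a) l hl.
move=> H; apply: pt_ext (H _ _) => [x||].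
- by rewrite E revK.
- apply: pt_pair.
    exact: (@step_elt (fun x => seq (Y x)) (fun x l => tlist [seq e y | y <- l])).
  exact: (@step_acc (fun x => seq (Y x)) (fun x l => tlist [seq e y | y <- l])).
- exists (maxn c c').+1 => x j; rewrite E map_cat.
  apply: leq_trans (tlist_cat_size _ _) _; rewrite map_rev tlist_rev_size map_take map_rev.
  apply: leq_trans (pwD _ (leq_maxl c c') (leq_maxr c c')).
  rewrite leq_add ?hc' //; apply: leq_trans (tlist_take_size _ _) _.
  by rewrite tlist_rev_size.
Qed.

End Lists2.

Section Lists3.
Variables (X : Type) (R : X -> realFieldType) (Y : X -> Type).
Variables (i : forall x, tree (R x)) (ys : forall x, seq (Y x)) (e : forall x, Y x -> tree (R x)).
Notation inp := (fun p : {x & Y x} => Node (i (tag p)) (e (tagged p))).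

Lemma pt_flatten (Z : X -> Type) (eZ : forall x, Z x -> tree (R x)) (g : forall x, Y x -> seq (Z x)) :
  pt i (fun x => tlist [seq e y | y <- ys x]) ->
  pt inp (fun p => tlist [seq eZ _ z | z <- g (tag p) (tagged p)]) ->
  pt i (fun x => tlist [seq eZ x z | z <- flatten [seq g x y | y <- ys x]]).
Proof.
move=> ptys hg.
have [c hc] := sum_poly ptys (g := fun x y => tlist [seq eZ x z | z <- g x y]) hg.
pose eA x l := tlist [seq eZ x z | z <- l].
have E x a m : foldl (fun a y => a ++ g x y) a m = a ++ flatten [seq g x y | y <- m].
  by elim: m a => /= [a|y m IHm a]; rewrite ?cats0 // IHm catA.
have := @pt_foldl X R _ i _ _ ptys (fun x => seq (Z x)) eA
  (fun x a y => a ++ g x y) (fun x => [::]) (pt_leaf _).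
move=> H; apply: pt_ext (H _ _) => [x||].
- by rewrite /eA E.
- apply: (@pt_cat _ _ (fun p => Z (tag p)) _ (fun p => (tagged p).1) (fun p => @eZ (tag p)) _ (fun p => g (tag p) (tagged p).2)).
    exact: (@step_acc _ _ _ i e (fun x => seq (Z x)) eA).
  exact: (@step_inp _ _ _ i e (fun x => seq (Z x)) eA (fun x y => tlist [seq eZ x z | z <- g x y]) hg).
- exists c => x j; rewrite E /eA /=; apply: leq_trans (hc x j).
  elim: (take j _) => //= y m IHm; rewrite map_cat.
  by apply: leq_trans (tlist_cat_size _ _) _; lia.
Qed.

Lemma pt_weak (o : forall x, tree (R x)) : pt i o -> pt inp (fun p => o (tag p)).
Proof.
move=> ho; apply: pt_comp (pt_reindex (fun p : {x & Y x} => tag p) ho).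
exact: (pt_expr _ (e := Left (Var 0))).
Qed.

Lemma pt_arg : pt inp (fun p => e (tagged p)).
Proof. exact: (pt_expr _ (e := Right (Var 0))). Qed.

End Lists3.

(** * Matroids and chordless paths *)

Record matroid (T : finType) := Matroid {
  ind : pred {set T};
  ind_set0 : ind set0;
  ind_sub : forall A B : {set T}, A \subset B -> ind B -> ind A;
  ind_aug : forall A B : {set T}, ind A -> ind B -> #|A| < #|B| ->
    exists2 x, x \in B :\: A & ind (x |: A) }.

(** * Closure, circuits and symmetric exchange *)

Section Matroid.
Variables (T : finType) (M : matroid T).
Implicit Types (A B C I J S : {set T}) (x y : T).

(** For independent [A], this says that [x] lies in the span of [A]. *)
Definition cl A x := (x \in A) || ~~ ind M (x |: A).

Lemma ind_card A J : ind M A -> ind M J -> (forall x, x \in J -> cl A x) -> #|J| <= #|A|.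
Proof.
move=> iA iJ h; rewrite leqNgt; apply/negP => /(ind_aug iA iJ) [x].
by rewrite inE => /andP[xA /h]; rewrite /cl (negbTE xA) /= => /negbTE->.
Qed.

Lemma ind_extend S A : ind M S -> ind M A ->
  exists S', [/\ S \subset S', S' \subset S :|: A, ind M S' & #|A| <= #|S'|].
Proof.
move=> + iA; have [n] := ubnP (#|A| - #|S|); elim: n S => // n IHn S hn iS.
case: (leqP #|A| #|S|) => [AS|SA]; first by exists S; split=> //; apply: subsetUl.
have [x] := ind_aug iS iA SA; rewrite inE => /andP[xS xA] ixS.
have [|S' [S1 S2 S3 S4]] := IHn (x |: S) _ ixS.
  by rewrite cardsU1 xS; lia.
exists S'; split=> //; first by apply: subset_trans S1; apply: subsetUr.
apply: subset_trans S2 _; rewrite subUset subsetUr andbT subUset subsetUl andbT.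
by rewrite sub1set inE xA orbT.
Qed.

(** Extend [S] inside [S :|: A] to an independent [S'] with at least [#|A|] elements. If [x |: A]
    were independent, it would augment [S'], either by [x], against the dependence of [x |: S], or
    by an element of [A], giving an independent set in the span of [A] with more elements than
    [A]. *)
Lemma cl_trans A S x : ind M A -> ind M S -> (forall s, s \in S -> cl A s) ->
  ~~ ind M (x |: S) -> cl A x.
Proof.
move=> iA iS hS dx; apply/negPn; rewrite /cl negb_or negbK; apply/negP => /andP[xA ixA].
have [S' [S1 S2 iS' cS']] := ind_extend iS iA.
have hS' s : s \in S' -> cl A s.
  move=> /(subsetP S2); rewrite inE => /orP[/hS //|sA].
  by rewrite /cl sA.
have cS'2 := ind_card iA iS' hS'.
have [|y] := ind_aug iS' ixA; first by rewrite cardsU1 xA.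
rewrite !inE => /andP[yS' /orP[/eqP->|yA]] iy.
  by move: dx; rewrite (ind_sub _ iy) // setUS.
have /(ind_card iA iy) : forall z, z \in y |: S' -> cl A z.
  by move=> z; rewrite !inE => /orP[/eqP->|/hS' //]; rewrite /cl yA.
by rewrite cardsU1 yS' add1n ltnNge cS'.
Qed.

(** [C] is an inclusion-minimal subset of [I] that is dependent together with [x], the fundamental
    circuit without [x]. Were [x |: I :\ y] dependent for some [y] of [C], then [x], and through the
    circuit also [y], would be in the span of [I :\ y]. *)
Lemma fund_circuit I x : ind M I -> ~~ ind M (x |: I) ->
  exists C, [/\ C \subset I, ~~ ind M (x |: C) & forall y, y \in C -> ind M (x |: I :\ y)].
Proof.
move=> iI dI; have xI : x \notin I by apply: contra dI => xI; rewrite (setUidPr _) ?sub1set.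
have [C /minsetP[dC minC] CI] := minset_exists (P := fun C => ~~ ind M (x |: C)) dI.
exists C; split=> // y yC; apply/negPn/negP => dy.
have yI := subsetP CI _ yC.
have iA : ind M (I :\ y) by apply: ind_sub iI; apply: subD1set.
have iS : ind M (x |: C :\ y).
  apply/negPn/negP => dS; have /setP/(_ y) := minC _ dS (subD1set _ _).
  by rewrite !inE eqxx yC.
have xy : x != y by apply: contraNneq xI => ->.
have : cl (I :\ y) y.
  apply: (cl_trans iA iS); last first.
    by rewrite setUCA setD1K // dC.
  move=> s; rewrite 2!inE => /orP[/eqP->|]; first by rewrite /cl dy orbT.
  by rewrite !inE => /andP[sy sC]; rewrite /cl !inE sy (subsetP CI).
by rewrite /cl !inE eqxx /= setD1K // iI.
Qed.

(** If the whole fundamental circuit of [x] lay in the span of [B :\ x], then so would [x]. An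
    element of the circuit outside this span serves in both exchanges. *)
Lemma sym_exchange I B x : ind M I -> ind M B -> x \in B -> x \notin I -> ~~ ind M (x |: I) ->
  exists y, [/\ y \in I, y \notin B, ind M (x |: I :\ y) & ind M (y |: B :\ x)].
Proof.
move=> iI iB xB xI dI; have [C [CI dC hC]] := fund_circuit iI dI.
have iBx : ind M (B :\ x) by apply: ind_sub iB; apply: subD1set.
have iC : ind M C by apply: ind_sub iI.
case: (boolP [forall y in C, cl (B :\ x) y]) => [/forall_inP h|].
  have := cl_trans iBx iC h dC.
  by rewrite /cl !inE eqxx /= setD1K // iB.
rewrite negb_forall_in => /exists_inP[y yC].
rewrite /cl negb_or negbK !inE negb_and negbK => /andP[yB iy].
have yI := subsetP CI _ yC.
exists y; split=> //; last exact: hC.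
by case/orP: yB => // /eqP yx; rewrite -yx yI in xI.
Qed.

(** Truncation turns independent sets with [n] elements into bases, so that [sym_exchange] applies
    to them even when they are not maximal in [M]. *)
Definition trunc_ind n A := ind M A && (#|A| <= n).

Lemma trunc_sub n A B : A \subset B -> trunc_ind n B -> trunc_ind n A.
Proof.
move=> AB /andP[iB cB]; rewrite /trunc_ind (ind_sub AB iB).
exact: leq_trans (subset_leq_card AB) cB.
Qed.

Lemma trunc_aug n A B : trunc_ind n A -> trunc_ind n B -> #|A| < #|B| ->
    exists2 x, x \in B :\: A & trunc_ind n (x |: A).
Proof.
move=> /andP[iA cA] /andP[iB cB] AB; have [x xBA ix] := ind_aug iA iB AB.
exists x => //; rewrite /trunc_ind ix /= cardsU1.
by move: xBA; rewrite inE => /andP[-> _]; apply: leq_trans AB cB.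
Qed.

Lemma trunc_set0 n : trunc_ind n set0.
Proof. by rewrite /trunc_ind ind_set0 cards0. Qed.

Definition trunc n := Matroid (trunc_set0 n) (@trunc_sub n) (@trunc_aug n).

End Matroid.

(** * Cheapest independent sets of a given size *)

Section Weighted.
Variables (T : finType) (R : realFieldType).
Implicit Types (M : matroid T) (w : T -> R) (A B C I J S : {set T}) (x y : T).
Local Open Scope ring_scope.

(** Equivalently, by [loc_extreme] and [extreme_loc], [I] is a cheapest independent set of its
    cardinality. The local form is the one that can be checked after a change of weights. *)
Definition loc M w I := ind M I /\
  forall x y, x \notin I -> y \in I -> ind M (x |: I :\ y) -> w y <= w x.

(** A symmetric exchange moves [J] one element closer to [I]; the exchange on the side of [I] shows
    that [J] does not become dearer. *)
Lemma loc_extreme M w I J : loc M w I -> ind M J -> #|J| = #|I| ->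
  \sum_(t in I) w t <= \sum_(t in J) w t.
Proof.
move=> [iI hI]; have [n] := ubnP #|J :\: I|; elim: n J => // n IHn J hn iJ cJ.
have [J0|] := boolP (J \subset I).
  suff -> : J = I by [].
  by apply/eqP; rewrite eqEcard J0 cJ leqnn.
case/subsetPn => x xJ xI.
pose M' := trunc M #|I|.
have iI' : ind M' I by rewrite /= /trunc_ind iI /=.
have iJ' : ind M' J by rewrite /= /trunc_ind iJ /= cJ.
have [|y [yI yJ /andP[iIy _] /andP[iJx _]]] := sym_exchange iI' iJ' xJ xI.
  by rewrite /= /trunc_ind cardsU1 xI add1n ltnn andbF.
have cJx : #|y |: J :\ x| = #|I|.
  by rewrite cardsU1 !inE negb_and negbK (negbTE yJ) orbT -cJ (cardsD1 x J) xJ.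
have yx : y != x by apply: contraNneq yJ => ->.
apply: le_trans (IHn _ _ iJx cJx) _.
  have : (y |: J :\ x) :\: I \proper J :\: I.
    apply/properP; split; last by exists x; rewrite !inE ?xI ?xJ // eqxx eq_sym (negbTE yx).
    apply/subsetP => z; rewrite !inE => /andP[zI /orP[/eqP zy|/andP[_ zJ]]].
      by rewrite zy yI in zI.
    by rewrite zI zJ.
  by move=> /proper_card h; apply: leq_trans h _; rewrite -ltnS.
rewrite big_setU1 /= ?inE ?negb_and ?negbK ?(negbTE yJ) ?orbT // [leRHS](big_setD1 x) //=.
by rewrite lerD2r hI.
Qed.

Lemma extreme_loc M w I : ind M I ->
  (forall J, ind M J -> #|J| = #|I| -> \sum_(t in I) w t <= \sum_(t in J) w t) -> loc M w I.
Proof.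
move=> iI hI; split=> // x y xI yI iJ.
have xIy : x \notin I :\ y by rewrite !inE negb_and xI orbT.
have cJ : #|x |: I :\ y| = #|I| by rewrite cardsU1 xIy [in RHS](cardsD1 y) yI.
have := hI _ iJ cJ; rewrite big_setU1 //= [leLHS](big_setD1 y) //=.
by rewrite lerD2r.
Qed.

(** Some [z] of [J] extends [I]; it weighs at least [w x0], and what is left of [J] at least as much
    as [I]. *)
Lemma loc_add M w I x0 : loc M w I -> x0 \notin I -> ind M (x0 |: I) ->
  (forall x, x \notin I -> ind M (x |: I) -> w x0 <= w x) ->
  forall J, ind M J -> #|J| = #|I|.+1 -> w x0 + \sum_(t in I) w t <= \sum_(t in J) w t.
Proof.
move=> lI x0I ix0 hx0 J iJ cJ; have [iI _] := lI.
have [|z] := ind_aug iI iJ; first by rewrite cJ.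
rewrite inE => /andP[zI zJ] iz.
rewrite [leRHS](big_setD1 z) //=; apply: lerD; first exact: hx0.
apply: (loc_extreme lI); first by apply: ind_sub iJ; apply: subD1set.
by apply: succn_inj; rewrite -cJ [in RHS](cardsD1 z) zJ.
Qed.

(** * Augmentation by an exchange without shortcuts *)

Section Augment.
Variables (M : matroid T) (w : T -> R) (I Y : {set T}) (x0 : T) (f : T -> T) (rho : T -> nat).
Hypothesis lI : loc M w I.
Hypothesis x0I : x0 \notin I.
Hypothesis ix0 : ind M (x0 |: I).
Hypothesis YI : Y \subset I.
Hypothesis fI : forall y, y \in Y -> f y \notin I.
Hypothesis fx0 : forall y, y \in Y -> f y != x0.
Hypothesis finj : {in Y &, injective f}.
Hypothesis fex : forall y, y \in Y -> ind M (f y |: I :\ y).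
Hypothesis fw : forall y, y \in Y -> w (f y) = w y.
Hypothesis fdep : forall y, y \in Y -> ~~ ind M (f y |: I).
Hypothesis fchord : forall y y', y \in Y -> y' \in Y -> y != y' ->
  (rho y <= rho y')%N -> w y = w y' -> ~~ ind M (f y' |: I :\ y).

Let K := x0 |: (I :\: Y) :|: f @: Y.

(** Suppose [K] contains a circuit [C]. It contains some [f y]; choose [j] with [f j] in [C], [w j]
    as large and then [rho j] as small as possible. Every other element of [C] lies in the span of
    [(x0 |: I) :\ j]: for [f y] this fails only if [f y] and [j] can be exchanged at equal weight,
    which [fchord] excludes. So [f j] lies in it too, which puts [x0] in the span of [f j |: I :\ j]
    and hence of [I]. *)
Lemma augment_ind : ind M K.
Proof.
have [iI hI] := lI; apply/negPn/negP => dK.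
have [C /minsetP[dC minC] CK] := minset_exists (P := fun C => ~~ ind M C) dK.
pose YC := [set y in Y | f y \in C].
have [YC0|[j0 j0Y]] := set_0Vmem YC.
  move: dC; rewrite (ind_sub _ ix0) //; apply/subsetP => z zC.
  have := subsetP CK _ zC; rewrite !inE => /orP[/orP[->//|/andP[_ ->]]|].
    by rewrite orbT.
  case/imsetP => y yY zE; have : y \in YC by rewrite inE yY -zE.
  by rewrite YC0 inE.
have [j [jY jC jmax]] : exists j, [/\ j \in Y, f j \in C &
    forall y, y \in Y -> f y \in C -> w y <= w j /\ (w y = w j -> (rho j <= rho y)%N)].
  have [y1 y1Y y1max] := arg_maxP w j0Y.
  have {}y1Y : y1 \in YC := y1Y.
  have y1P : (y1 \in YC) && (w y1 == w y1) by rewrite y1Y eqxx.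
  have [j /andP[jY /eqP wj] jmin] := arg_minnP (P := fun y => (y \in YC) && (w y == w y1)) rho y1P.
  exists j; move: (jY); rewrite inE => /andP[? ?]; split=> // y yY yC.
  have yYC : y \in YC by rewrite inE yY.
  by split=> [|wy]; [rewrite wj; exact: y1max | apply: jmin; rewrite yYC wy wj eqxx].
have jI := subsetP YI _ jY.
have jx0 : x0 != j by apply: contraNneq x0I => ->.
have iA : ind M ((x0 |: I) :\ j) by apply: ind_sub ix0; apply: subD1set.
have iS : ind M (C :\ f j).
  apply/negPn/negP => dS; have /setP/(_ (f j)) := minC _ dS (subD1set _ _).
  by rewrite !inE eqxx jC.
have : cl M ((x0 |: I) :\ j) (f j).
  apply: (cl_trans iA iS); last by rewrite setD1K.
  move=> s; rewrite !inE => /andP[sj sC].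
  have := subsetP CK _ sC; rewrite !inE => /orP[/orP[/eqP->|/andP[sY sI]]|].
  - by rewrite /cl !inE eqxx jx0.
  - by rewrite /cl !inE sI orbT andbT (contraNneq _ sY) // => ->.
  - case/imsetP => y yY sE.
    have [wy ry] := jmax y yY ltac:(by rewrite -sE).
    have yj : j != y by apply: contraNneq sj => ->; rewrite sE.
    apply/orP; right; rewrite sE; apply: (contra (ind_sub (A := f y |: I :\ j) _)).
      by apply: setUS; apply: setSD; apply: subsetUr.
    (* Local optimality gives [w j <= w (f y) = w y], the choice of [j] the converse. *)
    apply/negP => iy; have wjy : w j = w y.
      by apply/le_anti; rewrite wy andbT -(fw yY); apply: hI iy => //; apply: fI.
    by have := fchord jY yY yj (ry (esym wjy)) wjy; rewrite iy.
rewrite /cl !inE (negbTE (fx0 jY)) (negbTE (fI jY)) /= andbF /=; apply/negP/negPn.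
apply/negPn/negP => dx0.
have : cl M I x0.
  apply: (cl_trans iI (fex jY)).
    move=> s; rewrite 2!inE => /orP[/eqP->|]; first by rewrite /cl fdep // orbT.
    by rewrite !inE => /andP[_ sI]; rewrite /cl sI.
  apply: contra dx0; apply: ind_sub; rewrite setUCA; apply: setUS.
  by apply/subsetP => z; rewrite !inE => /andP[-> ->].
by rewrite /cl (negbTE x0I) ix0.
Qed.

Lemma augment_disjoint : [disjoint x0 |: (I :\: Y) & f @: Y].
Proof.
rewrite disjoint_sym disjoints_subset; apply/subsetP => z /imsetP[y yY ->].
by rewrite !inE (negbTE (fx0 yY)) (negbTE (fI yY)) andbF.
Qed.

Lemma augment_card : #|K| = #|I|.+1.
Proof.
have d1 := augment_disjoint.
rewrite /K cardsU disjoint_setI0 // cards0 subn0 cardsU1 !inE (negbTE x0I) andbF /=.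
by rewrite (card_in_imset finj) cardsD (setIidPr YI) -addnA subnK // subset_leq_card.
Qed.

(** [f] preserves weights, so [K] weighs [w x0] more than [I], which is the lower bound of [loc_add]
    for sets with one more element. *)
Lemma augment_loc : (forall x, x \notin I -> ind M (x |: I) -> w x0 <= w x) -> loc M w K.
Proof.
move=> hx0; apply: extreme_loc augment_ind _ => J iJ; rewrite augment_card => cJ.
apply: le_trans (loc_add lI x0I ix0 hx0 iJ cJ).
have d1 := augment_disjoint.
rewrite /K (eq_bigl [predU x0 |: I :\: Y & f @: Y]); last by move=> z; rewrite in_setU.
rewrite bigU // big_setU1 ?inE ?(negbTE x0I) ?andbF //.
rewrite big_imset //= (eq_bigr w fw) -addrA lerD2l [leRHS](big_setID Y) /=.
by rewrite (setIidPr YI) addrC.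
Qed.

End Augment.
End Weighted.

(** * Reachability and chordless paths *)

Section Reach.
Variable T : finType.
Implicit Types (r : rel T) (S Z W P : {set T}).

Definition rch r S : {set T} := [set b | [exists a in S, connect r a b]].

Definition restr W r : rel T := [rel a b | [&& r a b, a \in W & b \in W]].

Lemma rch_src r S : S \subset rch r S.
Proof. by apply/subsetP => a aS; rewrite inE; apply/exists_inP; exists a. Qed.

Lemma rch_step r S a b : a \in rch r S -> r a b -> b \in rch r S.
Proof.
rewrite !inE => /exists_inP[x xS xa] rab; apply/exists_inP; exists x => //.
exact: connect_trans xa (connect1 rab).
Qed.

Lemma rch_min r S P : S \subset P -> (forall a b, a \in P -> r a b -> b \in P) ->
  rch r S \subset P.
Proof.
move=> SP hP; apply/subsetP => b; rewrite inE => /exists_inP[a /(subsetP SP) aP].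
by case/connectP => p; elim: p a aP => [|c p IHp] a aP /= => [_ ->//|/andP[/(hP _ _ aP) cP]]; apply: IHp.
Qed.

Variables (r : rel T) (S Z : {set T}).

Definition joined W := [exists b in Z, b \in rch (restr W r) (S :&: W)].

Lemma rch_restr_mono W W' : W \subset W' ->
  rch (restr W r) (S :&: W) \subset rch (restr W' r) (S :&: W').
Proof.
move=> WW; apply: rch_min; first by apply: subset_trans (rch_src _ _); apply: setIS.
move=> a b aR /and3P[rab aW bW]; apply: rch_step aR _.
by rewrite /restr /= rab !(subsetP WW).
Qed.

Lemma joined_mono W W' : W \subset W' -> joined W -> joined W'.
Proof.
move=> /rch_restr_mono /subsetP WW /exists_inP[b bZ /WW bR].
by apply/exists_inP; exists b.
Qed.

(** Deleting every vertex that can be spared leaves the vertex set of a chordless path, as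
    [minimal_path] shows; no distances have to be computed. *)
Definition prune (l : seq T) : {set T} :=
  foldl (fun W t => if joined (W :\ t) then W :\ t else W) setT l.

(** One pass suffices: by monotonicity of [joined], a vertex that could not be deleted when its turn
    came cannot be deleted from a smaller set. *)
Lemma prune_minimal l : (forall t, t \in l) -> joined setT ->
  joined (prune l) /\ forall t, t \in prune l -> ~~ joined (prune l :\ t).
Proof.
move=> hl; rewrite /prune; move: setT => W jW.
have [H1 H2 H3] : let W' := foldl (fun W t => if joined (W :\ t) then W :\ t else W) W l in
   [/\ joined W', W' \subset W & forall t, t \in l -> t \in W' -> ~~ joined (W' :\ t)].
  elim: l {hl} W jW => //= t l IHl W jW.
  set W1 := if _ then _ else _.
  have WS : W1 \subset W by rewrite /W1; case: ifP => // _; apply: subD1set.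
  have [|/= H1 H2 H3] := IHl W1; first by rewrite /W1; case: ifP.
  split=> //; first exact: subset_trans H2 WS.
  move=> u; rewrite inE => /orP[/eqP->|/H3 //] tW.
  have tW1 := subsetP H2 _ tW.
  have nj : ~~ joined (W :\ t).
    by apply/negP => jt; move: tW1; rewrite /W1 jt !inE eqxx.
  apply: contra nj; apply: joined_mono; apply: setSD.
  exact: subset_trans H2 WS.
by split=> // t; apply: H3.
Qed.

(** A simple path from [S] to [Z] inside [W] uses all of [W]. An arc that skips vertices, a further
    source or an early sink would each leave a path that avoids a vertex of [W]. *)
Lemma minimal_path W : joined W -> (forall t, t \in W -> ~~ joined (W :\ t)) ->
  exists x0 s, let s_ := nth x0 s in [/\ 0 < size s, uniq s, W =i s,
    forall i, i.+1 < size s -> r (s_ i) (s_ i.+1) & s_ 0 \in S /\ s_ (size s).-1 \in Z] /\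
   [/\ forall i j, i.+1 < j -> j < size s -> ~~ r (s_ i) (s_ j),
       forall j, 0 < j -> j < size s -> s_ j \notin S &
       forall i, i.+1 < size s -> s_ i \notin Z].
Proof.
move=> /exists_inP[b bZ]; rewrite inE => /exists_inP[a aSW ab] minW.
case/connectP: ab bZ => p0 /shortenP[p pp up _] -> {p0} bZ.
have [aS aW] := setIP aSW.
exists a, (a :: p) => s_; set s := a :: p in s_ *.
have rs i : i.+1 < size s -> restr W r (s_ i) (s_ i.+1) by move=> hi; have /(pathP a) := pp; apply.
have sW i : i < size s -> s_ i \in W.
  by case: i => [|i] hi //; have /and3P[] := rs i hi.
(* A stretch of the path that avoids [t] remains available after the deletion of [t]. *)
have run t i j : i <= j -> j < size s -> (forall l, i <= l <= j -> s_ l != t) ->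
    s_ i \in rch (restr (W :\ t) r) (S :&: (W :\ t)) ->
    s_ j \in rch (restr (W :\ t) r) (S :&: (W :\ t)).
  elim: j => [|j IHj]; first by rewrite leqn0 => /eqP->.
  rewrite leq_eqVlt => /orP[/eqP->//|ij] js ht si.
  have sj : s_ j \in rch (restr (W :\ t) r) (S :&: (W :\ t)).
    apply: IHj => //; first exact: ltnW.
    by move=> l /andP[il lj]; apply: ht; rewrite il leqW.
  apply: rch_step sj _; have /and3P[rj w1 w2] := rs j js.
  have h1 : s_ j != t by apply: ht; rewrite -ltnS ij leqnSn.
  have h2 : s_ j.+1 != t by apply: ht; rewrite leqnn ltnW.
  by rewrite /restr /= rj !inE w1 w2 h1 h2.
have s0S t : s_ 0 != t -> s_ 0 \in rch (restr (W :\ t) r) (S :&: (W :\ t)).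
  by move=> h; apply: (subsetP (rch_src _ _)); rewrite !inE aS aW h.
have lastZ : s_ (size s).-1 \in Z by rewrite /s_ nth_last.
have jn t i : i < size s -> s_ i \in Z -> s_ i \in rch (restr (W :\ t) r) (S :&: (W :\ t)) ->
    joined (W :\ t).
  by move=> _ siZ h; apply/exists_inP; exists (s_ i).
have sneq i j : i < size s -> j < size s -> i != j -> s_ i != s_ j.
  by move=> hi hj; rewrite /s_ nth_uniq.
split; split=> //.
- move=> t; apply/idP/idP => [tW|/(nthP a)[i hi <-]]; last exact: sW.
  apply/negPn/negP => ts; have := minW t tW; rewrite (jn t (size s).-1) //.
  have st l : l < size s -> s_ l != t by move=> hl; apply: contraNneq ts => <-; apply: mem_nth.
  apply: (@run t 0 (size s).-1) => //; last exact/s0S/st.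
- by move=> i /rs /and3P[].
- move=> i j ij js; apply/negP => rij; set t := s_ i.+1.
  have tW : t \in W by apply: sW; apply: ltn_trans js.
  have := minW t tW; rewrite (jn t (size s).-1) //.
  have i1 : i.+1 < size s by apply: ltn_trans js.
  have si : s_ i \in rch (restr (W :\ t) r) (S :&: (W :\ t)).
    apply: (@run t 0 i) => // [|l /andP[_ li]|]; first exact: ltnW.
      by apply: sneq; rewrite ?(leq_ltn_trans li) ?(ltnW i1) // ltn_eqF // ltnS.
    by apply: s0S; apply: sneq.
  apply: (@run t j (size s).-1) => //.
    move=> l /andP[jl ls]; apply: sneq => //.
    by rewrite gtn_eqF // (leq_trans ij).
  have h1 : s_ i != t by apply: sneq; rewrite ?(ltnW i1) ?i1 ?ltn_eqF.
  have h2 : s_ j != t by apply: sneq; rewrite ?js ?i1 ?gtn_eqF.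
  by apply: rch_step si _; rewrite /restr /= rij !inE h1 h2 !sW // ltnW.
- move=> j j0 js; apply/negP => sjS; set t := s_ 0.
  have := minW t (sW 0 isT); rewrite (jn t (size s).-1) //.
  apply: (@run t j (size s).-1) => //.
    move=> l /andP[jl ls]; apply: sneq => //.
    by rewrite gtn_eqF // (leq_trans j0).
  apply: (subsetP (rch_src _ _)); rewrite !inE sjS sW // sneq //.
  by rewrite gtn_eqF.
- move=> i is1; apply/negP => siZ; set t := s_ (size s).-1.
  have := minW t (sW _ (leqnn _)); rewrite (jn t i (ltnW is1)) //.
  apply: (@run t 0 i) => // [|l /andP[_ li]|]; first exact: ltnW.
    apply: sneq => //; first by apply: leq_ltn_trans li _; apply: ltnW.
    by rewrite ltn_eqF // (leq_ltn_trans li).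
  by apply: s0S; apply: sneq => //; rewrite ltn_eqF // (leq_ltn_trans (leq0n i)).
Qed.

End Reach.

(** * Weighted matroid intersection *)

Section Wmi.
Variables (T : finType) (R : realFieldType) (M1 M2 : matroid T) (c : T -> R).
Local Open Scope ring_scope.
Implicit Types (I W J : {set T}) (w : T -> R).

(** The cost is split as [w] plus [compl_wt w]: [w] is used in [M1] and its complement in [M2]. *)
Definition compl_wt w t := c t - w t.

Definition free_elts (M : matroid T) I := [set x | (x \notin I) && ind M (x |: I)].

Definition min_free M I w :=
  [set x in free_elts M I | [forall y in free_elts M I, w x <= w y]].

(** Arcs of [M2] lead from outside into [I] and arcs of [M1] back out of it, so a path from a
    source, free in [M1], to a sink, free in [M2], alternates and starts and ends outside [I]. *)
Definition exch1 I : rel T := [rel a b | [&& a \in I, b \notin I & ind M1 (b |: I :\ a)]].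
Definition exch2 I : rel T := [rel a b | [&& a \notin I, b \in I & ind M2 (a |: I :\ b)]].

Definition sources I w := min_free M1 I w.
Definition sinks I w := min_free M2 I (compl_wt w).

Definition tight I w : rel T :=
  [rel a b | (exch1 I a b && (w a == w b)) || (exch2 I a b && (compl_wt w a == compl_wt w b))].

Definition reached I w := rch (tight I w) (sources I w).

Definition augmentable I w := [exists b in sinks I w, b \in reached I w].

Lemma restrT (r : rel T) : restr setT r =2 r.
Proof. by move=> a b; rewrite /restr /= !inE !andbT. Qed.

Lemma joinedT (r : rel T) S Z : joined r S Z setT = [exists b in Z, b \in rch r S].
Proof.
rewrite /joined setIT; apply: eq_existsb => b; congr (_ && _); rewrite !inE.
by apply: eq_existsb => a; rewrite (eq_connect (restrT r)).
Qed.

Definition loc2 I w := loc M1 w I /\ loc M2 (compl_wt w) I.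

Definition aug_set (l : seq T) I w : {set T} :=
  if augmentable I w then
    let W := prune (tight I w) (sources I w) (sinks I w) l in (I :\: W) :|: (W :\: I)
  else I.

Lemma min_freeP M I w x : x \in min_free M I w ->
  [/\ x \notin I, ind M (x |: I) & forall y, y \notin I -> ind M (y |: I) -> w x <= w y].
Proof.
rewrite inE => /andP[]; rewrite inE => /andP[xI ix] /forall_inP h; split=> // y yI iy.
by apply: h; rewrite inE yI.
Qed.

(* If [x] were free, [w x = w y] would make it tie with the cheapest free
   elements. *)
Lemma tight_dep M I w x0 x y : loc M w I -> x0 \in min_free M I w -> x \notin min_free M I w ->
  x \notin I -> y \in I -> w x = w y -> ~~ ind M (x |: I).
Proof.
move=> [iI hI] x0m xm xI yI wxy; apply/negP => ix; case/negP: xm.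
have [x0I ix0 hx0] := min_freeP x0m.
have wx0 : w y <= w x0.
  by apply: hI => //; apply: ind_sub ix0; apply: setUS; apply: subD1set.
rewrite !inE xI ix /=; apply/forall_inP => z; rewrite inE => /andP[zI iz].
by rewrite wxy (le_trans wx0) // hx0.
Qed.

Lemma tight_flip I w a b : tight I w a b -> (b \in I) = (a \notin I).
Proof.
by case/orP => /andP[/and3P[aI bI _] _]; rewrite ?aI ?(negbTE aI) ?(negbTE bI) ?bI.
Qed.

(** The chordless path has its vertices of even index outside [I] and the odd ones in [I]. In [M1]
    each odd vertex is replaced by its successor and the first vertex is new; in [M2] each is
    replaced by its predecessor and the last vertex is new. Both describe the symmetric difference
    of [I] with the path, to which [augment_loc] applies twice. *)
Lemma aug_set_loc l I w : (forall t, t \in l) -> augmentable I w -> loc2 I w ->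
  loc2 (aug_set l I w) w /\ #|aug_set l I w| = #|I|.+1.
Proof.
move=> hl ag [L1 L2]; rewrite /aug_set ag.
set r := tight I w; set S := sources I w; set Z := sinks I w.
have := prune_minimal (r := r) (S := S) (Z := Z) hl; rewrite joinedT => /(_ ag).
set W := prune _ _ _ _ => -[jW minW].
have [x0 [s [[s0 us Ws rs [sS sZ]] [ch chS chZ]]]] := minimal_path jW minW.
set s_ := nth x0 s in rs sS sZ ch chS chZ.
set n := size s in s0 rs ch chS chZ sZ.
have sI i : (i < n)%N -> (s_ i \in I) = odd i.
  elim: i => [|i IHi] hi; first by have [/negbTE] := min_freeP sS.
  by rewrite (tight_flip (rs i hi)) IHi // ltnW.
have [i_n iN] : (odd n.-1 = false) /\ (n.-1 < n)%N.
  have h : (n.-1 < n)%N by rewrite prednK.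
  by split=> //; rewrite -sI //; have [/negbTE] := min_freeP sZ.
have oddn : odd n by rewrite -(prednK s0) /= i_n.
have memW i : (i < n)%N -> s_ i \in W by move=> hi; rewrite Ws mem_nth.
have idx i : (i < n)%N -> index (s_ i) s = i by move=> hi; rewrite index_uniq.
have inW z : z \in W -> exists2 i, (i < n)%N & z = s_ i.
  by rewrite Ws => /(nthP x0)[i hi <-]; exists i.
pose Y := W :&: I.
have inY y : y \in Y -> exists i, [/\ (i.+1 < n)%N, (0 < i)%N, odd i & y = s_ i].
  case/setIP => /inW[i hi ->]; rewrite sI // => oi; exists i; split=> //.
    rewrite ltn_neqAle hi andbT; apply: contraTneq oddn => <- /=.
    by rewrite oi.
  by case: i oi {hi}.
have YI : Y \subset I by apply: subsetIr.
have WI i : (i < n)%N -> ~~ odd i -> s_ i \in W :\: I.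
  by move=> hi oi; rewrite inE sI // oi memW.
have sinj i j : (i < n)%N -> (j < n)%N -> s_ i = s_ j -> i = j.
  by move=> hi hj /eqP; rewrite nth_uniq // => /eqP.
have R1 i j : odd i -> ~~ odd j -> (i < n)%N -> (j < n)%N -> w (s_ i) = w (s_ j) ->
    ind M1 (s_ j |: I :\ s_ i) -> r (s_ i) (s_ j).
  move=> oi oj hi hj wij iM; apply/orP; left.
  by rewrite /exch1 /= !sI // oi oj iM wij eqxx.
have R2 i j : odd i -> ~~ odd j -> (i < n)%N -> (j < n)%N ->
    compl_wt w (s_ i) = compl_wt w (s_ j) -> ind M2 (s_ j |: I :\ s_ i) -> r (s_ j) (s_ i).
  move=> oi oj hi hj wij iM; apply/orP; right.
  by rewrite /exch2 /= !sI // oi oj iM wij eqxx.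
have arc1 i : (i.+1 < n)%N -> odd i -> ind M1 (s_ i.+1 |: I :\ s_ i) /\ w (s_ i) = w (s_ i.+1).
  move=> hi oi; have := rs i hi; rewrite /r /tight /= /exch1 /exch2 /=.
  by rewrite !sI ?(ltnW hi) //= oi /= orbF => /andP[? /eqP].
have arc2 i : (i.+1 < n)%N -> ~~ odd i -> ind M2 (s_ i |: I :\ s_ i.+1) /\
    compl_wt w (s_ i) = compl_wt w (s_ i.+1).
  move=> hi oi; have := rs i hi; rewrite /r /tight /= /exch1 /exch2 /=.
  by rewrite !sI ?(ltnW hi) //= (negbTE oi) /= => /andP[? /eqP].
pose f1 y := s_ (index y s).+1; pose f2 y := s_ (index y s).-1.
have K1 : s_ 0%N |: (I :\: Y) :|: f1 @: Y = (I :\: W) :|: (W :\: I).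
  apply/setP => z; rewrite [in RHS]inE [in RHS]inE; apply/idP/idP.
    rewrite !inE => /orP[/orP[/eqP->|/andP[]]|/imsetP[y yY ->]].
    - by rewrite !sI // memW //= orbT.
    - by rewrite negb_and => + zI; rewrite zI orbF => ->.
    - have [i [hi i0 oi ->]] := inY _ yY; rewrite /f1 idx ?(ltnW hi) //.
      by rewrite sI //= oi memW //= orbT.
  case/orP => [/andP[zW zI]|]; first by rewrite !inE (negbTE zW) zI /= orbT.
  case/setDP => /inW[[|i] hi ->]; first by rewrite !inE eqxx.
  rewrite sI //= negbK => oi; rewrite inE; apply/orP; right; apply/imsetP.
  by exists (s_ i); [rewrite !inE memW ?sI ?oi // ltnW | rewrite /f1 idx // ltnW].
have K2 : s_ n.-1 |: (I :\: Y) :|: f2 @: Y = (I :\: W) :|: (W :\: I).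
  apply/setP => z; rewrite [in RHS]inE [in RHS]inE; apply/idP/idP.
    rewrite !inE => /orP[/orP[/eqP->|/andP[]]|/imsetP[y yY ->]].
    - by rewrite !sI // memW // i_n /= ?orbT.
    - by rewrite negb_and => + zI; rewrite zI orbF => ->.
    - have [[|i] [hi i0 oi ->]] // := inY _ yY; rewrite /f2 idx ?(ltnW hi) //=.
      have hi' := ltnW (ltnW hi).
      by rewrite sI // memW //; move: oi => /= ->; rewrite ?orbT.
  case/orP => [/andP[zW zI]|]; first by rewrite !inE (negbTE zW) zI /= orbT.
  case/setDP => /inW[i hi ->]; rewrite sI // => oi.
  rewrite inE; case: (eqVneq i n.-1) => [->|ni]; first by rewrite !inE eqxx.
  have hi1 : (i.+1 < n)%N by rewrite -(prednK s0) ltnS ltn_neqAle ni -ltnS prednK.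
  apply/orP; right; apply/imsetP.
  by exists (s_ i.+1); [rewrite !inE memW ?sI /= ?oi | rewrite /f2 idx].
have [x0I ix0 hx0] := min_freeP sS; have [z0I iz0 hz0] := min_freeP sZ.
have f1I y : y \in Y -> f1 y \notin I.
  by move=> /inY[i [hi i0 oi ->]]; rewrite /f1 idx ?(ltnW hi) // sI //= oi.
have f2I y : y \in Y -> f2 y \notin I.
  move=> /inY[[|i] [hi i0 oi ->]] //; rewrite /f2 idx ?(ltnW hi) // sI //=.
  exact: ltnW (ltnW hi).
have A1 : loc M1 w (s_ 0%N |: (I :\: Y) :|: f1 @: Y) /\ #|s_ 0%N |: (I :\: Y) :|: f1 @: Y| = #|I|.+1.
  split; [apply: (@augment_loc _ _ _ _ _ _ _ _ (fun y => index y s)) => //| apply: augment_card => //].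
  - move=> y /inY[i [hi i0 oi ->]]; rewrite /f1 idx ?(ltnW hi) //.
    by apply/eqP => /(sinj _ _ hi s0).
  - move=> y y' /inY[i [hi i0 oi ->]] /inY[j [hj j0 oj ->]].
    rewrite /f1 !idx ?(ltnW hi) ?(ltnW hj) // => /(sinj _ _ hi hj).
    by case=> ->.
  - move=> y /inY[i [hi i0 oi ->]]; rewrite /f1 idx ?(ltnW hi) //.
    by have [] := arc1 i hi oi.
  - move=> y /inY[i [hi i0 oi ->]]; rewrite /f1 idx ?(ltnW hi) //.
    by have [_ ->] := arc1 i hi oi.
  - move=> y yY; have [i [hi i0 oi yE]] := inY _ yY.
    apply: (tight_dep (y := y) L1 sS); rewrite ?f1I ?(subsetP YI _ yY) //.
      by rewrite /f1 yE idx ?(ltnW hi) // chS.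
    by rewrite /f1 yE idx ?(ltnW hi) //; have [_ ->] := arc1 i hi oi.
  - move=> y y' /inY[i [hi i0 oi ->]] /inY[j [hj j0 oj ->]] yy'.
    rewrite /f1 !idx ?(ltnW hi) ?(ltnW hj) // => ij wij.
    have ltij : (i < j)%N by rewrite ltn_neqAle ij andbT; apply: contraNneq yy' => ->.
    (* The exchange would be a tight arc that skips the vertices between [i] and [j.+1]. *)
    apply/negP => iM; have := ch i j.+1 ltij hj; rewrite R1 //= ?oj // ?(ltnW hi) //.
    by rewrite wij; have [_ ->] := arc1 j hj oj.
  - move=> y /inY[i [hi i0 oi ->]]; rewrite /f1 idx ?(ltnW hi) //.
    by apply/eqP => /(sinj _ _ hi s0).
  - move=> y y' /inY[i [hi i0 oi ->]] /inY[j [hj j0 oj ->]].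
    rewrite /f1 !idx ?(ltnW hi) ?(ltnW hj) // => /(sinj _ _ hi hj).
    by case=> ->.
have A2 : loc M2 (compl_wt w) (s_ n.-1 |: (I :\: Y) :|: f2 @: Y).
  (* Arcs of [M2] point from [f2 y] to [y], so the order of the path is reversed. *)
  apply: (@augment_loc _ _ _ _ _ _ _ _ (fun y => n - index y s)%N) => //.
  - move=> y /inY[[|i] [hi i0 oi ->]] //; rewrite /f2 idx ?(ltnW hi) //=.
    have hi' := ltnW (ltnW hi).
    apply/eqP => /(sinj _ _ hi' iN) iE; move: hi; rewrite iE prednK //.
    by rewrite ltnNge leqnSn.
  - move=> y y' /inY[[|i] [hi i0 oi ->]] // /inY[[|j] [hj j0 oj ->]] //.
    rewrite /f2 !idx ?(ltnW hi) ?(ltnW hj) //=.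
    by move=> /(sinj _ _ (ltnW (ltnW hi)) (ltnW (ltnW hj))) ->.
  - move=> y /inY[[|i] [hi i0 oi ->]] //; rewrite /f2 idx ?(ltnW hi) //=.
    by have [] := arc2 i (ltnW hi) oi.
  - move=> y /inY[[|i] [hi i0 oi ->]] //; rewrite /f2 idx ?(ltnW hi) //=.
    by have [_ ->] := arc2 i (ltnW hi) oi.
  - move=> y yY; have [[|i] [hi i0 oi yE]] // := inY _ yY.
    apply: (tight_dep (y := y) L2 sZ); rewrite ?f2I ?(subsetP YI _ yY) //.
      by rewrite /f2 yE idx ?(ltnW hi) // chZ // ltnW.
    by rewrite /f2 yE idx ?(ltnW hi) //; have [_ ->] := arc2 i (ltnW hi) oi.
  - move=> y y' /inY[[|i] [hi i0 oi ->]] // /inY[[|j] [hj j0 oj ->]] // yy'.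
    rewrite /f2 !idx ?(ltnW hi) ?(ltnW hj) //= => ij wij.
    have ltij : (j.+1 < i.+1)%N.
      rewrite ltn_neqAle; apply/andP; split; first by apply: contraNneq yy' => ->.
      by move: ij (ltnW hi) (ltnW hj); clear; lia.
    apply/negP => iM; have := ch j i.+1 ltij (ltnW hi); rewrite R2 //.
    - exact: ltnW.
    - exact: ltnW (ltnW hj).
    - by rewrite wij; have [_ ->] := arc2 j (ltnW hj) oj.
rewrite -{1}K1 in A1 *; case: A1 => A1 cA1; split; last by rewrite -K1.
by split; [exact: A1 | rewrite K1 -K2].
Qed.

(** Pairs that leave the reached set and limit an increase of [w] on it: exchanges that must not
    become profitable, and pairs of free elements whose order must not be reversed, so that sources
    stay cheapest in [M1] and, with [cand2], sinks in [M2]. *)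
Definition cand1 I w : rel T := [rel a b | [&& a \in reached I w, b \notin reached I w &
  exch1 I a b || (a \in sources I w) && (b \in free_elts M1 I)]].

Definition cand2 I w : rel T := [rel a b | [&& a \in reached I w, b \notin reached I w &
  exch2 I a b || (a \in free_elts M2 I) && (b \in sinks I w)]].

Definition pairs (l : seq T) := flatten [seq [seq (a, b) | b <- l] | a <- l].

Definition gaps l I w : seq R :=
  [seq w p.2 - w p.1 | p <- pairs l & cand1 I w p.1 p.2] ++
  [seq compl_wt w p.1 - compl_wt w p.2 | p <- pairs l & cand2 I w p.1 p.2].

(* This is 0 if there is no gap. *)
Definition delta_wt l I w : R :=
  head 0 [seq g <- gaps l I w | all (fun h => g <= h) (gaps l I w)].

Definition dual_wt l I w : T -> R :=
  if augmentable I w then w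
  else fun t => if t \in reached I w then w t + delta_wt l I w else w t.

Lemma seq_min (s : seq R) : s != [::] -> has (fun g => all (fun h => g <= h) s) s.
Proof.
elim: s => //= a s IHs _; case: (eqVneq s [::]) => [->|/IHs]; first by rewrite /= lexx.
case/hasP => g gs /allP gm; case: (leP a g) => [ag|ga].
  by apply/orP; left; rewrite lexx; apply/allP => h /gm; apply: le_trans.
apply/orP; right; apply/hasP; exists g => //=.
by rewrite ltW //=; apply/allP.
Qed.

Lemma mem_pairs l a b : (forall t, t \in l) -> (a, b) \in pairs l.
Proof.
move=> hl; apply/flattenP; exists [seq (a, b) | b <- l]; first exact: map_f.
exact: map_f.
Qed.

Lemma delta_wtP l I w : gaps l I w != [::] ->
  delta_wt l I w \in gaps l I w /\ forall g, g \in gaps l I w -> delta_wt l I w <= g.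
Proof.
move=> /seq_min; rewrite /delta_wt has_filter; set s := gaps l I w.
case E : (filter _ s) => [//|g s'] _ /=.
have : g \in [seq g <- s | all (fun h => g <= h) s] by rewrite E mem_head.
by rewrite mem_filter => /andP[/allP h gs].
Qed.

Lemma delta_wt0 l I w : gaps l I w = [::] -> delta_wt l I w = 0.
Proof. by rewrite /delta_wt => ->. Qed.

(** * Change of the weight split when no sink is reached *)

Section Dual.
Variables (l : seq T) (I : {set T}) (w : T -> R).
Hypothesis hl : forall t, t \in l.
Hypothesis L : loc2 I w.
Hypothesis nag : ~~ augmentable I w.
Let U := reached I w.
Let d := delta_wt l I w.
Let w' t := if t \in U then w t + d else w t.

Lemma gap1 a b : cand1 I w a b -> w b - w a \in gaps l I w.
Proof.
move=> h; rewrite mem_cat; apply/orP; left; apply/mapP; exists (a, b) => //.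
by rewrite mem_filter h mem_pairs.
Qed.

Lemma gap2 a b : cand2 I w a b -> compl_wt w a - compl_wt w b \in gaps l I w.
Proof.
move=> h; rewrite mem_cat; apply/orP; right; apply/mapP; exists (a, b) => //.
by rewrite mem_filter h mem_pairs.
Qed.

Lemma gaps_ge0 g : g \in gaps l I w -> 0 <= g.
Proof.
have [[_ L1] [_ L2]] := L.
rewrite mem_cat => /orP[] /mapP[[a b]]; rewrite mem_filter => /andP[h _] -> /=.
- rewrite subr_ge0; case/and3P: h => _ _ /orP[/and3P[aI bI iM]|/andP[aS bF]].
    exact: L1.
  by have [_ _ h] := min_freeP aS; move: bF; rewrite inE => /andP[]; apply: h.
- rewrite subr_ge0; case/and3P: h => _ _ /orP[/and3P[aI bI iM]|/andP[aF bS]].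
    exact: L2.
  by have [_ _ h] := min_freeP bS; move: aF; rewrite inE => /andP[]; apply: h.
Qed.

Lemma delta_ge0 : 0 <= d.
Proof.
case: (eqVneq (gaps l I w) [::]) => [/delta_wt0|/delta_wtP[/gaps_ge0 //]].
by rewrite /d => ->.
Qed.

Lemma delta_le g : g \in gaps l I w -> d <= g.
Proof.
move=> gG; have /delta_wtP[_] : gaps l I w != [::] by case: (gaps l I w) gG.
exact.
Qed.

Lemma dual_le1 a b : cand1 I w a b -> w a + d <= w b.
Proof. by move=> /gap1 /delta_le; rewrite lerBrDr addrC. Qed.

Lemma dual_le2 a b : cand2 I w a b -> compl_wt w b <= compl_wt w a - d.
Proof. by move=> /gap2 /delta_le h; rewrite lerBrDr addrC -lerBrDr. Qed.

Lemma compl_w' t : compl_wt w' t = if t \in U then compl_wt w t - d else compl_wt w t.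
Proof. by rewrite /compl_wt /w'; case: ifP => // _; rewrite opprD addrA. Qed.

(** Shifting [U] changes only the comparisons across its border; those that get tighter belong to
    candidates, and [d] is at most their gap. *)
Lemma dual_loc2 : loc2 I w'.
Proof.
have [[i1 L1] [i2 L2]] := L; have d0 := delta_ge0.
split; split=> // x y xI yI iM.
  have wyx := L1 x y xI yI iM; rewrite /w'.
  case: ifP => yU; case: ifP => xU; rewrite ?lerD2r //; last by rewrite (le_trans wyx) // lerDl.
  by apply: dual_le1; rewrite /cand1 /= /exch1 /= -/U yU xU yI xI iM.
have wyx := L2 x y xI yI iM; rewrite !compl_w'.
case: ifP => yU; case: ifP => xU; rewrite ?lerD2r //; first by rewrite (le_trans _ wyx) // gerBl.
by apply: dual_le2; rewrite /cand2 /= /exch2 /= -/U yU xU yI xI iM.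
Qed.

Lemma src_reached : sources I w \subset U. Proof. exact: rch_src. Qed.

Lemma dual_src : sources I w \subset sources I w'.
Proof.
apply/subsetP => x xS; have xU := subsetP src_reached _ xS; have := xS.
rewrite !inE => /andP[-> /forall_inP h] /=; apply/forall_inP => y yF.
rewrite /w' xU; case: ifP => yU; first by rewrite lerD2r h.
by apply: dual_le1; rewrite /cand1 /= -/U xU yU xS yF orbT.
Qed.

Lemma dual_snk : sinks I w \subset sinks I w'.
Proof.
apply/subsetP => x xS.
have xU : x \in U = false.
  by apply/negP => xU; case/negP: nag; apply/exists_inP; exists x.
have := xS; rewrite !inE => /andP[-> /forall_inP h] /=; apply/forall_inP => y yF.
rewrite !compl_w' xU; case: ifP => yU; last exact: h.
by apply: dual_le2; rewrite /cand2 /= -/U xU yU xS yF orbT.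
Qed.

(** Arcs inside [U] have both ends shifted alike and stay tight, and sources stay sources. *)
Lemma dual_reached : U \subset reached I w'.
Proof.
suff /subsetP h : U \subset U :&: reached I w' by apply/subsetP => x /h; rewrite inE => /andP[].
apply: rch_min.
  rewrite subsetI src_reached; apply: subset_trans dual_src _; exact: rch_src.
move=> a b; rewrite inE => /andP[aU aU'] tab.
have bU : b \in U by apply: rch_step aU tab.
rewrite inE bU; apply: rch_step aU' _.
move: tab; rewrite /tight /= !compl_w' /w' aU bU.
by rewrite !(inj_eq (addIr _)).
Qed.

(** The candidate with the least gap becomes tied: it yields a tight arc leaving [U], a new source
    outside [U], or a sink in [U]. *)
Lemma dual_progress : gaps l I w != [::] ->
  augmentable I w' \/ (#|U| < #|reached I w'|)%N.
Proof.
move=> /delta_wtP[+ _]; rewrite -/d mem_cat.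
have grow b : b \notin U -> b \in reached I w' -> (#|U| < #|reached I w'|)%N.
  by move=> bU bU'; apply: proper_card; apply/properP; split; [exact: dual_reached | exists b].
case/orP => /mapP[[a b]]; rewrite mem_filter => /andP[h _] /= dE.
- case/and3P: (h) => aU bU hab; right; apply: (grow b bU).
  have wab : w' a = w' b by rewrite /w' aU (negbTE bU) dE addrC subrK.
  case/orP: hab => [e1|/andP[aS bF]].
    apply: (rch_step (subsetP dual_reached _ aU)).
    by apply/orP; left; rewrite e1 wab eqxx.
  apply: (subsetP (rch_src _ _)); have := subsetP dual_src _ aS.
  by rewrite !inE wab => /andP[_ ->]; move: bF; rewrite inE => ->.
- case/and3P: (h) => aU bU hab.
  have wab : compl_wt w' a = compl_wt w' b.
    by rewrite !compl_w' aU (negbTE bU) dE opprB addrC subrK.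
  case/orP: hab => [e1|/andP[aF bS]].
    right; apply: (grow b bU); apply: (rch_step (subsetP dual_reached _ aU)).
    by apply/orP; right; rewrite e1 wab eqxx.
  left; apply/exists_inP; exists a; last exact: (subsetP dual_reached _ aU).
  have := subsetP dual_snk _ bS.
  by rewrite !inE wab => /andP[_ ->]; move: aF; rewrite inE => ->.
Qed.

(* With no candidate left, [I :\: U] spans the complement of [U] in [M1]
   and [I :&: U] spans [U] in [M2], which bounds every common independent set. *)
Lemma gaps_nonempty J : ind M1 J -> ind M2 J -> (#|I| < #|J|)%N -> gaps l I w != [::].
Proof.
move=> iJ1 iJ2 IJ; apply/eqP => G0.
have [[i1 L1] [i2 L2]] := L.
have n1 a b : ~~ cand1 I w a b by apply/negP => /gap1; rewrite G0.
have n2 a b : ~~ cand2 I w a b by apply/negP => /gap2; rewrite G0.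
have [x0 x0S] : exists x, x \in sources I w.
  have [x1] := ind_aug i1 iJ1 IJ; rewrite inE => /andP[x1I _] ix1.
  have x1F : x1 \in free_elts M1 I by rewrite inE x1I.
  have [x2 x2F x2m] := arg_minP w x1F; exists x2.
  have {}x2F : x2 \in free_elts M1 I := x2F.
  by rewrite inE x2F; apply/forall_inP => y /x2m.
have [z0 z0S] : exists x, x \in sinks I w.
  have [x1] := ind_aug i2 iJ2 IJ; rewrite inE => /andP[x1I _] ix1.
  have x1F : x1 \in free_elts M2 I by rewrite inE x1I.
  have [x2 x2F x2m] := arg_minP (compl_wt w) x1F; exists x2.
  have {}x2F : x2 \in free_elts M2 I := x2F.
  by rewrite inE x2F; apply/forall_inP => y /x2m.
have x0U := subsetP src_reached _ x0S.
have z0U : z0 \notin U by apply: contra nag => z0U; apply/exists_inP; exists z0.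
have s1 : (#|J :\: U| <= #|I :\: U|)%N.
  apply: (@ind_card _ M1).
  - by apply: ind_sub i1; apply: subsetDl.
  - by apply: ind_sub iJ1; apply: subsetDl.
  move=> y; rewrite inE => /andP[yU yJ]; rewrite /cl inE yU /=.
  case: (boolP (y \in I)) => //= yI.
  have dy : ~~ ind M1 (y |: I).
    apply/negP => iy; have := n1 x0 y.
    have yF : y \in free_elts M1 I by rewrite inE yI.
    by rewrite /cand1 /= -/U x0U yU x0S yF orbT.
  have [C [CI dC hC]] := fund_circuit i1 dy.
  apply: contra dC; apply: ind_sub; apply: setUS; apply/subsetP => z zC.
  rewrite inE (subsetP CI) // andbT; apply/negP => zU; have := n1 z y.
  by rewrite /cand1 /= /exch1 /= -/U zU yU (subsetP CI) // yI hC.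
have s2 : (#|J :&: U| <= #|I :&: U|)%N.
  apply: (@ind_card _ M2).
  - by apply: ind_sub i2; apply: subsetIl.
  - by apply: ind_sub iJ2; apply: subsetIl.
  move=> y; rewrite inE => /andP[yJ yU]; rewrite /cl inE yU /= andbT.
  case: (boolP (y \in I)) => //= yI.
  have dy : ~~ ind M2 (y |: I).
    apply/negP => iy; have := n2 y z0.
    have yF : y \in free_elts M2 I by rewrite inE yI.
    by rewrite /cand2 /= -/U z0U yU z0S yF orbT.
  have [C [CI dC hC]] := fund_circuit i2 dy.
  apply: contra dC; apply: ind_sub; apply: setUS; apply/subsetP => z zC.
  rewrite inE (subsetP CI) //=; apply/negPn/negP => zU; have := n2 y z.
  by rewrite /cand2 /= /exch2 /= -/U zU yU yI (subsetP CI _ zC) hC.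
by have := leq_add s2 s1; rewrite !cardsID leqNgt IJ.
Qed.

End Dual.

Lemma dual_wt_loc2 l I w : (forall t, t \in l) -> loc2 I w -> loc2 I (dual_wt l I w).
Proof. by move=> hl L; rewrite /dual_wt; case: ifP => // _; apply: dual_loc2. Qed.

Lemma iter_dual_loc2 l I w n : (forall t, t \in l) -> loc2 I w ->
  loc2 I (iter n (dual_wt l I) w).
Proof. by move=> hl L; elim: n => //= n; apply: dual_wt_loc2. Qed.

(** Every round that does not reach a sink enlarges the reached set, so more than [#|T|] such rounds
    are impossible; once a sink is reached, [dual_wt] changes nothing, so a fixed number of rounds
    will do. *)
Lemma iter_dual_augmentable l I w n J : (forall t, t \in l) -> loc2 I w ->
  ind M1 J -> ind M2 J -> (#|I| < #|J|)%N -> (#|T| < n)%N ->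
  augmentable I (iter n (dual_wt l I) w).
Proof.
move=> hl L iJ1 iJ2 IJ nT.
suff [//|] : augmentable I (iter n (dual_wt l I) w) \/
    (n <= #|reached I (iter n (dual_wt l I) w)|)%N.
  by rewrite leqNgt (leq_ltn_trans (max_card _) nT).
elim: n {nT} => [|n IHn]; first by right.
rewrite iterS; set v := iter n _ w in IHn *; have Lv : loc2 I v by apply: iter_dual_loc2.
rewrite /dual_wt; case: ifP => [->|/negbT nag]; first by left.
case: IHn => [ag|hn]; first by rewrite ag in nag.
have [|h|h] := dual_progress hl nag; first exact: gaps_nonempty iJ1 iJ2 IJ.
  by left.
by right; apply: leq_ltn_trans h.
Qed.

Definition wmi_step n l (p : {set T} * (T -> R)) :=
  (aug_set l p.1 (iter n (dual_wt l p.1) p.2), iter n (dual_wt l p.1) p.2).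

Definition wmi n m l := (iter m (wmi_step n l) (set0, c)).1.

(** The final set is cheapest of its size for [w] in [M1] and for the complementary weight in [M2];
    adding the two inequalities against [J] gives optimality for [c]. Since [J] is as large as any
    independent set of [M1], augmentation stops exactly at [#|J|] elements. *)
Lemma wmi_correct n m l J : (forall t, t \in l) -> (#|T| < n)%N -> (#|J| <= m)%N ->
  ind M1 J -> ind M2 J -> (forall A, ind M1 A -> (#|A| <= #|J|)%N) ->
  [/\ ind M1 (wmi n m l), ind M2 (wmi n m l), #|wmi n m l| = #|J| &
     \sum_(t in wmi n m l) c t <= \sum_(t in J) c t].
Proof.
move=> hl nT mJ iJ1 iJ2 maxJ; rewrite /wmi.
set p := iter m _ _.
have [L cp] : loc2 p.1 p.2 /\ #|p.1| = #|J|.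
  suff [H h] : loc2 p.1 p.2 /\ ((m <= #|p.1|)%N \/ #|p.1| = #|J|).
    split=> //; case: h => // mp; have [[/maxJ pJ _] _] := H.
    by apply/eqP; rewrite eqn_leq pJ (leq_trans mJ).
  rewrite /p; elim: m {mJ p} => [|m [IH1 IH2]].
    split; last by left.
    (* The empty set admits no exchange, so it is locally optimal for any split; the initial one is
       [c] and zero. *)
    by split; split=> [|x y]; rewrite /= ?ind_set0 ?inE.
  rewrite iterS /=; set q := iter m _ _ in IH1 IH2 *.
  have Lw := iter_dual_loc2 n hl IH1; set v := iter n _ q.2 in Lw *.
  case: (boolP (augmentable q.1 v)) => ag; last first.
    rewrite /aug_set (negbTE ag); split=> //; right.
    case: (ltngtP #|q.1| #|J|) => // h.
      by have := iter_dual_augmentable hl IH1 iJ1 iJ2 h nT; rewrite (negbTE ag).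
    by have [[/maxJ]] := IH1; rewrite leqNgt h.
  have [La ca] := aug_set_loc hl ag Lw; split=> //; left; rewrite ca.
  case: IH2 => // qJ; have [[/maxJ]] := La; rewrite ca qJ ltnn //.
have [[i1 l1] [i2 l2]] := L; split=> //.
have h1 := loc_extreme (conj i1 l1) iJ1 (esym cp).
have h2 := loc_extreme (conj i2 l2) iJ2 (esym cp).
have E A : \sum_(t in A) (p.2 t + compl_wt p.2 t) = \sum_(t in A) c t.
  by apply: eq_bigr => t _; rewrite /compl_wt addrC subrK.
by have := lerD h1 h2; rewrite -!big_split /= !E.
Qed.

End Wmi.

(** * Coloured forests, laminar matroids and arborescence packings *)

Section LinearMatroid.
Variables (T : finType) (F : fieldType) (vT : vectType F) (vec : T -> vT).
Implicit Types (A B J K : {set T}).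

Definition vspan A : {vspace vT} := <<[seq vec t | t <- enum A]>>%VS.
Definition vfree : pred {set T} := fun A => free [seq vec t | t <- enum A].

Lemma memv_vspan A t : t \in A -> vec t \in vspan A.
Proof. by move=> tA; apply: memv_span; apply: map_f; rewrite mem_enum. Qed.

Lemma vspan_sub A (U : {vspace vT}) : (forall t, t \in A -> vec t \in U) -> (vspan A <= U)%VS.
Proof.
move=> h; apply/span_subvP => v /mapP[t]; rewrite mem_enum => tA ->; exact: h.
Qed.

Lemma vspanS A B : A \subset B -> (vspan A <= vspan B)%VS.
Proof. by move=> /subsetP AB; apply: vspan_sub => t /AB; apply: memv_vspan. Qed.

Lemma vfreeU A B : [disjoint A & B] ->
  vfree (A :|: B) = free ([seq vec t | t <- enum A] ++ [seq vec t | t <- enum B]).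
Proof.
move=> dAB; apply: perm_free; rewrite -map_cat; apply: perm_map.
apply: uniq_perm; rewrite ?enum_uniq // ?cat_uniq ?enum_uniq //=.
  rewrite andbT; apply/hasPn => t; rewrite !mem_enum => tB.
  by apply: contraTN tB => tA; rewrite (disjointFr dAB tA).
by move=> t; rewrite mem_cat !mem_enum in_setU.
Qed.

Lemma vfreeU1 x A : x \notin A -> vfree (x |: A) = (vec x \notin vspan A) && vfree A.
Proof.
move=> xA; rewrite vfreeU; first by rewrite enum_set1 /= free_cons.
by rewrite disjoints1.
Qed.

Lemma vfree_set0 : vfree set0.
Proof. by rewrite /vfree enum_set0 nil_free. Qed.

Lemma vfree_sub A B : A \subset B -> vfree B -> vfree A.
Proof.
move=> AB; have -> : B = A :|: (B :\: A).
  by apply/setP => t; rewrite !inE; case: (boolP (t \in A)) => // /(subsetP AB).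
rewrite vfreeU; first exact: catl_free.
by rewrite disjoint_sym disjoints_subset; apply/subsetP => t; rewrite !inE => /andP[].
Qed.

Lemma vfree_dim A : vfree A -> \dim (vspan A) = #|A|.
Proof. by rewrite /vfree /free => /eqP; rewrite size_map -cardE. Qed.

Lemma vfree_card A (U : {vspace vT}) : vfree A -> (forall t, t \in A -> vec t \in U) ->
  #|A| <= \dim U.
Proof. by move=> /vfree_dim <- h; apply: dimvS; apply: vspan_sub. Qed.

Lemma vfree_aug A B : vfree A -> vfree B -> #|A| < #|B| ->
  exists2 x, x \in B :\: A & vfree (x |: A).
Proof.
move=> fA fB AB; apply/exists_inP; rewrite -[X in is_true X]negbK negb_exists_in.
apply/negP => /forall_inP h.
suff /(vfree_card fB) : forall t, t \in B -> vec t \in vspan A.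
  by rewrite vfree_dim // leqNgt AB.
move=> t tB; case: (boolP (t \in A)) => tA; first exact: memv_vspan.
have := h t; rewrite inE tA tB => /(_ isT); rewrite vfreeU1 // fA andbT.
by rewrite negbK.
Qed.

Definition linear_matroid := Matroid vfree_set0 vfree_sub vfree_aug.

Lemma vfreeP J : reflect (forall t, t \in J -> vec t \notin vspan (J :\ t)) (vfree J).
Proof.
apply: (iffP idP) => [fJ t tJ|h].
  by move: fJ; rewrite -{1}(setD1K tJ) vfreeU1 ?inE ?eqxx // => /andP[].
suff: forall K, K \subset J -> vfree K by apply.
move=> K; have [n] := ubnP #|K|; elim: n K => // n IHn K hn KJ.
have [->|[t tK]] := set_0Vmem K; first exact: vfree_set0.
have tKt : t \notin K :\ t by rewrite !inE eqxx.
rewrite -(setD1K tK) vfreeU1 // IHn ?andbT.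
- apply: contra (h t (subsetP KJ _ tK)); apply: subvP; apply: vspanS.
  exact: setSD.
- by move: hn; rewrite (cardsD1 t) tK.
- exact: subset_trans (subD1set _ _) KJ.
Qed.

End LinearMatroid.

(** * Direct sum of graphic matroids on coloured arcs *)

Section Arcs.
Variables (n m k : nat) (src tgt : 'I_m -> 'I_n).

Notation arc := ('I_m * bool)%type.
Notation elt := ('I_k * arc)%type.
Implicit Types (J K B : {set elt}) (t : elt) (S Q : {set 'I_n}).

Definition atail (a : arc) := if a.2 then src a.1 else tgt a.1.
Definition ahead (a : arc) := if a.2 then tgt a.1 else src a.1.

(** The incidence vector of the arc, placed in the row of its colour: different colours are
    independent, and the linear matroid of these vectors is the direct sum of [k] graphic matroids.
    Linear algebra supplies the matroid axioms; the program tests [is_forest] instead. *)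
Definition avec t : 'M[rat]_(k, n) := (delta_mx t.1 (atail t.2) - delta_mx t.1 (ahead t.2))%R.

Definition forests := linear_matroid avec.

Definition adj J (j : 'I_k) : rel 'I_n := [rel u v | [exists t in J, (t.1 == j) &&
  ((atail t.2 == u) && (ahead t.2 == v) || (atail t.2 == v) && (ahead t.2 == u))]].

(** A path of colour [j] from tail to head writes the vector as a telescoping sum. Conversely, the
    linear form that sums the entries of row [j] over the component of the tail vanishes on [J], and
    it is 1 on [avec t] unless the head lies in the same component. *)
Lemma avec_span J t : (avec t \in vspan avec J) =
  (ahead t.2 \in rch (adj J t.1) [set atail t.2]).
Proof.
set j := t.1; set x := atail t.2; set y := ahead t.2; apply/idP/idP; last first.
  suff /subsetP h : rch (adj J j) [set x] \subset
      [set v | (delta_mx j x - delta_mx j v)%R \in vspan avec J] by move=> /h; rewrite inE.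
  apply: rch_min => [|u v].
    by apply/subsetP => v; rewrite !inE => /eqP->; rewrite subrr mem0v.
  rewrite !inE => hu /exists_inP[s sJ /andP[/eqP sj h]].
  have hs := memv_vspan avec sJ; rewrite -(subrK (delta_mx j u) (delta_mx j x)) -addrA.
  rewrite memvD //; case/orP: h => /andP[/eqP ex /eqP ey].
    by rewrite /avec sj ex ey in hs.
  by rewrite /avec sj ex ey -opprB memvN in hs.
pose c : 'cV[rat]_n := (\col_v (v \in rch (adj J j) [set x])%:R)%R.
pose f : {linear 'M[rat]_(k, n) -> 'M[rat]_(1, 1)} := (mulmxr c \o mulmx (delta_mx 0%R j))%FUN.
have fE (i : 'I_k) v : f (delta_mx i v) = (((j == i) && (v \in rch (adj J j) [set x]))%:R%:M)%R.
  rewrite /f /= mul_delta_mx_cond; case: eqP => _ /=; last first.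
    by rewrite mulr0n mul0mx raddf0.
  rewrite mulr1n; apply/matrixP => a b; rewrite !ord1 !mxE (bigD1 v) //= !mxE !eqxx mul1r.
  by rewrite big1 ?addr0 ?mulr1n // => u uv; rewrite !mxE (negbTE uv) mul0r.
move=> tJ; have : avec t \in lker (linfun f).
  apply: subvP tJ; apply: vspan_sub => s sJ; rewrite memv_ker lfunE.
  change (f (avec s) == 0%R); rewrite /avec linearB !fE.
  case: (eqVneq j s.1) => [sj|]; last by rewrite /= subrr.
  have a1 : adj J j (atail s.2) (ahead s.2).
    by apply/exists_inP; exists s; rewrite ?sj ?eqxx.
  have a2 : adj J j (ahead s.2) (atail s.2).
    by apply/exists_inP; exists s; rewrite ?sj ?eqxx ?orbT.
  rewrite /= subr_eq0; apply/eqP; congr (_%:R%:M%R); congr nat_of_bool.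
  by apply/idP/idP => h; [apply: rch_step h a1 | apply: rch_step h a2].
rewrite memv_ker lfunE; change (f (avec t) == 0%R -> y \in rch (adj J j) [set x]).
rewrite /avec linearB !fE eqxx /= -/x -/y.
have -> : x \in rch (adj J j) [set x] by apply: (subsetP (rch_src _ _)); rewrite inE.
case: (y \in _) => //=; rewrite raddf0 subr0 => /eqP/matrixP/(_ 0 0)%R.
by rewrite !mxE.
Qed.

Definition is_forest J := [forall t in J, ahead t.2 \notin rch (adj (J :\ t) t.1) [set atail t.2]].

Lemma forestsE J : ind forests J = is_forest J.
Proof.
by apply/vfreeP/forall_inP => h t tJ; have := h t tJ; rewrite avec_span.
Qed.

(** With [s0] in [S] fixed, the vectors of arcs inside [S] are spanned by the [k * #|S|.-1]
    differences between the unit vectors of [s0] and of the other vertices of [S], taken in every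
    colour. *)
Lemma forests_inside J (S : {set 'I_n}) : ind forests J -> S != set0 ->
  (forall t, t \in J -> (atail t.2 \in S) && (ahead t.2 \in S)) -> #|J| <= k * #|S|.-1.
Proof.
move=> fJ /set0Pn[s0 s0S] h.
pose X := [seq (delta_mx p.1 s0 - delta_mx p.1 p.2)%R : 'M[rat]_(k, n) |
            p <- enum (setX [set: 'I_k] (S :\ s0))].
have : #|J| <= \dim <<X>>%VS.
  apply: (vfree_card fJ) => t /h /andP[aS bS].
  have D v : v \in S -> (delta_mx t.1 s0 - delta_mx t.1 v)%R \in <<X>>%VS.
    move=> vS; case: (eqVneq v s0) => [->|vs0]; first by rewrite subrr mem0v.
    apply: memv_span; apply/mapP; exists (t.1, v) => //.
    by rewrite mem_enum !inE vs0.
  have -> : avec t = ((delta_mx t.1 s0 - delta_mx t.1 (ahead t.2)) -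
      (delta_mx t.1 s0 - delta_mx t.1 (atail t.2)))%R.
    by rewrite opprB addrC addrA subrK.
  by rewrite memvB ?D.
move/leq_trans; apply; apply: leq_trans (dim_span _) _.
by rewrite size_map -cardE cardsX cardsT card_ord (cardsD1 s0 S) s0S.
Qed.

Lemma forests_card J : 0 < n -> ind forests J -> #|J| <= k * n.-1.
Proof.
move=> n0 fJ; have := forests_inside (S := setT) fJ; rewrite cardsT card_ord; apply.
  by apply/set0Pn; exists (Ordinal n0).
by move=> t _; rewrite !inE.
Qed.

(** The two orientations of an edge have opposite vectors. So a colour uses an edge at most once, on
    which the bound by [k OPT] rests. *)
Lemma forests_flip J (j : 'I_k) e : ind forests J -> (j, (e, true)) \in J ->
  (j, (e, false)) \notin J.
Proof.
move=> /vfreeP h h1; apply/negP => h2; have := h _ h1.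
have : (j, (e, false)) \in J :\ (j, (e, true)) by rewrite !inE h2 !xpair_eqE /= !andbF.
move=> /(memv_vspan avec) hs /negP[]; move: hs.
by rewrite -memvN /avec /= /atail /ahead /= opprB.
Qed.

(** * Laminar degree and capacity constraints *)

Variables (r : 'I_n) (cap : 'I_m -> nat).

Definition arcs_of J (a : arc) := [set t in J | t.2 == a].
Definition heads_of J (v : 'I_n) := [set t in J | ahead t.2 == v].

(** All copies of an arc share their head, so the constrained sets form a laminar family. With the
    bound 0 at the root, a member with [k * n.-1] elements has exactly [k] arcs into every other
    vertex. *)
Definition lam : pred {set elt} := fun J =>
  [forall a, #|arcs_of J a| <= cap a.1] &&
  [forall v, #|heads_of J v| <= if v == r then 0 else k].

Lemma card_fibers (aT : finType) (f : elt -> aT) J :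
  #|J| = \sum_(a : aT) #|[set t in J | f t == a]|.
Proof.
rewrite -sum1_card (partition_big f predT) //=; apply: eq_bigr => a _.
by rewrite -sum1_card; apply: eq_bigl => t; rewrite inE.
Qed.

Lemma lam_set0 : lam set0.
Proof.
have E (p : pred elt) : #|[set t in set0 | p t]| = 0.
  by apply/eqP; rewrite cards_eq0; apply/eqP/setP => t; rewrite !inE.
apply/andP; split; apply/forallP => x; first by rewrite (E (fun t => t.2 == x)).
by rewrite (E (fun t => ahead t.2 == x)).
Qed.

Lemma lam_sub J K : J \subset K -> lam K -> lam J.
Proof.
move=> /subsetP JK /andP[/forallP h1 /forallP h2]; apply/andP; split; apply/forallP => x.
  apply: leq_trans (h1 x); apply: subset_leq_card; apply/subsetP => t.
  by rewrite !inE => /andP[/JK -> ->].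
apply: leq_trans (h2 x); apply: subset_leq_card; apply/subsetP => t.
by rewrite !inE => /andP[/JK -> ->].
Qed.

Lemma lt_fiber (aT : finType) (f : elt -> aT) J K : #|J| < #|K| ->
  exists a, #|[set t in J | f t == a]| < #|[set t in K | f t == a]|.
Proof.
rewrite (card_fibers f J) (card_fibers f K) => h; apply/existsP; apply: contraTT h.
rewrite negb_exists -leqNgt => /forallP h; apply: leq_sum => a _.
by rewrite leqNgt h.
Qed.

Lemma card_setU1_fiber (p : pred elt) x J :
  #|[set t in x |: J | p t]| <= p x + #|[set t in J | p t]|.
Proof.
case px : (p x); last first.
  apply: subset_leq_card; apply/subsetP => t; rewrite !inE.
  by case/andP => /orP[/eqP->|->]; rewrite ?px.
apply: leq_trans (_ : #|x |: [set t in J | p t]| <= _).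
  by apply: subset_leq_card; apply/subsetP => t; rewrite !inE; case: eqP.
by rewrite cardsU1; case: (_ \notin _).
Qed.

(** Descend the laminar family: at some vertex [K] has more arcs than [J], and among these some arc
    has more copies in [K]. Both constraints on such a copy have room in [J]. *)
Lemma lam_aug J K : lam J -> lam K -> #|J| < #|K| -> exists2 x, x \in K :\: J & lam (x |: J).
Proof.
move=> /andP[/forallP J1 /forallP J2] /andP[/forallP K1 /forallP K2] JK.
have [v hv] := lt_fiber (fun t => ahead t.2) JK.
have [a ha] := lt_fiber (fun t => t.2) hv.
have av : ahead a = v.
  have /card_gt0P[t] : 0 < #|[set t in heads_of K v | t.2 == a]| by apply: leq_ltn_trans ha.
  by rewrite !inE => /andP[/andP[_ /eqP <-] /eqP ->].
have E L : [set t in heads_of L v | t.2 == a] = arcs_of L a.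
  apply/setP => t; rewrite !inE; case: (t.2 =P a) => [->|]; last by rewrite !andbF.
  by rewrite av eqxx !andbT.
rewrite !E in ha.
have /subsetPn[x xK xJ] : ~~ (arcs_of K a \subset arcs_of J a).
  by apply/negP => /subset_leq_card; rewrite leqNgt ha.
have xa : x.2 = a by move: xK; rewrite inE => /andP[_ /eqP].
have {}xK : x \in K by move: xK; rewrite inE => /andP[].
have {}xJ : x \notin J by apply: contra xJ => xJ; rewrite inE xJ xa eqxx.
exists x; first by rewrite inE xJ.
apply/andP; split; apply/forallP => y.
  apply: leq_trans (card_setU1_fiber _ _ _) _; rewrite xa.
  by case: eqP => [<-|_]; [apply: leq_trans ha (K1 a) | apply: J1].
apply: leq_trans (card_setU1_fiber _ _ _) _; rewrite xa av.
by case: eqP => [<-|_]; [apply: leq_trans hv (K2 v) | apply: J2].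
Qed.

Definition laminar := Matroid lam_set0 lam_sub lam_aug.

Definition edges_of J := [set e | [exists t in J, t.2.1 == e]].

Definition bdry (S : {set 'I_n}) := [set e | (src e \in S) (+) (tgt e \in S)].

Lemma bdryC S : bdry (~: S) = bdry S.
Proof. by apply/setP => e; rewrite !inE; do 2!case: (_ \in S). Qed.

Lemma common_base_cut J (S : {set 'I_n}) : ind forests J -> lam J -> #|J| = k * n.-1 ->
  S != set0 -> S != setT -> k <= \sum_(e in bdry S :&: edges_of J) cap e.
Proof.
(* [bdry] does not change under complementation, so [S] may be taken to avoid the root. *)
move=> fJ lJ cJ; wlog rS : S / r \notin S => [H S0 ST|S0 _].
  case: (boolP (r \in S)) => rS; last exact: H.
  have := H (~: S); rewrite bdryC inE rS; apply=> //.
    by apply: contraNneq ST => S0'; rewrite -(setCK S) S0' setC0.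
  by apply: contraNneq S0 => S0'; rewrite -(setCK S) S0' setCT.
have /andP[/forallP J1 /forallP J2] := lJ.
have hE v : v != r -> #|heads_of J v| = k.
  have : \sum_(v | v != r) (k - #|heads_of J v|) = 0.
    rewrite sumnB; last by move=> u ur; have := J2 u; rewrite (negbTE ur).
    rewrite sum_nat_const cardC1 card_ord; apply/eqP; rewrite subn_eq0 mulnC -cJ.
    rewrite (card_fibers (fun t => ahead t.2) J) (bigD1 r) //= -/(heads_of J r).
    by have := J2 r; rewrite eqxx leqn0 => /eqP->.
  move/eqP; rewrite sum_nat_eq0 => /forall_inP h vr.
  apply/eqP; rewrite eqn_leq; have := J2 v; rewrite (negbTE vr) => ->.
  by have := h v vr; rewrite subn_eq0.
pose inS := [set t in J | ahead t.2 \in S].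
pose both := [set t in inS | atail t.2 \in S].
pose ent := [set t in inS | atail t.2 \notin S].
have cS : #|inS| = k * #|S|.
  rewrite (card_fibers (fun t => ahead t.2) inS) (bigID (mem S)) /= [X in _ + X]big1 ?addn0.
    rewrite mulnC -sum_nat_const; apply: eq_bigr => v vS.
    apply: etrans (hE v _); last by apply: contraNneq rS => <-.
    by apply: eq_card => t; rewrite !inE; case: eqP => [->|]; rewrite ?vS ?andbT ?andbF.
  move=> v vS; apply/eqP; rewrite cards_eq0; apply/eqP/setP => t; rewrite !inE.
  by apply/negP => /andP[/andP[_ tS] /eqP tv]; rewrite -tv tS in vS.
have cB : #|both| <= k * #|S|.-1.
  apply: forests_inside S0 _.
    by apply: ind_sub fJ; apply/subsetP => t; rewrite !inE => /andP[/andP[]].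
  by move=> t; rewrite !inE => /andP[/andP[_ ->] ->].
have cE : k <= #|ent|.
  have : #|inS| = #|both| + #|ent|.
    rewrite -(cardsID [set t | atail t.2 \in S] inS); congr (_ + _); apply: eq_card => t.
      by rewrite !inE.
    by rewrite !inE andbC.
  rewrite cS; have S1 : 0 < #|S| by rewrite card_gt0.
  by move: cB; rewrite -{2}(prednK S1) mulnS; lia.
apply: leq_trans cE _.
rewrite -sum1_card (partition_big (fun t => t.2.1) (mem (bdry S :&: edges_of J))) /=.
  apply: leq_sum => e _; rewrite sum1_card.
  (* Of the two orientations of a boundary edge only this one enters [S], so the capacity of the
     edge is used only once. *)
  pose a : arc := (e, tgt e \in S).
  apply: leq_trans (J1 a); apply: subset_leq_card; apply/subsetP => -[j [e' b]].
  rewrite unfold_in !inE /= => /andP[/andP[/andP[tJ hS] tS] /eqP ee]; rewrite tJ /=.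
  move: hS tS; rewrite /a -ee /ahead /atail /=; case: b {tJ} => /= hS tS; first by rewrite hS.
  by rewrite (negbTE tS).
move=> t; rewrite !inE => /andP[/andP[tJ hS] tS]; apply/andP; split.
  by move: hS tS; rewrite /ahead /atail; case: t.2.2 => -> /negbTE->.
by apply/exists_inP; exists t.
Qed.

(** * Edmonds' theorem on packing arborescences *)

Definition enters (S : {set 'I_n}) (a : arc) := (ahead a \in S) && (atail a \notin S).

Definition residual B a := cap a.1 - #|arcs_of B a|.

Definition indeg B S := \sum_(a | enters S a) residual B a.

Lemma indeg_submod B S S' :
  indeg B (S :&: S') + indeg B (S :|: S') <= indeg B S + indeg B S'.
Proof.
rewrite /indeg !(big_mkcond (enters _)) -!big_split /=; apply: leq_sum => a _.
rewrite /enters !inE; do 4!case: (_ \in _) => //=; lia.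
Qed.

(* A partial packing: the colours below [c] carry spanning arborescences, colour
   [c] an arborescence on [S]; what is left over still satisfies the cut
   condition for the remaining colours. *)
Record packing B c S : Prop := Packing {
  packing_root : r \in S;
  packing_free : ind forests B;
  packing_colour : forall t, t \in B -> t.1 < c \/
    [/\ t.1 = c :> nat, atail t.2 \in S & ahead t.2 \in S];
  packing_head : forall t, t \in B -> ahead t.2 != r;
  packing_inj : {in B &, forall t t', t.1 = t'.1 -> ahead t.2 = ahead t'.2 -> t = t'};
  packing_card : #|B| = c * n.-1 + #|S|.-1;
  packing_cap : forall a, #|arcs_of B a| <= cap a.1;
  packing_cut : forall Q, Q != set0 -> r \notin Q -> k - c.+1 <= indeg B Q;
  packing_cut0 : forall Q, Q != set0 -> [disjoint Q & S] -> k - c <= indeg B Q }.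

(* Lovász's argument: a minimal tight set that is not contained in [S] spans an
   arc leaving [S], and by submodularity this arc enters no tight set. *)
Lemma packing_arc B c S : c < k -> packing B c S -> S != setT -> exists a,
  [/\ 0 < residual B a, atail a \in S, ahead a \notin S &
      forall Q, r \notin Q -> enters Q a -> k - c.+1 < indeg B Q].
Proof.
move=> ck P ST.
have more Q Q' : indeg B Q' < indeg B Q ->
    exists a, [/\ 0 < residual B a, enters Q a & ~~ enters Q' a].
  move=> h; suff /existsP[a /and3P[]] :
      [exists a, [&& 0 < residual B a, enters Q a & ~~ enters Q' a]] by exists a.
  apply: contraTT h; rewrite negb_exists -leqNgt => /forallP h.
  rewrite /indeg !(big_mkcond (enters _)); apply: leq_sum => a _.
  have := h a; case: (enters Q a) => //=; case: (enters Q' a) => //=.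
  by rewrite andbT lt0n negbK => /eqP->.
have more0 Q : 0 < indeg B Q -> exists a, 0 < residual B a /\ enters Q a.
  move=> h; have [|a [h1 h2 _]] := more Q set0; last by exists a.
  by rewrite {1}/indeg big1 // => a; rewrite /enters inE.
pose bad Q := [&& r \notin Q, ~~ (Q \subset S) & indeg B Q <= k - c.+1].
case: (boolP [exists Q, bad Q]) => [/existsP[Q0 badQ0]|/existsPn nobad]; last first.
  have [|a [a1 /andP[a2 a3]]] := more0 (~: S).
    apply: (@leq_trans (k - c)); first by rewrite subn_gt0.
    apply: (packing_cut0 P); last by rewrite disjoints_subset.
    by apply: contraNneq ST => S0; rewrite -(setCK S) S0 setC0.
  move: a2 a3; rewrite !inE negbK => a2 a3; exists a; split=> // Q rQ /andP[aQ _].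
  rewrite ltnNge; apply: contra (nobad Q) => hQ; rewrite /bad rQ hQ andbT /=.
  by apply/subsetPn; exists (ahead a).
have [Q /minsetP[/and3P[rQ QS iQ] minQ] _] := minset_exists (P := bad) badQ0.
(* [Q :\: S] avoids [S], so by [packing_cut0] its residual in-degree exceeds that of the tight [Q],
   and some arc enters it without entering [Q]: its tail is in both [Q] and [S]. *)
have [|a [a1 /andP[a2 a3] a4]] := more (Q :\: S) Q.
  apply: leq_ltn_trans iQ _; apply: (@leq_trans (k - c)); first by clear -ck; lia.
  apply: (packing_cut0 P); first by rewrite setD_eq0.
  by rewrite disjoints_subset; apply/subsetP => v; rewrite !inE => /andP[].
move: a2 a3; rewrite !inE => /andP[aS aQ]; rewrite negb_and negbK.
have tQ : atail a \in Q by move: a4; rewrite /enters aQ /= negbK.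
rewrite tQ orbF => tS; exists a; split=> // Q' rQ' /andP[aQ' tQ'].
rewrite ltnNge; apply/negP => iQ'.
(* If the arc entered a tight [Q'], submodularity would make [Q :&: Q'] tight. This set contains the
   head but not the tail, so it is a smaller bad set. *)
have badI : bad (Q :&: Q').
  apply/and3P; split; first by rewrite inE negb_and rQ.
    by apply/subsetPn; exists (ahead a); rewrite ?inE ?aQ.
  have := indeg_submod B Q Q'.
  have : k - c.+1 <= indeg B (Q :|: Q').
    apply: (packing_cut P); last by rewrite inE negb_or rQ.
    by apply/set0Pn; exists (ahead a); rewrite inE aQ.
  by clear -iQ iQ'; lia.
by have /setP/(_ (atail a)) := minQ _ badI (subsetIl _ _); rewrite inE tQ (negbTE tQ').
Qed.

(** The head of the new arc is outside [S], so colour [c] stays a forest; the in-degree drops only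
    for sets that the arc enters, and these have slack by [packing_arc]. Sets disjoint from the
    enlarged [S] are not entered. *)
Lemma packing_grow B c S : c < k -> packing B c S -> S != setT ->
  exists B' S', packing B' c S' /\ #|S'| = #|S|.+1.
Proof.
move=> ck P ST; have [a [a1 aS aS' a4]] := packing_arc ck P ST.
pose t : elt := (Ordinal ck, a).
have tB : t \notin B.
  by apply/negP => /(packing_colour P)[|[_ _]]; rewrite /= ?ltnn // (negbTE aS').
have rS := packing_root P.
have cA b : #|arcs_of (t |: B) b| = (b == a) + #|arcs_of B b|.
  rewrite /arcs_of; case: eqP => [->|ba].
    have -> : [set s in t |: B | s.2 == a] = t |: [set s in B | s.2 == a].
      by apply/setP => s; rewrite !inE; case: eqP => [->|//]; rewrite eqxx.
    by rewrite cardsU1 inE (negbTE tB).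
  apply: eq_card => s; rewrite !inE; case: eqP => [->|//].
  by rewrite (negbTE tB) /=; case: eqP => // e; case: ba.
have rE b : residual (t |: B) b = residual B b - (b == a).
  by rewrite /residual cA addnC subnDA.
have iE Q : indeg B Q = indeg (t |: B) Q + enters Q a.
  rewrite /indeg; case: (boolP (enters Q a)) => ha.
    rewrite (bigD1 a) //= [in RHS](bigD1 a) //= rE eqxx subn1.
    rewrite addnAC addn1 prednK //; congr (_ + _); apply: eq_bigr => b /andP[_ /negbTE ba].
    by rewrite rE ba subn0.
  rewrite addn0; apply: eq_bigr => b hb; rewrite rE; case: eqP => [ba|_]; last by rewrite subn0.
  by rewrite -ba hb in ha.
have ar : ahead a != r by apply: contraNneq aS' => ->.
exists (t |: B), (ahead a |: S); split; last by rewrite cardsU1 aS'.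
split.
- by rewrite inE rS orbT.
- rewrite /= vfreeU1 //; apply/andP; split; last exact: (packing_free P).
  rewrite avec_span.
  have /subsetP h : rch (adj B (Ordinal ck)) [set atail a] \subset S.
    apply: rch_min => [|u v uS /exists_inP[s sB /andP[/eqP sc]]]; first by rewrite sub1set.
    have [|[_ h1 h2]] := packing_colour P sB; first by rewrite sc /= ltnn.
    by case/orP => /andP[/eqP e1 /eqP e2]; [rewrite -e2 | rewrite -e1].
  by apply/negP => /h; rewrite (negbTE aS').
- move=> s; rewrite inE => /orP[|/(packing_colour P)[|[h1 h2 h3]]]; last 2 first.
  + by left.
  + by right; rewrite !inE h2 h3 !orbT.
  by rewrite inE => /eqP->; right; rewrite !inE /= aS eqxx orbT.
- by move=> s; rewrite 2!inE => /orP[/eqP-> //|/(packing_head P)].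
- have new s : s \in B -> s.1 = Ordinal ck -> ahead s.2 <> ahead a.
    move=> sB sc sa; have [|[_ _]] := packing_colour P sB; first by rewrite sc /= ltnn.
    by rewrite sa (negbTE aS').
  move=> s s'; rewrite 2!inE => /orP[/eqP->|sB]; rewrite 2!inE => /orP[/eqP->|sB'] //=.
  + by move=> e1 e2; case: (new _ sB' (esym e1)).
  + by move=> e1 e2; case: (new _ sB e1).
  + exact: (packing_inj P).
- rewrite !cardsU1 tB aS' (packing_card P) /=.
  have : 0 < #|S| by apply/card_gt0P; exists r.
  by move=> S1; rewrite !add1n /= -addnS prednK.
- move=> b; rewrite cA; case: eqP => [->|_]; last exact: (packing_cap P).
  by move: a1; rewrite /residual subn_gt0.
- move=> Q Q0 rQ; case: (boolP (enters Q a)) => ha.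
    by have := a4 Q rQ ha; rewrite iE ha addn1 ltnS.
  by have := packing_cut P Q0 rQ; rewrite iE (negbTE ha) addn0.
- move=> Q Q0 dQ; have dQS : [disjoint Q & S].
    by apply: disjointWr dQ; apply: subsetUr.
  have := packing_cut0 P Q0 dQS; rewrite iE.
  have -> : enters Q a = false.
    rewrite /enters; apply/negP => /andP[aQ _].
    by have := disjointFr dQ aQ; rewrite !inE eqxx.
  by rewrite addn0.
Qed.

Lemma packing_fill B c S : c < k -> packing B c S -> exists B', packing B' c setT.
Proof.
move=> ck; have [d] := ubnP (n - #|S|); elim: d B S => // d IHd B S hd P.
case: (eqVneq S setT) => [SE|ST]; first by exists B; rewrite -SE.
have [B' [S' [P' cS]]] := packing_grow ck P ST; apply: IHd P'.
have : #|S'| <= n by rewrite -[X in _ <= X]card_ord max_card.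
by move: hd; rewrite cS; clear; lia.
Qed.

(** When colour [c] spans all vertices, [packing_cut] for [c] is exactly [packing_cut0] for the next
    colour, whose arborescence starts at the root alone. *)
Lemma packing_next B c : packing B c setT -> packing B c.+1 [set r].
Proof.
move=> P; split; last first.
- move=> Q Q0 rQ; apply: (packing_cut P) => //.
  by rewrite disjoint_sym disjoints1 in rQ.
- move=> Q Q0 rQ; apply: leq_trans (packing_cut P Q0 rQ).
  by apply: leq_sub2l.
- exact: (packing_cap P).
- rewrite (packing_card P) cardsT card_ord cards1 mulSn addn0 addnC //.
- exact: (packing_inj P).
- exact: (packing_head P).
- move=> t /(packing_colour P)[h|[h _ _]]; left; first exact: ltnW.
  by rewrite h.
- exact: (packing_free P).
- by rewrite inE.
Qed.

(** Of the arborescences only what makes a common base is retained: forests in every colour, the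
    degree and capacity bounds, and the cardinality. *)
Lemma arborescence_packing :
  (forall S, S != set0 -> r \notin S -> k <= \sum_(a | enters S a) cap a.1) ->
  exists B : {set elt}, [/\ ind forests B, lam B & #|B| = k * n.-1].
Proof.
move=> cut.
have [B P] : exists B, packing B k [set r].
  suff H c : c <= k -> exists B, packing B c [set r] by apply: H.
  elim: c => [|c IHc] ck; last first.
    have [B P] := IHc (ltnW ck); have [B' P'] := packing_fill ck P.
    by exists B'; apply: packing_next.
  have a0 a : #|arcs_of set0 a| = 0.
    by apply/eqP; rewrite cards_eq0; apply/eqP/setP => t; rewrite !inE.
  have i0 Q : indeg set0 Q = \sum_(a | enters Q a) cap a.1.
    by apply: eq_bigr => a _; rewrite /residual a0 subn0.
  exists set0; split; rewrite ?inE //.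
  - exact: vfree_set0.
  - by move=> t; rewrite inE.
  - by move=> t; rewrite inE.
  - by move=> t t'; rewrite inE.
  - by rewrite cards0 cards1 mul0n.
  - by move=> a; rewrite a0.
  - by move=> Q Q0 rQ; rewrite i0 (leq_trans _ (cut Q Q0 rQ)) // leq_subr.
  - move=> Q Q0; rewrite disjoint_sym disjoints1 => rQ.
    by rewrite i0 (leq_trans _ (cut Q Q0 rQ)) // leq_subr.
exists B; split; first exact: (packing_free P).
  apply/andP; split; apply/forallP => v; first exact: (packing_cap P).
  case: eqP => [->|_].
    rewrite leqn0 cards_eq0; apply/eqP/setP => t; rewrite !inE.
    by apply/negP => /andP[/(packing_head P)/negbTE->].
  rewrite -[X in _ <= X](card_ord k).
  (* A colour has at most one arc into each vertex, so the arcs into [v] are counted by their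
     colours. *)
  have /card_in_imset <- : {in heads_of B v &, injective (fun t => t.1)}.
    move=> t t'; rewrite !inE => /andP[tB /eqP e] /andP[tB' /eqP e'] h.
    by apply: (packing_inj P) => //; rewrite e e'.
  exact: max_card.
by rewrite (packing_card P) cards1 addn0.
Qed.

End Arcs.

(** * Minimum cuts *)

Section MinCut.
Variables (V E : finType) (cap : E -> nat) (k : nat) (d : V).
Implicit Types (s t : E -> V) (A X : {set V}) (u v p q : V).

Definition cutval s t X := \sum_(e | (s e \in X) (+) (t e \in X)) cap e.

Definition attach s t A u :=
  \sum_(e | (s e \in A) && (t e == u) || (t e \in A) && (s e == u)) cap e.

(** The vertices are read off the edges, with repetitions. Isolated vertices are invisible, but a
    connected graph with an edge has none, see [mem_ends]. *)
Definition ends s t := [seq s e | e <- enum E] ++ [seq t e | e <- enum E].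

Definition ma_cands s t A :=
  [seq u <- ends s t | (u \notin A) &&
     all (fun v => (v \in A) || (attach s t A v <= attach s t A u)) (ends s t)].

(* One step of a maximum adjacency order: the visited set and its last two
   vertices. *)
Definition ma_step s t (x : {set V} * (V * V)) :=
  if all (fun v => v \in x.1) (ends s t) then x
  else (head d (ma_cands s t x.1) |: x.1, (x.2.2, head d (ma_cands s t x.1))).

Definition ma_run s t :=
  let v0 := head d (ends s t) in iter (size (ends s t)) (ma_step s t) ([set v0], (v0, v0)).

Definition identify p q v := if v == q then p else v.

(** A phase of the Stoer-Wagner algorithm: the last vertex of a maximum adjacency order forms a
    minimum cut against the last but one; once this cut has been compared with [k], the two can be
    merged. Merging produces loops, which lie in no cut. When a single vertex is left, the two
    coincide and the test passes. *)
Definition mc_step (x : (E -> V) * (E -> V) * bool) :=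
  let pq := (ma_run x.1.1 x.1.2).2 in
  (((fun e => identify pq.1 pq.2 (x.1.1 e)), (fun e => identify pq.1 pq.2 (x.1.2 e))),
   x.2 && ((pq.1 == pq.2) || (k <= cutval x.1.1 x.1.2 [set pq.2]))).

Definition mincut_test s t := (iter (size (ends s t)) mc_step (s, t, true)).2.

Section Order.
Variables s t : E -> V.

Inductive ma_order : {set V} -> V -> Prop :=
| ma_order1 v : ma_order [set v] v
| ma_orderS A v u : ma_order A v -> u \notin A ->
    (forall u', u' \in ends s t -> u' \notin A -> attach s t A u' <= attach s t A u) ->
    ma_order (u |: A) u.

Definition cutin A X :=
  \sum_(e | [&& s e \in A, t e \in A & (s e \in X) (+) (t e \in X)]) cap e.

Lemma mem_ma_order A v : ma_order A v -> v \in A.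
Proof. by case=> [w|B w u _ _ _]; rewrite !inE eqxx. Qed.

Lemma attachU1 A u0 u : attach s t (u0 |: A) u <= attach s t A u + attach s t [set u0] u.
Proof.
rewrite /attach !(big_mkcond (fun e => _ || _)) -big_split /=; apply: leq_sum => e _.
rewrite !inE; case: (s e == u0); case: (t e == u0); case: (s e == u); case: (t e == u);
  by case: (s e \in A); case: (t e \in A) => //=; lia.
Qed.

Lemma attach1C u v : attach s t [set u] v = attach s t [set v] u.
Proof.
by apply: eq_bigl => e; rewrite !inE orbC; congr (_ || _); rewrite andbC.
Qed.

Lemma cutin_add x y (B X : {set V}) : x \notin B -> y \in B -> (x \in X) (+) (y \in X) ->
  cutin B X + attach s t [set x] y <= cutin (x |: B) X.
Proof.
move=> xB yB sep; rewrite /cutin /attach !(big_mkcond (fun e => _ || _)).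
rewrite !(big_mkcond (fun e => [&& _, _ & _])) -big_split /=; apply: leq_sum => e _.
have yx : (y == x) = false by apply: contraNF xB => /eqP <-.
rewrite !inE; case: (s e =P x) => [->|_].
  rewrite (negbTE xB) /= add0n [x == y]eq_sym yx andbF orbF.
  by case: (t e =P y) => [->|_]; rewrite ?yB ?orbT ?sep.
case: (t e =P x) => [->|_].
  rewrite (negbTE xB) /= andbF add0n; case: (s e =P y) => [->|_] //.
  by rewrite yB addbC sep.
by rewrite /= addn0.
Qed.

Lemma cutin_le A X : cutin A X <= cutval s t X.
Proof.
rewrite /cutin /cutval !(big_mkcond (fun e => [&& _, _ & _])).
rewrite !(big_mkcond (fun e => _ (+) _)); apply: leq_sum => e _ /=.
by case: (_ \in A); case: (_ \in A) => //=; case: ifP.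
Qed.

(* Any cut separating the last vertex of a maximum adjacency order from a
   further vertex [u] costs at least the attachment of [u] to the order. *)
Lemma ma_order_cut A v : ma_order A v -> forall u X, u \in ends s t -> u \notin A ->
  (v \in X) (+) (u \in X) -> attach s t A u <= cutin (u |: A) X.
Proof.
elim=> [w|B w u0 oB IH u0B h] u X uE uA sep.
  apply: leq_trans (cutin_add (x := u) (y := w) _ _ _); last first.
  - by rewrite addbC.
  - by rewrite inE.
  - by [].
  by rewrite attach1C leq_addl.
have [uB uu0] : u \notin B /\ u != u0 by move: uA; rewrite !inE negb_or => /andP[].
have hu := h u uE uB.
apply: leq_trans (attachU1 _ _ _) _.
(* If [w] and [u] are separated, induction bounds the attachment of [u] to [B]. Otherwise [w] and
   [u0] are separated, and induction bounds the attachment of [u0], which is at least that of [u].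
   In both cases the edges between [u] and [u0] account for the rest. *)
case: (boolP ((w \in X) (+) (u \in X))) => wu.
  apply: (@leq_trans (cutin (u |: B) X + attach s t [set u0] u)).
    by rewrite leq_add2r; apply: IH.
  rewrite setUCA; apply: cutin_add => //; last by rewrite !inE eqxx.
  by rewrite !inE negb_or eq_sym uu0.
apply: (@leq_trans (cutin (u0 |: B) X + attach s t [set u] u0)).
  rewrite (attach1C u) leq_add2r; apply: leq_trans hu _.
  have [u0E|u0E] := boolP (u0 \in ends s t).
    by apply: IH => //; move: wu sep; do 3!case: (_ \in X).
  rewrite /attach big1 // => e; case/orP => /andP[_ /eqP eu].
    by rewrite -eu mem_cat map_f ?orbT ?mem_enum in u0E.
  by rewrite -eu mem_cat map_f ?mem_enum in u0E.
by apply: cutin_add => //; [rewrite !inE eqxx | rewrite addbC].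
Qed.

Lemma ma_order_last A v u X : ma_order A v -> u \notin A -> u \in ends s t ->
  {subset ends s t <= u |: A} -> (v \in X) (+) (u \in X) ->
  cutval s t [set u] <= cutval s t X.
Proof.
move=> oA uA uE sub sep; apply: leq_trans (cutin_le (u |: A) X).
apply: leq_trans (ma_order_cut oA uE uA sep).
rewrite /cutval /attach (big_mkcond (fun e => _ (+) _)) (big_mkcond (fun e => _ || _)).
apply: leq_sum => e _ /=; have := sub (s e); have := sub (t e).
rewrite !mem_cat !map_f ?mem_enum ?orbT // !inE => /(_ isT) + /(_ isT).
case: (s e =P u) => [->|_] /=; case: (t e =P u) => [->|_] //=.
  by move=> -> _; rewrite orbT.
by move=> _ ->.
Qed.

Definition ma_inv (x : {set V} * (V * V)) :=
  x.2.2 \in ends s t /\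
  ((x.1 = [set x.2.2] /\ x.2.1 = x.2.2) \/
   exists A, [/\ ma_order A x.2.1, x.2.2 \notin A, x.2.1 \in ends s t, x.1 = x.2.2 |: A &
     forall u', u' \in ends s t -> u' \notin A -> attach s t A u' <= attach s t A x.2.2]).

Lemma ma_invS x : ma_inv x -> ~~ all (fun v => v \in x.1) (ends s t) ->
  ma_inv (ma_step s t x) /\ #|(ma_step s t x).1| = #|x.1|.+1.
Proof.
move: x => [A [p q]] inv nall; rewrite /ma_step (negbTE nall) /=.
have [u [uE uA umax]] : exists u, [/\ u \in ends s t, u \notin A &
    forall v, v \in ends s t -> v \notin A -> attach s t A v <= attach s t A u].
  case/allPn: nall => v0 v0E v0A.
  have P0 : (v0 \in ends s t) && (v0 \notin A) by rewrite v0E.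
  have [u /andP[uE uA] um] := arg_maxnP (P := fun v => (v \in ends s t) && (v \notin A)) (attach s t A) P0.
  by exists u; split=> // v vE vA; apply: um; rewrite vE.
have : head d (ma_cands s t A) \in ma_cands s t A.
  have : u \in ma_cands s t A.
    rewrite mem_filter uA uE andbT; apply/allP => v vE.
    by case: (boolP (v \in A)) => //= vA; apply: umax.
  by case: (ma_cands s t A) => //= a l _; rewrite mem_head.
set c := head d _; rewrite mem_filter => /andP[/andP[cA /allP cmax] cE].
split; last by rewrite cardsU1 cA.
split=> //=; right; exists A; split=> //; last first.
- by move=> v vE vA; have := cmax v vE; rewrite (negbTE vA).
- by case: inv.
case: inv => /= qE [[-> _]|[B [oB qB pE -> h]]]; first exact: ma_order1.
exact: ma_orderS oB qB h.
Qed.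

(** Each round before completion adds a vertex, and visited vertices stay among the ends, so
    [size (ends s t)] rounds are enough. *)
Lemma ma_runP : 0 < #|E| ->
  let x := ma_run s t in [/\ ma_inv x & {subset ends s t <= x.1}].
Proof.
move=> /card_gt0P[e0 _]; rewrite /ma_run; set v0 := head d (ends s t).
have v0E : v0 \in ends s t.
  rewrite /v0; have : s e0 \in ends s t by rewrite mem_cat map_f ?mem_enum.
  by case: (ends s t) => //= a l _; rewrite mem_head.
have H j : let x := iter j (ma_step s t) ([set v0], (v0, v0)) in
    ma_inv x /\ ({subset ends s t <= x.1} \/ j < #|x.1|).
  elim: j => [|j [IH1 IH2]] /=.
    by split; [split=> //=; left | right; rewrite cards1].
  set x := iter j _ _ in IH1 IH2 *.
  case: (boolP (all (fun v => v \in x.1) (ends s t))) => [al|nall].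
    by rewrite /ma_step al; split=> //; left; apply/allP.
  have [inv' c'] := ma_invS IH1 nall; split=> //; right; rewrite c'.
  by case: IH2 => // /allP al; rewrite al in nall.
have /= [inv h] := H (size (ends s t)); split=> //.
case: h => // h; set x := iter _ _ _ in inv h *.
have sub : x.1 \subset ends s t.
  have H2 j : (iter j (ma_step s t) ([set v0], (v0, v0))).1 \subset ends s t.
    elim: j => [|j IHj] /=; first by apply/subsetP => v; rewrite inE => /eqP->.
    have [ij _] := H j; set y := iter j _ _ in IHj ij *.
    case: (boolP (all (fun v => v \in y.1) (ends s t))) => [al|nall]; first by rewrite /ma_step al.
    have [[qE _] _] := ma_invS ij nall; move: qE; rewrite /ma_step (negbTE nall) /= => qE.
    by apply/subsetP => v; rewrite !inE => /orP[/eqP->//|/(subsetP IHj)].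
  exact: H2.
by have := leq_trans h (leq_trans (subset_leq_card sub) (card_size _)); rewrite ltnn.
Qed.

Definition good := forall X, (exists a b, [/\ a \in ends s t, b \in ends s t, a \in X & b \notin X]) ->
  k <= cutval s t X.

End Order.

Lemma ma_run_pair s t (x := ma_run s t) : 0 < #|E| -> x.2.1 != x.2.2 ->
  [/\ x.2.1 \in ends s t, x.2.2 \in ends s t &
   forall X, (x.2.1 \in X) (+) (x.2.2 \in X) -> cutval s t [set x.2.2] <= cutval s t X].
Proof.
move=> E0 pq; have [[qE inv] sub] := ma_runP s t E0.
case: inv => [[_ h]|[A [oA qA pE xE h]]]; first by rewrite -/x h eqxx in pq.
by split=> // X sep; apply: ma_order_last oA qA qE _ sep; rewrite -xE.
Qed.

Lemma ma_run_single s t (x := ma_run s t) : 0 < #|E| -> x.2.1 = x.2.2 ->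
  forall v, v \in ends s t -> v = x.2.2.
Proof.
move=> E0 pq v vE; have [[qE inv] sub] := ma_runP s t E0.
case: inv => [[h _]|[A [/mem_ma_order oA qA _ _ _]]]; last first.
  by move: oA qA; rewrite -/x pq => ->.
by have := sub v vE; rewrite h inE => /eqP.
Qed.

Section Merge.
Variables (s t : E -> V) (p q : V).
Let s' e := identify p q (s e).
Let t' e := identify p q (t e).

Lemma mem_ends_identify v : (v \in ends s' t') -> exists2 w, w \in ends s t & v = identify p q w.
Proof.
rewrite mem_cat => /orP[] /mapP[e _ ->]; [exists (s e) | exists (t e)] => //.
  by rewrite mem_cat map_f ?mem_enum.
by rewrite mem_cat map_f ?mem_enum ?orbT.
Qed.

Lemma ends_identify w : w \in ends s t -> identify p q w \in ends s' t'.
Proof.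
rewrite mem_cat => /orP[] /mapP[e _ ->]; rewrite mem_cat; apply/orP; [left|right];
  by apply/mapP; exists e; rewrite ?mem_enum.
Qed.

Lemma cutval_identify X : cutval s' t' X = cutval s t [set v | identify p q v \in X].
Proof. by apply: eq_bigl => e; rewrite !inE. Qed.

(** Cuts separating [p] from [q] are controlled by the cut around [q]; all others are cuts of the
    graph in which [q] is merged into [p]. *)
Lemma good_identify : p != q -> p \in ends s t -> q \in ends s t ->
  (forall X, (p \in X) (+) (q \in X) -> cutval s t [set q] <= cutval s t X) ->
  good s t <-> k <= cutval s t [set q] /\ good s' t'.
Proof.
move=> pq pE qE hX; split=> [g|[kq g'] X [a [b [aE bE aX bX]]]].
  split; first by apply: g; exists q, p; rewrite !inE eqxx.
  move=> X [a [b [/mem_ends_identify[a0 a0E ->] /mem_ends_identify[b0 b0E ->] aX bX]]].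
  by rewrite cutval_identify; apply: g; exists a0, b0; rewrite !inE.
case: (boolP ((p \in X) (+) (q \in X))) => [/hX|npq]; first exact: leq_trans.
have mX v : (identify p q v \in X) = (v \in X).
  by rewrite /identify; case: eqP => [->|//]; move: npq; do 2!case: (_ \in X).
have -> : X = [set v | identify p q v \in X] by apply/setP => v; rewrite inE mX.
rewrite -cutval_identify; apply: g'; exists (identify p q a), (identify p q b).
by rewrite !ends_identify // !mX.
Qed.

Lemma card_ends_identify : p != q -> p \in ends s t -> q \in ends s t ->
  #|ends s' t'| < #|ends s t|.
Proof.
move=> pq pE qE; apply: proper_card; apply/properP; split.
  apply/subsetP => v /mem_ends_identify[w wE ->]; rewrite /identify.
  by case: eqP.
exists q => //; apply/negP => /mem_ends_identify[w wE].
by rewrite /identify; case: eqP => [_ qp|wq qw]; [rewrite qp eqxx in pq | case: wq].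
Qed.

End Merge.

Lemma good_single s t (v : V) : (forall u, u \in ends s t -> u = v) -> good s t.
Proof. by move=> h X [a [b [/h -> /h -> ->]]]. Qed.

(** Induction on the number of phases left, for graphs with at most one vertex more than phases. A
    phase either loses a vertex or finds a single one left, where the cut condition is void. *)
Lemma mincut_testP s t : 0 < #|E| -> reflect (good s t) (mincut_test s t).
Proof.
move=> E0; rewrite /mincut_test.
suff H j s0 t0 ok : #|ends s0 t0| <= j.+1 ->
    (iter j mc_step (s0, t0, ok)).2 <-> ok /\ good s0 t0.
  have [|h1 h2] := H (size (ends s t)) s t true.
    exact: leq_trans (card_size _) (leqnSn _).
  by apply: (iffP idP) => [/h1[] //|g]; apply: h2.
elim: j s0 t0 ok => [|j IHj] s0 t0 ok hc.
  rewrite /=; split=> [okE|[]//]; split=> // X [a [b [aE bE aX bX]]].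
  have : #|[set a; b]| <= #|ends s0 t0|.
    by apply: subset_leq_card; apply/subsetP => v; rewrite !inE => /orP[] /eqP->.
  move/leq_trans/(_ hc); rewrite cards2; case: eqP => // ab.
  by rewrite ab (negbTE bX) in aX.
rewrite iterSr /mc_step /=.
set p := (ma_run s0 t0).2.1; set q := (ma_run s0 t0).2.2.
case: (eqVneq p q) => [pq|pq].
  have all_q := ma_run_single E0 pq.
  have g0 := good_single all_q.
  rewrite andbT IHj.
    split=> [[-> _]|[-> _]]; split=> //; apply: (@good_single _ _ q) => v.
    by case/mem_ends_identify => w /all_q -> ->; rewrite /identify; case: eqP.
  apply: (@leq_trans 1) => //; rewrite -(cards1 q); apply: subset_leq_card.
  apply/subsetP => v /mem_ends_identify[w /all_q -> ->]; rewrite inE /identify -/q.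
  by rewrite eqxx pq.
have [pE qE hX] := ma_run_pair E0 pq.
rewrite IHj /=; last first.
  by rewrite -ltnS; apply: leq_trans hc; apply: card_ends_identify.
rewrite (good_identify pq pE qE hX); split=> [[/andP[-> ->] g]|[-> [-> g]]] //.
Qed.

End MinCut.

(** * Polynomial-time closure, matroid intersection and minimum cuts *)

(** The length of the list only fixes the number of rounds. The size bound is asked for all states
    rather than those visited, since a state will be a table whose size has a bound independent of
    the bits and numbers in it. *)
Lemma pt_iterf (X : Type) (R : X -> realFieldType) (i : forall x, tree (R x))
    (lt : forall x, seq (tree (R x))) (A : X -> Type) (eA : forall x, A x -> tree (R x))
    (f : forall x, A x -> A x) (a0 : forall x, A x) :
  pt i (fun x => tlist (lt x)) -> pt i (fun x => eA x (a0 x)) ->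
  pt (fun p : {x & A x} => Node (i (tag p)) (eA (tag p) (tagged p)))
     (fun p => eA (tag p) (f (tag p) (tagged p))) ->
  (exists c, forall x a, tree_size (eA x a) <= pw (tree_size (i x)) c) ->
  pt i (fun x => eA x (iter (size (lt x)) (f x) (a0 x))).
Proof.
move=> hl h0 hf [c hc].
have := @pt_iter X R i lt (fun x j => eA x (iter j (f x) (a0 x))) hl h0.
apply; last by exists c => x j _; apply: hc.
pose g (p : {x & 'I_(size (lt x))}) : {x & A x} :=
  Tagged _ (iter (tagged p) (f (tag p)) (a0 (tag p))).
apply: pt_comp (pt_reindex g hf).
exact: (pt_expr _ (e := ENode (Left (Left (Var 0))) (Right (Var 0)))).
Qed.

Lemma tlist_map_size (R : realFieldType) (T : Type) (f g : T -> tree R) K (l : seq T) :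
  (forall t, tree_size (f t) <= K + tree_size (g t)) ->
  tree_size (tlist [seq f t | t <- l]) <= K.+1 * tree_size (tlist [seq g t | t <- l]).
Proof.
move=> h; rewrite !tree_size_tlist !big_map; elim: l => [|t l IHl].
  by rewrite !big_nil; lia.
by rewrite !big_cons; have := h t; lia.
Qed.

(** What a row adds to its key consists of bits and atoms, of size at most [K]; hence a bound
    uniform in [a]. *)
Lemma table_size_poly (X : Type) (R : X -> realFieldType) (i : forall x, tree (R x))
    (Y A : X -> Type) (ys : forall x, seq (Y x)) (g : forall x, Y x -> tree (R x))
    (f : forall x, A x -> Y x -> tree (R x)) K :
  pt i (fun x => tlist [seq g x y | y <- ys x]) ->
  (forall x a y, tree_size (f x a y) <= K + tree_size (g x y)) ->
  exists c, forall x a, tree_size (tlist [seq f x a y | y <- ys x]) <= pw (tree_size (i x)) c.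
Proof.
move=> /pt_size[c hc] h; exists (c + K.+1) => x a.
apply: leq_trans (tlist_map_size _ (h x a)) _.
apply: leq_trans (pw_mulX _ _ _).
by apply: leq_mul; [apply: ltnW; apply: ltn_expl | apply: hc].
Qed.

Lemma tbool_size (R : realFieldType) b : tree_size (tbool R b) <= 3.
Proof. by case: b. Qed.

(** * Reachability by repeated growth *)

Section Closure.
Variables (T : finType) (r : rel T) (S : {set T}).

Definition grow (U : {set T}) : {set T} := [set b | (b \in U) || [exists a in U, r a b]].

Lemma iter_growP n b : (b \in iter n grow S) <->
  exists a p, [/\ a \in S, path r a p, size p <= n & b = last a p].
Proof.
elim: n b => [|n IHn] b.
  split=> [bS|[a [[|? ?] [aS _ // _ ->]]]]; last by [].
  by exists b, [::].
rewrite iterS inE; split=> [/orP[/IHn[a [p [aS pp sp ->]]]|/exists_inP[c /IHn[a [p [aS pp sp ->]]] rb]]|].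
- by exists a, p; split=> //; apply: leqW.
- exists a, (rcons p b); split=> //; last by rewrite last_rcons.
    by rewrite rcons_path pp.
  by rewrite size_rcons.
- move=> [a [p [aS + + ->]]]; case/lastP: p => [_ _|p c].
    by apply/orP; left; apply/IHn; exists a, [::].
  rewrite rcons_path size_rcons last_rcons => /andP[pp rc] sp; apply/orP; right.
  by apply/exists_inP; exists (last a p) => //; apply/IHn; exists a, p.
Qed.

Lemma iter_grow n : #|T| <= n -> iter n grow S = rch r S.
Proof.
move=> nT; apply/setP => b; rewrite [RHS]inE; apply/idP/exists_inP => [/iter_growP[a [p [aS pp _ ->]]]|].
  by exists a => //; apply/connectP; exists p.
move=> [a aS /connectP[p0 /shortenP[p pp up _] ->]].
apply/iter_growP; exists a, p; split=> //.
by apply: leq_trans nT; apply: ltnW; rewrite -[X in X <= _]/(size (a :: p)) -(card_uniqP up) max_card.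
Qed.

End Closure.

Section PtRch.
Variables (Z : Type) (R : Z -> realFieldType) (T : Z -> finType).
Variables (j : forall z, tree (R z)) (enc : forall z, T z -> tree (R z)) (ls : forall z, seq (T z)).
Variables (r : forall z, rel (T z)) (S : forall z, {set T z}).
Hypothesis lsT : forall z t, t \in ls z.
Hypothesis hl : pt j (fun z => tlist [seq enc t | t <- ls z]).
Hypothesis hr : pt (fun p : {z & (T z * T z)%type} =>
    Node (j (tag p)) (Node (enc (tagged p).1) (enc (tagged p).2)))
  (fun p => tbool (R (tag p)) (r (tagged p).1 (tagged p).2)).
Hypothesis hS : pt (fun p : {z & T z} => Node (j (tag p)) (enc (tagged p)))
  (fun p => tbool (R (tag p)) (tagged p \in S (tag p))).

(** A set is handed to a program as the list of all elements, each with its membership bit, so that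
    a loop over the elements finds the bit next to the element. *)
Definition tab z (U : {set T z}) :=
  tlist [seq Node (enc t) (tbool (R z) (t \in U)) | t <- ls z].

Lemma existsb_has (fT : finType) (s : seq fT) (q : pred fT) : (forall t, t \in s) ->
  [exists t, q t] = has q s.
Proof.
move=> h; apply/existsP/hasP => [[t qt]|[t _ qt]]; by exists t.
Qed.

Lemma forallb_all (fT : finType) (s : seq fT) (q : pred fT) : (forall t, t \in s) ->
  [forall t, q t] = all q s.
Proof. by move=> h; apply/forallP/allP => q1 t; [move=> _ | ]; apply: q1. Qed.

Lemma pt_rch : pt j (fun z => tab (rch (@r z) (S z))).
Proof.
apply: (@pt_ext _ _ _ (fun z => tab (iter (size [seq enc t | t <- ls z]) (grow (@r z)) (S z)))).
  move=> z; rewrite iter_grow // size_map.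
  have <- : #|ls z| = #|T z| by apply: eq_card => t; rewrite lsT.
  exact: card_size.
apply: (@pt_iterf _ _ j (fun z => [seq enc t | t <- ls z]) (fun z => {set T z}) tab
  (fun z => grow (@r z)) S) => //.
- by apply: (pt_map hl); apply: pt_pair hS; apply: pt_arg.
- pose X1 := {z & {set T z}}.
  pose j1 (p : X1) := Node (j (tag p)) (tab (tagged p)).
  pose e1 (p : X1) (t : T (tag p)) := Node (enc t) (tbool (R (tag p)) (t \in tagged p)).
  have hl1 : pt j1 (fun p => tlist [seq e1 p t | t <- ls (tag p)]).
    exact: (pt_expr _ (e := Right (Var 0))).
  apply: (pt_map hl1).
  pose X2 := {p : X1 & T (tag p)}.
  pose j2 (p : X2) := Node (j1 (tag p)) (e1 (tag p) (tagged p)).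
  apply: pt_pair; first exact: (pt_expr _ (e := Left (Right (Var 0)))).
  apply: (@pt_ext _ _ _ (fun p : X2 => tbool (R (tag (tag p))) ((tagged p \in tagged (tag p)) ||
      has (fun a => (a \in tagged (tag p)) && r a (tagged p)) (ls (tag (tag p)))))).
    by move=> p; rewrite inE (existsb_has _ (lsT (z := _))).
  apply: pt_or; first exact: (pt_expr _ (e := Right (Right (Var 0)))).
  have hl2 : pt j2 (fun p => tlist [seq e1 (tag p) t | t <- ls (tag (tag p))]).
    exact: (pt_expr _ (e := Right (Left (Var 0)))).
  apply: (pt_has hl2); apply: pt_and; first exact: (pt_expr _ (e := Right (Right (Var 0)))).
  pose g (p : {p : X2 & T (tag (tag p))}) : {z & (T z * T z)%type} :=
    Tagged (fun z => T z * T z)%type (tagged p, tagged (tag p)).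
  apply: pt_comp (pt_reindex g hr).
  exact: (pt_expr _ (e := ENode (Left (Left (Left (Var 0))))
    (ENode (Left (Right (Var 0))) (Left (Right (Left (Var 0))))))).
- apply: (@table_size_poly Z R j T (fun z => {set T z}) ls enc
    (fun z U t => Node (enc t) (tbool (R z) (t \in U))) 4 hl).
  by move=> z U t /=; have := tbool_size (R z) (t \in U); lia.
Qed.

End PtRch.

(** * Weighted matroid intersection in polynomial time *)

Section PtWmi.
Variables (X : Type) (R : X -> realFieldType) (T : X -> finType).
Variables (e : forall x, T x -> tree (R x)) (l : forall x, seq (T x)).
Variables (M1 M2 : forall x, matroid (T x)) (c : forall x, T x -> R x).
Variable env : forall x, tree (R x).
Hypothesis lT : forall x t, t \in l x.
Hypothesis pt_l : pt env (fun x => tlist [seq e t | t <- l x]).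
Hypothesis pt_c : pt (fun p : {x & T x} => e (tagged p)) (fun p => Atom (c (tagged p))).
Hypothesis pt_eqT : pt (fun p : {x & (T x * T x)%type} => Node (e (tagged p).1) (e (tagged p).2))
  (fun p => tbool (R (tag p)) ((tagged p).1 == (tagged p).2)).

Definition set_tab x (J : {set T x}) := tlist [seq Node (e t) (tbool (R x) (t \in J)) | t <- l x].

Definition pt_oracle (M : forall x, matroid (T x)) :=
  pt (fun p : {x & {set T x}} => Node (env (tag p)) (set_tab (tagged p)))
     (fun p => tbool (R (tag p)) (ind (M (tag p)) (tagged p))).

Hypothesis pt_M1 : pt_oracle M1.
Hypothesis pt_M2 : pt_oracle M2.
Hypothesis pt_0 : pt env (fun x => Atom 0%R).

Definition stt x := ({set T x} * (T x -> R x))%type.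
Definition XS := {x & stt x}.
Definition sI (q : XS) := (tagged q).1.
Definition sw (q : XS) := (tagged q).2.
Arguments sw : clear implicits.
(** The weight function is stored in the rows of the state, next to the bit of the current set, so a
    change of weights is a map over the table. *)
Definition renc (q : XS) (t : T (tag q)) :=
  Node (e t) (Node (tbool (R (tag q)) (t \in sI q)) (Atom (sw q t))).
Definition stab (q : XS) := tlist [seq renc t | t <- l (tag q)].
Definition iS (q : XS) := Node (env (tag q)) (stab q).

Definition Q1 := {q : XS & T (tag q)}.
Definition Q2 := {q : XS & (T (tag q) * T (tag q))%type}.
Definition in1 (p : Q1) := Node (iS (tag p)) (renc (tagged p)).
Definition in2 (p : Q2) := Node (iS (tag p)) (Node (renc (tagged p).1) (renc (tagged p).2)).

(** An oracle call on a set given by a membership program: the table of the set is first made from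
    the rows of the state. The map [g] says which state the current input contains. *)
Lemma pt_ind_pred (M : forall x, matroid (T x)) (Z : Type) (g : Z -> XS)
    (j : forall z, tree (R (tag (g z)))) (J : forall z, {set T (tag (g z))}) :
  pt_oracle M -> pt j (fun z => iS (g z)) ->
  pt (fun p : {z & T (tag (g z))} => Node (j (tag p)) (renc (tagged p)))
     (fun p => tbool (R (tag (g (tag p)))) (tagged p \in J (tag p))) ->
  pt j (fun z => tbool (R (tag (g z))) (ind (M (tag (g z))) (J z))).
Proof.
move=> hM hj hJ; pose g' z : {x & {set T x}} := Tagged (fun x => {set T x}) (J z).
apply: pt_comp (pt_reindex g' hM); apply: pt_pair; first exact: pt_fst hj.
apply: (pt_map (pt_snd hj)); apply: pt_pair => //.
exact: (pt_expr _ (e := Left (Right (Var 0)))).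
Qed.

Lemma pt_eq_elt (Z : Type) (g : Z -> X) (j : forall z, tree (R (g z))) (a b : forall z, T (g z)) :
  pt j (fun z => e (a z)) -> pt j (fun z => e (b z)) ->
  pt j (fun z => tbool (R (g z)) (a z == b z)).
Proof.
move=> ha hb; pose g' z : {x & (T x * T x)%type} := Tagged (fun x => T x * T x)%type (a z, b z).
exact: pt_comp (pt_pair ha hb) (pt_reindex g' pt_eqT).
Qed.

Lemma pt_swap M : pt_oracle M ->
  pt in2 (fun p => tbool (R (tag (tag p)))
    (ind (M (tag (tag p))) ((tagged p).2 |: sI (tag p) :\ (tagged p).1))).
Proof.
move=> hM; apply: (@pt_ind_pred M _ (fun p : Q2 => tag p) in2
   (fun p => (tagged p).2 |: sI (tag p) :\ (tagged p).1) hM).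
  exact: (pt_expr _ (e := Left (Var 0))).
apply: (@pt_ext _ _ _ (fun p : {z : Q2 & T (tag (tag z))} => tbool (R (tag (tag (tag p))))
  ((tagged p == (tagged (tag p)).2) ||
   (~~ (tagged p == (tagged (tag p)).1) && (tagged p \in sI (tag (tag p))))))).
  by move=> p; rewrite !inE.
have ht : pt (fun p : {z : Q2 & T (tag (tag z))} => Node (in2 (tag p)) (renc (tagged p)))
    (fun p => e (tagged p)) by exact: (pt_expr _ (e := Left (Right (Var 0)))).
apply: pt_or.
  apply: (pt_eq_elt (g := fun p : {z : Q2 & T (tag (tag z))} => tag (tag (tag p))) ht).
  exact: (pt_expr _ (e := Left (Right (Right (Left (Var 0)))))).
apply: pt_and; last exact: (pt_expr _ (e := Left (Right (Right (Var 0))))).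
apply: pt_not.
apply: (pt_eq_elt (g := fun p : {z : Q2 & T (tag (tag z))} => tag (tag (tag p))) ht).
exact: (pt_expr _ (e := Left (Left (Right (Left (Var 0)))))).
Qed.

Lemma pt_free M : pt_oracle M ->
  pt in1 (fun p => tbool (R (tag (tag p))) (tagged p \in free_elts (M (tag (tag p))) (sI (tag p)))).
Proof.
move=> hM.
apply: (@pt_ext _ _ _ (fun p : Q1 => tbool (R (tag (tag p))) (~~ (tagged p \in sI (tag p)) &&
  ind (M (tag (tag p))) (tagged p |: sI (tag p))))); first by move=> p; rewrite inE.
apply: pt_and.
  by apply: pt_not; exact: (pt_expr _ (e := Left (Right (Right (Var 0))))).
apply: (@pt_ind_pred M _ (fun p : Q1 => tag p) in1 (fun p => tagged p |: sI (tag p)) hM).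
  exact: (pt_expr _ (e := Left (Var 0))).
apply: (@pt_ext _ _ _ (fun p : {z : Q1 & T (tag (tag z))} => tbool (R (tag (tag (tag p))))
  ((tagged p == tagged (tag p)) || (tagged p \in sI (tag (tag p)))))).
  by move=> p; rewrite !inE.
apply: pt_or; last exact: (pt_expr _ (e := Left (Right (Right (Var 0))))).
apply: (pt_eq_elt (g := fun p : {z : Q1 & T (tag (tag z))} => tag (tag (tag p)))).
  exact: (pt_expr _ (e := Left (Right (Var 0)))).
exact: (pt_expr _ (e := Left (Right (Left (Var 0))))).
Qed.

Lemma pt_min_free M (wt : forall q : XS, T (tag q) -> R (tag q)) : pt_oracle M ->
  pt in1 (fun p => Atom (wt (tag p) (tagged p))) ->
  pt in1 (fun p => tbool (R (tag (tag p)))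
    (tagged p \in min_free (M (tag (tag p))) (sI (tag p)) (wt (tag p)))).
Proof.
move=> hM hw.
apply: (@pt_ext _ _ _ (fun p : Q1 => tbool (R (tag (tag p)))
  ((tagged p \in free_elts (M (tag (tag p))) (sI (tag p))) &&
   all (fun y => ~~ (y \in free_elts (M (tag (tag p))) (sI (tag p))) ||
     (wt (tag p) (tagged p) <= wt (tag p) y)%R) (l (tag (tag p)))))).
  move=> p; rewrite [in RHS]inE (forallb_all _ (lT (x := _))); congr (tbool _ (_ && _)).
  by apply: eq_all => y; rewrite implybE.
apply: pt_and; first exact: pt_free.
have hl : pt in1 (fun p => tlist [seq renc (q := tag p) t | t <- l (tag (tag p))]).
  exact: (pt_expr _ (e := Right (Left (Var 0)))).
apply: (pt_all hl).
pose Z := {p : Q1 & T (tag (tag p))}.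
pose g (p : Z) : Q1 := Tagged (fun q : XS => T (tag q)) (tagged p).
have call o : pt in1 o -> pt (fun p : Z => Node (in1 (tag p)) (renc (tagged p))) (fun p => o (g p)).
  move=> ho; apply: pt_comp (pt_reindex g ho).
  exact: (pt_expr _ (e := ENode (Left (Left (Var 0))) (Right (Var 0)))).
apply: pt_or; first by apply: pt_not; apply: (call _ (pt_free hM)).
apply: pt_le; last exact: (call _ hw).
exact: (pt_weak (i := in1) (fun p : Q1 => @renc (tag p)) hw).
Qed.

Definition swc (q : XS) := compl_wt (@c (tag q)) (sw q).
Arguments swc : clear implicits.

Lemma pt_sw : pt in1 (fun p => Atom (sw (tag p) (tagged p))).
Proof. exact: (pt_expr _ (e := Right (Right (Right (Var 0))))). Qed.

Lemma pt_swc : pt in1 (fun p => Atom (swc (tag p) (tagged p))).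
Proof.
apply: pt_sub; last exact: pt_sw.
pose g (p : Q1) : {x & T x} := Tagged T (tagged p).
apply: pt_comp (pt_reindex g pt_c).
exact: (pt_expr _ (e := Left (Right (Var 0)))).
Qed.

Definition ssrc (q : XS) := sources (M1 (tag q)) (sI q) (sw q).
Definition ssnk (q : XS) := sinks (M2 (tag q)) (@c (tag q)) (sI q) (sw q).
Definition stight (q : XS) := tight (M1 (tag q)) (M2 (tag q)) (@c (tag q)) (sI q) (sw q).
Arguments stight : clear implicits.
Definition sreached (q : XS) := reached (M1 (tag q)) (M2 (tag q)) (@c (tag q)) (sI q) (sw q).
Definition saug (q : XS) := augmentable (M1 (tag q)) (M2 (tag q)) (@c (tag q)) (sI q) (sw q).

Lemma pt_ssrc : pt in1 (fun p => tbool (R (tag (tag p))) (tagged p \in ssrc (tag p))).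
Proof. exact: pt_min_free pt_M1 pt_sw. Qed.

Lemma pt_ssnk : pt in1 (fun p => tbool (R (tag (tag p))) (tagged p \in ssnk (tag p))).
Proof. exact: (pt_min_free pt_M2 pt_swc). Qed.

Lemma pt_fst2 o : pt in1 o ->
  pt in2 (fun p => o (Tagged (fun q : XS => T (tag q)) (tagged p).1)).
Proof.
move=> ho.
apply: pt_comp (pt_reindex (fun p : Q2 => Tagged (fun q : XS => T (tag q)) (tagged p).1) ho).
exact: (pt_expr _ (e := ENode (Left (Var 0)) (Left (Right (Var 0))))).
Qed.

Lemma pt_snd2 o : pt in1 o ->
  pt in2 (fun p => o (Tagged (fun q : XS => T (tag q)) (tagged p).2)).
Proof.
move=> ho.
apply: pt_comp (pt_reindex (fun p : Q2 => Tagged (fun q : XS => T (tag q)) (tagged p).2) ho).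
exact: (pt_expr _ (e := ENode (Left (Var 0)) (Right (Right (Var 0))))).
Qed.

Lemma pt_swap2 (o : forall p : Q2, tree (R (tag (tag p)))) : pt in2 o ->
  pt in2 (fun p => o (Tagged (fun q : XS => (T (tag q) * T (tag q))%type)
    ((tagged p).2, (tagged p).1))).
Proof.
move=> ho.
apply: pt_comp (pt_reindex (fun p : Q2 => Tagged (fun q : XS => (T (tag q) * T (tag q))%type)
  ((tagged p).2, (tagged p).1)) ho).
exact: (pt_expr _ (e := ENode (Left (Var 0)) (ENode (Right (Right (Var 0))) (Left (Right (Var 0)))))).
Qed.

Lemma pt_memI : pt in1 (fun p => tbool (R (tag (tag p))) (tagged p \in sI (tag p))).
Proof. exact: (pt_expr _ (e := Left (Right (Right (Var 0))))). Qed.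

Lemma pt_exch1 : pt in2 (fun p => tbool (R (tag (tag p)))
  (exch1 (M1 (tag (tag p))) (sI (tag p)) (tagged p).1 (tagged p).2)).
Proof.
apply: pt_and; first exact: (pt_fst2 pt_memI).
by apply: pt_and; [apply: (pt_not (pt_snd2 pt_memI)) | apply: pt_swap].
Qed.

Lemma pt_exch2 : pt in2 (fun p => tbool (R (tag (tag p)))
  (exch2 (M2 (tag (tag p))) (sI (tag p)) (tagged p).1 (tagged p).2)).
Proof.
apply: pt_and; first exact: (pt_not (pt_fst2 pt_memI)).
by apply: pt_and; [apply: (pt_snd2 pt_memI) | apply: (pt_swap2 (pt_swap pt_M2))].
Qed.

Lemma pt_stight : pt in2 (fun p => tbool (R (tag (tag p))) (stight (tag p) (tagged p).1 (tagged p).2)).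
Proof.
apply: pt_or; apply: pt_and.
- exact: pt_exch1.
- exact: (pt_eq (pt_fst2 pt_sw) (pt_snd2 pt_sw)).
- exact: pt_exch2.
- exact: (pt_eq (pt_fst2 pt_swc) (pt_snd2 pt_swc)).
Qed.

(** The reached set is computed once, and its bit travels with every row. *)
Definition uenc (q : XS) (t : T (tag q)) := Node (renc t) (tbool (R (tag q)) (t \in sreached q)).
Definition utab (q : XS) := tlist [seq uenc t | t <- l (tag q)].

Lemma pt_utab : pt iS utab.
Proof.
apply: (@pt_rch XS (fun q => R (tag q)) (fun q => T (tag q)) iS (@renc) (fun q => l (tag q))
  stight ssrc).
- by move=> q; apply: lT.
- exact: (pt_expr _ (e := Right (Var 0))).
- exact: pt_stight.
- exact: pt_ssrc.
Qed.

Definition iU (q : XS) := Node (iS q) (utab q).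
Definition inU1 (p : Q1) := Node (iU (tag p)) (uenc (tagged p)).
Definition inU2 (p : Q2) := Node (iU (tag p)) (Node (uenc (tagged p).1) (uenc (tagged p).2)).

Lemma pt_iU o : pt iU o -> pt iS o.
Proof. by apply: pt_comp; apply: pt_pair (pt_id _) pt_utab. Qed.

Lemma pt_U1 o : pt in1 o -> pt inU1 o.
Proof.
apply: pt_comp; exact: (pt_expr _ (e := ENode (Left (Left (Var 0))) (Left (Right (Var 0))))).
Qed.

Lemma pt_U2 o : pt in2 o -> pt inU2 o.
Proof.
apply: pt_comp; exact: (pt_expr _ (e := ENode (Left (Left (Var 0)))
  (ENode (Left (Left (Right (Var 0)))) (Left (Right (Right (Var 0))))))).
Qed.

Lemma pt_saug : pt iU (fun q => tbool (R (tag q)) (saug q)).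
Proof.
apply: (@pt_ext _ _ _ (fun q : XS => tbool (R (tag q))
  (has (fun b => (b \in ssnk q) && (b \in sreached q)) (l (tag q))))).
  by move=> q; rewrite /saug /augmentable (existsb_has _ (lT (x := _))).
have hl : pt iU (fun q => tlist [seq uenc t | t <- l (tag q)]).
  exact: (pt_expr _ (e := Right (Var 0))).
apply: (pt_has hl); apply: pt_and; first exact: (pt_U1 pt_ssnk).
exact: (pt_expr _ (e := Right (Right (Var 0)))).
Qed.

Lemma pt_cand1 : pt inU2 (fun p => tbool (R (tag (tag p)))
  (cand1 (M1 (tag (tag p))) (M2 (tag (tag p))) (@c (tag (tag p))) (sI (tag p)) (sw (tag p))
     (tagged p).1 (tagged p).2)).
Proof.
apply: pt_and; first exact: (pt_expr _ (e := Right (Left (Right (Var 0))))).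
apply: pt_and; first by apply: pt_not; exact: (pt_expr _ (e := Right (Right (Right (Var 0))))).
apply: pt_U2; apply: pt_or; first exact: pt_exch1.
by apply: pt_and; [apply: (pt_fst2 pt_ssrc) | apply: (pt_snd2 (pt_free pt_M1))].
Qed.

Lemma pt_cand2 : pt inU2 (fun p => tbool (R (tag (tag p)))
  (cand2 (M1 (tag (tag p))) (M2 (tag (tag p))) (@c (tag (tag p))) (sI (tag p)) (sw (tag p))
     (tagged p).1 (tagged p).2)).
Proof.
apply: pt_and; first exact: (pt_expr _ (e := Right (Left (Right (Var 0))))).
apply: pt_and; first by apply: pt_not; exact: (pt_expr _ (e := Right (Right (Right (Var 0))))).
apply: pt_U2; apply: pt_or; first exact: pt_exch2.
by apply: pt_and; [apply: (pt_fst2 (pt_free pt_M2)) | apply: (pt_snd2 pt_ssnk)].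
Qed.

Definition penc (q : XS) (p : T (tag q) * T (tag q)) := Node (uenc p.1) (uenc p.2).

Lemma pt_pairs : pt iU (fun q => tlist [seq penc p | p <- pairs (l (tag q))]).
Proof.
have hl : pt iU (fun q => tlist [seq uenc t | t <- l (tag q)]).
  exact: (pt_expr _ (e := Right (Var 0))).
apply: (@pt_flatten _ _ (fun q => T (tag q)) iU (fun q => l (tag q)) (@uenc)
  (fun q => T (tag q) * T (tag q))%type (@penc) (fun q a => [seq (a, b) | b <- l (tag q)]) hl).
apply: (@pt_ext _ _ _ (fun p : Q1 => tlist [seq Node (uenc (tagged p)) (uenc b) | b <- l (tag (tag p))])).
  by move=> p; rewrite -map_comp.
have hl1 : pt inU1 (fun p => tlist [seq uenc (q := tag p) t | t <- l (tag (tag p))]).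
  exact: (pt_expr _ (e := Right (Left (Var 0)))).
apply: (pt_map hl1).
exact: (pt_expr _ (e := ENode (Right (Left (Var 0))) (Right (Var 0)))).
Qed.

Definition sgaps (q : XS) :=
  gaps (M1 (tag q)) (M2 (tag q)) (@c (tag q)) (l (tag q)) (sI q) (sw q).

Lemma pt_gaps : pt iU (fun q => tlist [seq Atom g | g <- sgaps q]).
Proof.
apply: pt_cat.
  apply: (@pt_ext _ _ _ (fun q : XS => tlist [seq Atom (sw q p.2 - sw q p.1)%R |
    p <- pairs (l (tag q)) & cand1 (M1 (tag q)) (M2 (tag q)) (@c (tag q)) (sI q) (sw q) p.1 p.2])).
    by move=> q; rewrite -map_comp.
  apply: (pt_map (pt_filter pt_pairs pt_cand1)); apply: (pt_U2 (pt_sub (pt_snd2 pt_sw) (pt_fst2 pt_sw))).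
apply: (@pt_ext _ _ _ (fun q : XS => tlist [seq Atom (swc q p.1 - swc q p.2)%R |
  p <- pairs (l (tag q)) & cand2 (M1 (tag q)) (M2 (tag q)) (@c (tag q)) (sI q) (sw q) p.1 p.2])).
  by move=> q; rewrite -map_comp.
apply: (pt_map (pt_filter pt_pairs pt_cand2)); apply: (pt_U2 (pt_sub (pt_fst2 pt_swc) (pt_snd2 pt_swc))).
Qed.

Definition sdelta (q : XS) :=
  delta_wt (M1 (tag q)) (M2 (tag q)) (@c (tag q)) (l (tag q)) (sI q) (sw q).

Lemma pt_delta : pt iU (fun q => Atom (sdelta q)).
Proof.
pose Y (q : XS) : Type := R (tag q).
pose eY (q : XS) (y : Y q) : tree (R (tag q)) := Atom y.
have h0 : pt iU (fun q => eY q 0%R).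
  apply: pt_comp (pt_reindex (fun q : XS => tag q) pt_0).
  exact: (pt_expr _ (e := Left (Left (Var 0)))).
apply: (@pt_head _ _ Y iU (fun q => [seq g <- sgaps q | all (fun h => g <= h)%R (sgaps q)]) eY
  _ (fun q => 0%R) h0).
apply: (@pt_filter _ _ Y iU sgaps eY pt_gaps (fun q g => all (fun h => g <= h)%R (sgaps q))).
pose j (p : {q & Y q}) := Node (iU (tag p)) (eY _ (tagged p)).
have hg : pt j (fun p => tlist [seq eY (tag p) g | g <- sgaps (tag p)]).
  exact: (pt_weak (i := iU) eY pt_gaps).
apply: (@pt_all _ _ (fun p : {q & Y q} => Y (tag p)) j (fun p => sgaps (tag p))
  (fun p => eY (tag p)) hg (fun p h => (tagged p <= h)%R)).
apply: pt_le; last exact: (pt_expr _ (e := Right (Var 0))).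
exact: (pt_expr _ (e := Right (Left (Var 0)))).
Qed.

Definition mkS (x : X) (I : {set T x}) (w : T x -> R x) : XS := Tagged stt (I, w).

Definition sdual (q : XS) :=
  dual_wt (M1 (tag q)) (M2 (tag q)) (@c (tag q)) (l (tag q)) (sI q) (sw q).

Arguments sdual : clear implicits.

Lemma pt_dual : pt iS (fun q => stab (mkS (sI q) (sdual q))).
Proof.
apply: pt_iU.
pose j (q : XS) := Node (iU q) (Node (tbool (R (tag q)) (saug q)) (Atom (sdelta q))).
have hj : pt iU j by apply: pt_pair (pt_id _) (pt_pair pt_saug pt_delta).
apply: (pt_comp hj).
have hl : pt j (fun q => tlist [seq uenc t | t <- l (tag q)]).
  exact: (pt_expr _ (e := Right (Left (Var 0)))).
apply: (pt_map hl); apply: pt_pair; first exact: (pt_expr _ (e := Left (Left (Right (Var 0))))).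
apply: pt_pair; first exact: (pt_expr _ (e := Left (Right (Left (Right (Var 0)))))).
pose Z := {q : XS & T (tag q)}.
pose jj (p : Z) := Node (j (tag p)) (uenc (tagged p)).
have hw : pt jj (fun p => Atom (sw (tag p) (tagged p))).
  exact: (pt_expr _ (e := Right (Right (Left (Right (Var 0)))))).
have hd : pt jj (fun p => Atom (sdelta (tag p))).
  exact: (pt_expr _ (e := Right (Right (Left (Var 0))))).
have ha : pt jj (fun p => tbool (R (tag (tag p))) (saug (tag p))).
  exact: (pt_expr _ (e := Left (Right (Left (Var 0))))).
have hU : pt jj (fun p => tbool (R (tag (tag p))) (tagged p \in sreached (tag p))).
  exact: (pt_expr _ (e := Right (Right (Var 0)))).
apply: pt_ext (pt_ite ha hw (pt_ite hU (pt_add hw hd) hw)) => p.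
by rewrite /sw /= /sdual /dual_wt /saug; case: ifP => // _; case: ifP.
Qed.

(** One more than the length of the list, as [iter_dual_augmentable] asks for more than [#|T|]
    rounds. *)
Definition iters x := (size (l x)).+1.

Definition sdualn (q : XS) : T (tag q) -> R (tag q) :=
  iter (iters (tag q)) (dual_wt (M1 (tag q)) (M2 (tag q)) (@c (tag q)) (l (tag q)) (sI q)) (sw q).
Arguments sdualn : clear implicits.

Lemma stab_size (Z : Type) (g : Z -> X) (j : forall z, tree (R (g z))) :
  pt j (fun z => env (g z)) ->
  exists d, forall z (s : stt (g z)), tree_size (stab (Tagged stt s)) <= pw (tree_size (j z)) d.
Proof.
move=> hj; have hl := pt_comp hj (pt_reindex g pt_l).
apply: (@table_size_poly Z (fun z => R (g z)) j (fun z => T (g z)) (fun z => stt (g z))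
  (fun z => l (g z)) (fun z => @e (g z))
  (fun z s t => @renc (Tagged stt s) t) 6 hl) => z s t /=.
by have := tbool_size (R (g z)) (t \in s.1); rewrite /sI /=; lia.
Qed.

Lemma pt_dualn : pt iS (fun q => stab (mkS (sI q) (sdualn q))).
Proof.
(* The extra cell accounts for the additional round in [iters]. *)
pose lt (q : XS) := Leaf :: [seq e t | t <- l (tag q)].
have henv : pt iS (fun q => env (tag q)) by exact: (pt_expr _ (e := Left (Var 0))).
pose A (q : XS) : Type := T (tag q) -> R (tag q).
pose eA (q : XS) (w : A q) := stab (mkS (sI q) w).
apply: (@pt_ext _ _ _ (fun q => eA q (iter (size (lt q))
  (dual_wt (M1 (tag q)) (M2 (tag q)) (@c (tag q)) (l (tag q)) (sI q)) (sw q)))).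
  by move=> q; rewrite /lt /= size_map.
apply: (@pt_iterf XS (fun q => R (tag q)) iS lt A eA).
- by apply: pt_pair (pt_leaf _) _; apply: (pt_comp henv (pt_reindex (fun q : XS => tag q) pt_l)).
- apply: (@pt_ext _ _ _ stab); first by case=> x [I w].
  exact: (pt_expr _ (e := Right (Var 0))).
- pose g (p : {q : XS & A q}) : XS := mkS (sI (tag p)) (tagged p).
  apply: pt_comp (pt_reindex g pt_dual).
  exact: (pt_expr _ (e := ENode (Left (Left (Var 0))) (Right (Var 0)))).
- have [d hd] := stab_size henv; exists d => q w.
  exact: (hd q (sI q, w)).
Qed.

Definition QW := {q : XS & {set T (tag q)}}.
Definition wenc (p : QW) (t : T (tag (tag p))) :=
  Node (renc t) (tbool (R (tag (tag p))) (t \in tagged p)).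
Definition wtab (p : QW) := tlist [seq wenc t | t <- l (tag (tag p))].
Definition inW (p : QW) := Node (iS (tag p)) (wtab p).

Lemma pt_joined : pt inW (fun p => tbool (R (tag (tag p)))
  (joined (stight (tag p)) (ssrc (tag p)) (ssnk (tag p)) (tagged p))).
Proof.
pose TT (p : QW) : finType := T (tag (tag p)).
pose S (p : QW) : {set TT p} := rch (restr (tagged p) (stight (tag p))) (ssrc (tag p) :&: tagged p).
pose venc (p : QW) (t : TT p) := Node (wenc t) (tbool (R (tag (tag p))) (t \in S p)).
have hl : pt inW (fun p => tlist [seq @wenc p t | t <- l (tag (tag p))]).
  exact: (pt_expr _ (e := Right (Var 0))).
have hv : pt inW (fun p => tlist [seq venc p t | t <- l (tag (tag p))]).
  apply: (@pt_rch QW (fun p => R (tag (tag p))) TT inW (@wenc) (fun p => l (tag (tag p)))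
    (fun p => restr (tagged p) (stight (tag p))) (fun p => ssrc (tag p) :&: tagged p)).
  - by move=> p; apply: lT.
  - exact: hl.
  - pose g (p : {z : QW & (TT z * TT z)%type}) : Q2 :=
      Tagged (fun q : XS => (T (tag q) * T (tag q))%type) (tagged p).
    apply: pt_and.
      apply: pt_comp (pt_reindex g pt_stight).
      exact: (pt_expr _ (e := ENode (Left (Left (Var 0))) (ENode (Left (Left (Right (Var 0))))
        (Left (Right (Right (Var 0))))))).
    apply: pt_and; first exact: (pt_expr _ (e := Right (Left (Right (Var 0))))).
    exact: (pt_expr _ (e := Right (Right (Right (Var 0))))).
  - pose g (p : {z : QW & TT z}) : Q1 := Tagged (fun q : XS => T (tag q)) (tagged p).
    apply: (@pt_ext _ _ _ (fun p : {z : QW & TT z} => tbool (R (tag (tag (tag p))))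
      ((tagged p \in ssrc (tag (tag p))) && (tagged p \in tagged (tag p))))).
      by move=> p; rewrite in_setI.
    apply: pt_and; last exact: (pt_expr _ (e := Right (Right (Var 0)))).
    apply: pt_comp (pt_reindex g pt_ssrc).
    exact: (pt_expr _ (e := ENode (Left (Left (Var 0))) (Left (Right (Var 0))))).
apply: (@pt_ext _ _ _ (fun p : QW => tbool (R (tag (tag p)))
  (has (fun b => (b \in ssnk (tag p)) && (b \in S p)) (l (tag (tag p)))))).
  by move=> p; rewrite /joined (existsb_has _ (lT (x := _))).
apply: (pt_has hv); apply: pt_and; last exact: (pt_expr _ (e := Right (Right (Var 0)))).
pose g (p : {z : QW & TT z}) : Q1 := Tagged (fun q : XS => T (tag q)) (tagged p).
apply: pt_comp (pt_reindex g pt_ssnk).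
exact: (pt_expr _ (e := ENode (Left (Left (Var 0))) (Left (Left (Right (Var 0)))))).
Qed.

Definition mkW (q : XS) (W : {set T (tag q)}) : QW := Tagged (fun q : XS => {set T (tag q)}) W.

Definition sprune (q : XS) := prune (stight q) (ssrc q) (ssnk q) (l (tag q)).

Lemma pt_prune : pt iS (fun q => wtab (mkW (sprune q))).
Proof.
have hl : pt iS (fun q => tlist [seq @renc q t | t <- l (tag q)]).
  exact: (pt_expr _ (e := Right (Var 0))).
pose A (q : XS) : Type := {set T (tag q)}.
pose eA (q : XS) (W : A q) := wtab (@mkW q W).
apply: (@pt_foldl XS (fun q => R (tag q)) (fun q => T (tag q)) iS (fun q => l (tag q)) (@renc) hl
  A eA).
- apply: (pt_map hl); apply: pt_pair; first exact: (pt_expr _ (e := Right (Var 0))).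
  by apply: pt_ext (pt_true _) => p; rewrite inE.
- pose Z := {q : XS & (A q * T (tag q))%type}.
  pose j (p : Z) := Node (Node (iS (tag p)) (renc (tagged p).2)) (eA (tag p) (tagged p).1).
  pose W' (p : Z) : A (tag p) := (tagged p).1 :\ (tagged p).2.
  have hW' : pt j (fun p => eA (tag p) (W' p)).
    have hl' : pt j (fun p => tlist [seq @wenc (@mkW (tag p) (tagged p).1) t | t <- l (tag (tag p))]).
      exact: (pt_expr _ (e := Right (Var 0))).
    apply: (pt_map hl'); apply: pt_pair; first exact: (pt_expr _ (e := Left (Right (Var 0)))).
    apply: (@pt_ext _ _ _ (fun p : {z : Z & T (tag (tag z))} => tbool (R (tag (tag (tag p))))
      (~~ (tagged p == (tagged (tag p)).2) && (tagged p \in (tagged (tag p)).1)))).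
      by move=> p; rewrite !inE.
    apply: pt_and; last exact: (pt_expr _ (e := Right (Right (Var 0)))).
    apply: pt_not.
    apply: (pt_eq_elt (g := fun p : {z : Z & T (tag (tag z))} => tag (tag (tag p)))).
      exact: (pt_expr _ (e := Left (Left (Right (Var 0))))).
    exact: (pt_expr _ (e := Left (Right (Left (Left (Var 0)))))).
  have hJ : pt j (fun p => tbool (R (tag (tag p)))
      (joined (stight (tag p)) (ssrc (tag p)) (ssnk (tag p)) (W' p))).
    apply: pt_comp (pt_reindex (fun p : Z => mkW (W' p)) pt_joined).
    by apply: pt_pair hW'; exact: (pt_expr _ (e := Left (Left (Var 0)))).
  apply: pt_ext (pt_ite hJ hW' (pt_expr _ (e := Right (Var 0)) isT)) => p /=.
  by case: ifP.
- have [d hd] : exists d, forall q (W : A q), tree_size (eA q W) <= pw (tree_size (iS q)) d.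
    apply: (@table_size_poly XS (fun q => R (tag q)) iS (fun q => T (tag q)) A
      (fun q => l (tag q)) (@renc) (fun q W t => @wenc (@mkW q W) t) 4 hl) => q W t /=.
    by have := tbool_size (R (tag q)) (t \in W); lia.
  by exists d => q k; apply: hd.
Qed.

Definition saug_set (q : XS) :=
  aug_set (M1 (tag q)) (M2 (tag q)) (@c (tag q)) (l (tag q)) (sI q) (sw q).

Lemma pt_aug : pt iS (fun q => stab (mkS (saug_set q) (sw q))).
Proof.
pose j (q : XS) := Node (tbool (R (tag q)) (saug q)) (wtab (mkW (sprune q))).
have hj : pt iS j by apply: pt_pair pt_prune; apply: (pt_iU pt_saug).
apply: (pt_comp hj).
have hl : pt j (fun q => tlist [seq @wenc (mkW (sprune q)) t | t <- l (tag q)]).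
  exact: (pt_expr _ (e := Right (Var 0))).
apply: (pt_map hl); apply: pt_pair; first exact: (pt_expr _ (e := Left (Left (Right (Var 0))))).
apply: pt_pair; last exact: (pt_expr _ (e := Right (Right (Left (Right (Var 0)))))).
pose jj (p : Q1) := Node (j (tag p)) (@wenc (mkW (sprune (tag p))) (tagged p)).
have hI : pt jj (fun p => tbool (R (tag (tag p))) (tagged p \in sI (tag p))).
  exact: (pt_expr _ (e := Left (Right (Left (Right (Var 0)))))).
have hW : pt jj (fun p => tbool (R (tag (tag p))) (tagged p \in sprune (tag p))).
  exact: (pt_expr _ (e := Right (Right (Var 0)))).
have ha : pt jj (fun p => tbool (R (tag (tag p))) (saug (tag p))).
  exact: (pt_expr _ (e := Left (Left (Var 0)))).
apply: pt_ext (pt_ite ha (pt_or (pt_and (pt_not hW) hI) (pt_and (pt_not hI) hW)) hI) => p.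
rewrite /sI /= /saug_set /aug_set /saug; case: ifP => // _.
by rewrite !inE.
Qed.

Definition sstep (q : XS) : stt (tag q) :=
  wmi_step (M1 (tag q)) (M2 (tag q)) (@c (tag q)) (iters (tag q)) (l (tag q)) (tagged q).

Lemma pt_step : pt iS (fun q => stab (Tagged stt (sstep q))).
Proof.
have h1 : pt iS (fun q => iS (mkS (sI q) (sdualn q))).
  by apply: pt_pair pt_dualn; exact: (pt_expr _ (e := Left (Var 0))).
exact: pt_comp h1 (pt_reindex (fun q : XS => mkS (sI q) (sdualn q)) pt_aug).
Qed.

Definition wmi_out x := wmi (M1 x) (M2 x) (@c x) (iters x) (size (l x)) (l x).

Lemma pt_wmi : pt env (fun x => set_tab (wmi_out x)).
Proof.
pose eA x (s : stt x) := stab (Tagged stt s).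
pose f x (s : stt x) : stt x := sstep (Tagged stt s).
pose a0 x : stt x := (set0, @c x).
have h : pt env (fun x => eA x (iter (size [seq e t | t <- l x]) (f x) (a0 x))).
  apply: (@pt_iterf X R env (fun x => [seq e t | t <- l x]) stt eA f a0 pt_l).
  - apply: (pt_map pt_l); apply: pt_pair; first exact: (pt_expr _ (e := Right (Var 0))).
    apply: pt_pair; first by apply: pt_ext (pt_false _) => p; rewrite inE.
    apply: pt_comp pt_c; exact: (pt_expr _ (e := Right (Var 0))).
  - exact: pt_step.
  - have [d hd] := @stab_size X id env (pt_id env).
    by exists d => x s; apply: hd.
pose fs x := iter (size [seq e t | t <- l x]) (f x) (a0 x).
have hl : pt (fun x => eA x (fs x)) (fun x => tlist [seq @renc (Tagged stt (fs x)) t | t <- l x]).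
  exact: pt_id.
have h2 : pt (fun x => eA x (fs x)) (fun x => set_tab (fs x).1).
  apply: (@pt_map X R T _ l (fun x t => @renc (Tagged stt (fs x)) t) hl
    (fun x t => Node (e t) (tbool (R x) (t \in (fs x).1)))).
  apply: pt_pair; first exact: (pt_expr _ (e := Left (Right (Var 0)))).
  exact: (pt_expr _ (e := Left (Right (Right (Var 0))))).
by apply: pt_ext (pt_comp h h2) => x; rewrite /wmi_out /wmi /fs size_map.
Qed.

End PtWmi.

(** * The minimum cut test in polynomial time *)

Section PtMinCut.
Variables (X : Type) (R : X -> realFieldType) (V E : X -> finType).
Variables (cap : forall x, E x -> nat) (k : X -> nat) (d : forall x, V x).
Variables (c0 : forall x, R x) (av : forall x, V x -> R x).
Variable env : forall x, tree (R x).
Hypothesis c0_gt0 : forall x, (0 < c0 x)%R.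
Hypothesis av_inj : forall x, injective (@av x).
Hypothesis pt_0 : pt env (fun x => Atom 0%R).
Hypothesis pt_k : pt env (fun x => Atom (c0 x *+ k x)%R).
Hypothesis pt_d : pt env (fun x => Atom (av (d x))).

Definition ep x := ((E x -> V x) * (E x -> V x))%type.
(** Vertices are compared through the injectivity of [av]; capacities are multiples of the positive
    [c0], so that sums and comparisons of atoms replace arithmetic on integers. *)
Definition eenc x (s : ep x) (e : E x) :=
  Node (Atom (av (s.1 e))) (Node (Atom (av (s.2 e))) (Atom (c0 x *+ cap e)%R)).
Definition etab x (s : ep x) := tlist [seq eenc s e | e <- enum (E x)].

Definition XC := {x & ep x}.
Definition iC (q : XC) := Node (env (tag q)) (etab (tagged q)).
Definition sends (q : XC) := ends (tagged q).1 (tagged q).2.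

Lemma pt_sends : pt iC (fun q => tlist [seq Atom (av v) | v <- sends q]).
Proof.
have hl : pt iC (fun q => tlist [seq eenc (tagged q) e | e <- enum (E (tag q))]).
  exact: (pt_expr _ (e := Right (Var 0))).
apply: pt_cat.
  apply: (@pt_ext _ _ _ (fun q : XC => tlist [seq Atom (av ((tagged q).1 e)) | e <- enum (E (tag q))])).
    by move=> q; rewrite -map_comp.
  by apply: (pt_map hl); exact: (pt_expr _ (e := Left (Right (Var 0)))).
apply: (@pt_ext _ _ _ (fun q : XC => tlist [seq Atom (av ((tagged q).2 e)) | e <- enum (E (tag q))])).
  by move=> q; rewrite -map_comp.
by apply: (pt_map hl); exact: (pt_expr _ (e := Left (Right (Right (Var 0))))).
Qed.

Definition ms (q : XC) := ({set V (tag q)} * (V (tag q) * V (tag q)))%type.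
Definition XM := {q : XC & ms q}.
Definition venc (m : XM) (v : V (tag (tag m))) :=
  Node (Atom (av v)) (tbool (R (tag (tag m))) (v \in (tagged m).1)).
Definition mtab (m : XM) := Node (tlist [seq venc v | v <- sends (tag m)])
  (Node (Atom (av (tagged m).2.1)) (Atom (av (tagged m).2.2))).
Definition iM (m : XM) := Node (iC (tag m)) (mtab m).

Lemma pt_vlist : pt iM (fun m => tlist [seq @venc m v | v <- sends (tag m)]).
Proof. exact: (pt_expr _ (e := Left (Right (Var 0)))). Qed.

(** The table of the visited set lists only ends of edges, so membership can be looked up only for
    these. *)
Definition XV := {m : XM & {v | v \in sends (tag m)}}.

Lemma pt_memA : pt (fun p : XV => Node (iM (tag p)) (Atom (av (sval (tagged p)))))
  (fun p => tbool (R (tag (tag (tag p)))) (sval (tagged p) \in (tagged (tag p)).1)).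
Proof.
pose j (p : XV) := Node (iM (tag p)) (Atom (av (sval (tagged p)))).
have hl : pt j (fun p => tlist [seq @venc (tag p) v | v <- sends (tag (tag p))]).
  exact: (pt_expr _ (e := Left (Right (Left (Var 0))))).
apply: (@pt_ext _ _ _ (fun p : XV => tbool (R (tag (tag (tag p))))
  (has (fun v => (av (sval (tagged p)) == av v) && (v \in (tagged (tag p)).1)) (sends (tag (tag p)))))).
  move=> -[m [v vE]] /=; congr (tbool _ _); apply/hasP/idP => [[u _ /andP[/eqP/av_inj -> //]]|vA].
  by exists v; rewrite ?eqxx.
apply: (pt_has hl); apply: pt_and; last exact: (pt_expr _ (e := Right (Right (Var 0)))).
apply: pt_eq; first exact: (pt_expr _ (e := Right (Left (Var 0)))).
exact: (pt_expr _ (e := Left (Right (Var 0)))).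
Qed.

Definition sattach (m : XM) u :=
  attach (@cap (tag (tag m))) (tagged (tag m)).1 (tagged (tag m)).2 (tagged m).1 u.

Lemma big_mul_cond (Rr : realFieldType) (fT : finType) (P : pred fT) (F : fT -> nat) (y : Rr) :
  (\sum_(e <- enum fT) (if P e then y *+ F e else 0) = y *+ (\sum_(e | P e) F e))%R.
Proof. by rewrite big_enum -big_mkcond /= sumrMnr. Qed.

Definition XU := {m : XM & V (tag (tag m))}.

Lemma pt_attach : pt (fun p : XU => Node (iM (tag p)) (Atom (av (tagged p))))
  (fun p => Atom (c0 (tag (tag (tag p))) *+ sattach (tagged p))%R).
Proof.
pose j (p : XU) := Node (iM (tag p)) (Atom (av (tagged p))).
have hl : pt j (fun p => tlist [seq eenc (tagged (tag (tag p))) e | e <- enum (E (tag (tag (tag p))))]).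
  exact: (pt_expr _ (e := Right (Left (Left (Var 0))))).
have h0 (Z : Type) (g : Z -> X) (i : forall z, tree (R (g z))) : pt i (fun z => env (g z)) ->
    pt i (fun z => Atom 0%R).
  by move=> h; apply: pt_comp h (pt_reindex g pt_0).
apply: (pt_ext (fun p => f_equal (@Atom _) (big_mul_cond _ _ _))).
apply: (pt_sum hl).
  apply: (h0 _ (fun p : XU => tag (tag (tag p)))).
  exact: (pt_expr _ (e := Left (Left (Left (Var 0))))).
pose Z := {p : XU & E (tag (tag (tag p)))}.
pose jj (p : Z) := Node (j (tag p)) (eenc (tagged (tag (tag (tag p)))) (tagged p)).
pose A (p : Z) := (tagged (tag (tag p))).1.
pose s (p : Z) := (tagged (tag (tag (tag p)))).1 (tagged p).
pose t (p : Z) := (tagged (tag (tag (tag p)))).2 (tagged p).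
have sE (p : Z) : s p \in sends (tag (tag (tag p))).
  by rewrite /sends /ends mem_cat map_f // mem_enum.
have tE (p : Z) : t p \in sends (tag (tag (tag p))).
  by rewrite /sends /ends mem_cat map_f ?orbT // mem_enum.
have hsA : pt jj (fun p => tbool (R (tag (tag (tag (tag p))))) (s p \in A p)).
  pose g (p : Z) : XV := Tagged (fun m : XM => {v | v \in sends (tag m)})
    (exist (fun v => v \in sends (tag (tag (tag p)))) (s p) (sE p)).
  apply: pt_comp (pt_reindex g pt_memA).
  exact: (pt_expr _ (e := ENode (Left (Left (Var 0))) (Left (Right (Var 0))))).
have htA : pt jj (fun p => tbool (R (tag (tag (tag (tag p))))) (t p \in A p)).
  pose g (p : Z) : XV := Tagged (fun m : XM => {v | v \in sends (tag m)})
    (exist (fun v => v \in sends (tag (tag (tag p)))) (t p) (tE p)).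
  apply: pt_comp (pt_reindex g pt_memA).
  exact: (pt_expr _ (e := ENode (Left (Left (Var 0))) (Left (Right (Right (Var 0)))))).
have hsu : pt jj (fun p => tbool (R (tag (tag (tag (tag p))))) (s p == tagged (tag p))).
  apply: (@pt_ext _ _ _ (fun p : Z => tbool (R (tag (tag (tag (tag p)))))
     (av (s p) == av (tagged (tag p))))); first by move=> p; rewrite (inj_eq (@av_inj _)).
  apply: pt_eq; first exact: (pt_expr _ (e := Left (Right (Var 0)))).
  exact: (pt_expr _ (e := Right (Left (Var 0)))).
have htu : pt jj (fun p => tbool (R (tag (tag (tag (tag p))))) (t p == tagged (tag p))).
  apply: (@pt_ext _ _ _ (fun p : Z => tbool (R (tag (tag (tag (tag p)))))
     (av (t p) == av (tagged (tag p))))); first by move=> p; rewrite (inj_eq (@av_inj _)).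
  apply: pt_eq; first exact: (pt_expr _ (e := Left (Right (Right (Var 0))))).
  exact: (pt_expr _ (e := Right (Left (Var 0)))).
have h0' : pt jj (fun p => Atom 0%R).
  apply: (h0 _ (fun p : Z => tag (tag (tag (tag p))))).
  exact: (pt_expr _ (e := Left (Left (Left (Left (Var 0)))))).
apply: pt_ext (pt_ite (pt_or (pt_and hsA htu) (pt_and htA hsu))
  (pt_expr _ (e := Right (Right (Right (Var 0)))) isT) h0') => p /=.
by rewrite /s /t /A /=; case: ifP.
Qed.

Definition mhead (m : XM) :=
  head (d (tag (tag m))) (ma_cands (@cap (tag (tag m))) (tagged (tag m)).1 (tagged (tag m)).2 (tagged m).1).

Lemma pt_mhead : pt iM (fun m => Atom (av (mhead m))).
Proof.
pose cands (m : XM) := ma_cands (@cap (tag (tag m))) (tagged (tag m)).1 (tagged (tag m)).2 (tagged m).1.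
have hc : pt iM (fun m => tlist [seq @venc m v | v <- cands m]).
  apply: (@pt_filter XM (fun m => R (tag (tag m))) (fun m => V (tag (tag m))) iM
    (fun m => sends (tag m)) (@venc) pt_vlist (fun m u => (u \notin (tagged m).1) &&
      all (fun v => (v \in (tagged m).1) || (sattach v <= sattach u)) (sends (tag m)))).
  apply: pt_and; first by apply: pt_not; exact: (pt_expr _ (e := Right (Right (Var 0)))).
  pose j (p : XU) := Node (iM (tag p)) (venc (tagged p)).
  have hl : pt j (fun p => tlist [seq @venc (tag p) v | v <- sends (tag (tag p))]).
    exact: (pt_expr _ (e := Left (Right (Left (Var 0))))).
  apply: (pt_all hl); apply: pt_or; first exact: (pt_expr _ (e := Right (Right (Var 0)))).
  pose Z := {p : XU & V (tag (tag (tag p)))}.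
  apply: (@pt_ext _ _ _ (fun p : Z => tbool (R (tag (tag (tag (tag p)))))
     (c0 _ *+ sattach (tagged p) <= c0 _ *+ sattach (tagged (tag p)))%R)).
    by move=> p; rewrite ler_pMn2l ?c0_gt0.
  apply: pt_le.
    pose g (p : Z) : XU := Tagged (fun m : XM => V (tag (tag m))) (tagged p).
    apply: pt_comp (pt_reindex g pt_attach).
    exact: (pt_expr _ (e := ENode (Left (Left (Var 0))) (Left (Right (Var 0))))).
  apply: pt_comp (pt_reindex (fun p : Z => tag p) pt_attach).
  exact: (pt_expr _ (e := ENode (Left (Left (Var 0))) (Left (Right (Left (Var 0)))))).
have hc' : pt iM (fun m => tlist [seq Atom (av v) | v <- cands m]).
  by apply: (pt_map hc); exact: (pt_expr _ (e := Left (Right (Var 0)))).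
apply: (@pt_head XM (fun m => R (tag (tag m))) (fun m => V (tag (tag m))) iM cands
  (fun m v => Atom (av v)) hc' (fun m => d (tag (tag m)))).
apply: pt_comp (pt_reindex (fun m : XM => tag (tag m)) pt_d).
exact: (pt_expr _ (e := Left (Left (Var 0)))).
Qed.

Definition mkM (q : XC) (a : ms q) : XM := Tagged ms a.

Definition sma_step (q : XC) : ms q -> ms q :=
  ma_step (@cap (tag q)) (d (tag q)) (tagged q).1 (tagged q).2.

Lemma pt_ma_step : pt iM (fun m => mtab (mkM (sma_step (tagged m)))).
Proof.
have hall : pt iM (fun m => tbool (R (tag (tag m)))
    (all (fun v => v \in (tagged m).1) (sends (tag m)))).
  by apply: (pt_all pt_vlist); exact: (pt_expr _ (e := Right (Right (Var 0)))).
have hold : pt iM mtab by exact: (pt_expr _ (e := Right (Var 0))).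
pose new (m : XM) : ms (tag m) := (mhead m |: (tagged m).1, ((tagged m).2.2, mhead m)).
have hnew : pt iM (fun m => mtab (mkM (new m))).
  apply: pt_pair; last first.
    by apply: pt_pair pt_mhead; exact: (pt_expr _ (e := Right (Right (Right (Var 0))))).
  pose j (m : XM) := Node (iM m) (Atom (av (mhead m))).
  have hj : pt iM j by apply: pt_pair (pt_id _) pt_mhead.
  apply: (pt_comp hj).
  have hl : pt j (fun m => tlist [seq @venc m v | v <- sends (tag m)]).
    exact: (pt_expr _ (e := Left (Right (Left (Var 0))))).
  apply: (pt_map hl); apply: pt_pair; first exact: (pt_expr _ (e := Left (Right (Var 0)))).
  apply: (@pt_ext _ _ _ (fun p : XU => tbool (R (tag (tag (tag p))))
     ((av (tagged p) == av (mhead (tag p))) || (tagged p \in (tagged (tag p)).1)))).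
    by move=> p; rewrite !inE (inj_eq (@av_inj _)).
  apply: pt_or; last exact: (pt_expr _ (e := Right (Right (Var 0)))).
  apply: pt_eq; first exact: (pt_expr _ (e := Left (Right (Var 0)))).
  exact: (pt_expr _ (e := Right (Left (Var 0)))).
apply: pt_ext (pt_ite hall hold hnew) => -[q a] /=.
rewrite /sma_step /ma_step /= /sends /=; case: ifP => //.
Qed.

Definition sma_run (q : XC) : ms q := ma_run (@cap (tag q)) (d (tag q)) (tagged q).1 (tagged q).2.

Lemma pt_ma_run : pt iC (fun q => mtab (mkM (sma_run q))).
Proof.
pose v0 (q : XC) := head (d (tag q)) (sends q).
pose lt (q : XC) := [seq Atom (av v) | v <- sends q].
have hv0 : pt iC (fun q => Atom (av (v0 q))).
  apply: (@pt_head XC (fun q => R (tag q)) (fun q => V (tag q)) iC sends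
    (fun q v => Atom (av v)) pt_sends (fun q => d (tag q))).
  apply: pt_comp (pt_reindex (fun q : XC => tag q) pt_d).
  exact: (pt_expr _ (e := Left (Var 0))).
pose eA (q : XC) (a : ms q) := mtab (mkM a).
apply: (@pt_ext _ _ _ (fun q => eA q (iter (size (lt q)) (@sma_step q) ([set v0 q], (v0 q, v0 q))))).
  by move=> q; rewrite /lt size_map.
apply: (@pt_iterf XC (fun q => R (tag q)) iC lt ms eA).
- exact: pt_sends.
- apply: pt_pair (pt_pair hv0 hv0).
  pose j (q : XC) := Node (tlist (lt q)) (Atom (av (v0 q))).
  have hj : pt iC j by apply: pt_pair pt_sends hv0.
  apply: (pt_comp hj).
  have hl : pt j (fun q => tlist [seq Atom (av v) | v <- sends q]).
    exact: (pt_expr _ (e := Left (Var 0))).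
  apply: (pt_map hl); apply: pt_pair; first exact: (pt_expr _ (e := Right (Var 0))).
  apply: (@pt_ext _ _ _ (fun p : {q : XC & V (tag q)} => tbool (R (tag (tag p)))
     (av (tagged p) == av (v0 (tag p))))).
    by move=> p; rewrite !inE (inj_eq (@av_inj _)).
  apply: pt_eq; first exact: (pt_expr _ (e := Right (Var 0))).
  exact: (pt_expr _ (e := Right (Left (Var 0)))).
- exact: pt_ma_step.
- have [D hD] := @table_size_poly XC (fun q => R (tag q)) iC (fun q => V (tag q)) ms sends
    (fun q v => Atom (av v)) (fun q a v => @venc (mkM a) v) 4 pt_sends
    ltac:(by move=> q a v /=; have := tbool_size (R (tag q)) (v \in a.1); lia).
  exists (D + 3) => q a; have := hD q a.
  have := pw_mulX (tree_size (iC q)) D 3; have := pw_gt0 (tree_size (iC q)) D.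
  by rewrite /eA /mtab /=; lia.
Qed.

Definition mcst x := ((ep x) * bool)%type.
Definition smc_step x : mcst x -> mcst x := mc_step (@cap x) (k x) (d x).
Definition mcenc x (a : mcst x) := Node (etab a.1) (tbool (R x) a.2).

Lemma pt_mc_step : pt (fun p : {x & mcst x} => Node (env (tag p)) (mcenc (tagged p)))
  (fun p => mcenc (smc_step (tagged p))).
Proof.
pose Z := {x & mcst x}.
pose g (p : Z) : XC := Tagged ep (tagged p).1.
pose i (p : Z) := Node (env (tag p)) (mcenc (tagged p)).
pose P (p : Z) := (sma_run (g p)).2.1; pose Q (p : Z) := (sma_run (g p)).2.2.
pose j (p : Z) := Node (i p) (Node (Atom (av (P p))) (Atom (av (Q p)))).
have hrun : pt i (fun p => mtab (mkM (sma_run (g p)))).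
  apply: pt_comp (pt_reindex g pt_ma_run).
  exact: (pt_expr _ (e := ENode (Left (Var 0)) (Left (Right (Var 0))))).
have hj : pt i j by apply: pt_pair (pt_id _) (pt_snd hrun).
apply: (pt_comp hj).
have hl : pt j (fun p => tlist [seq eenc (tagged p).1 e | e <- enum (E (tag p))]).
  exact: (pt_expr _ (e := Left (Right (Left (Var 0))))).
have hP : pt j (fun p => Atom (av (P p))) by exact: (pt_expr _ (e := Left (Right (Var 0)))).
have hQ : pt j (fun p => Atom (av (Q p))) by exact: (pt_expr _ (e := Right (Right (Var 0)))).
pose W := {p : Z & E (tag p)}.
pose jj (p : W) := Node (j (tag p)) (eenc (tagged (tag p)).1 (tagged p)).
have eqQ (v : forall p : W, V (tag (tag p))) : pt jj (fun p => Atom (av (v p))) ->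
    pt jj (fun p => tbool (R (tag (tag p))) (v p == Q (tag p))).
  move=> hv; apply: (@pt_ext _ _ _ (fun p : W => tbool (R (tag (tag p))) (av (v p) == av (Q (tag p))))).
    by move=> p; rewrite (inj_eq (@av_inj _)).
  by apply: (pt_eq hv); exact: (pt_expr _ (e := Right (Right (Left (Var 0))))).
have hs : pt jj (fun p => Atom (av ((tagged (tag p)).1.1 (tagged p)))).
  exact: (pt_expr _ (e := Left (Right (Var 0)))).
have ht : pt jj (fun p => Atom (av ((tagged (tag p)).1.2 (tagged p)))).
  exact: (pt_expr _ (e := Left (Right (Right (Var 0))))).
have hPj : pt jj (fun p => Atom (av (P (tag p)))).
  exact: (pt_expr _ (e := Left (Right (Left (Var 0))))).
have hm (v : forall p : W, V (tag (tag p))) : pt jj (fun p => Atom (av (v p))) ->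
    pt jj (fun p => Atom (av (identify (P (tag p)) (Q (tag p)) (v p)))).
  move=> hv; apply: pt_ext (pt_ite (eqQ v hv) hPj hv) => p.
  by rewrite /identify; case: ifP.
apply: pt_pair.
  apply: (pt_map hl); apply: pt_pair; first exact: hm.
  by apply: pt_pair; [exact: hm | exact: (pt_expr _ (e := Right (Right (Right (Var 0)))))].
apply: pt_and; first exact: (pt_expr _ (e := Right (Right (Left (Var 0))))).
apply: pt_or.
  apply: (@pt_ext _ _ _ (fun p : Z => tbool (R (tag p)) (av (P p) == av (Q p)))).
    by move=> p; rewrite (inj_eq (@av_inj _)).
  exact: pt_eq.
apply: (@pt_ext _ _ _ (fun p : Z => tbool (R (tag p)) (c0 (tag p) *+ k (tag p) <=
    c0 (tag p) *+ cutval (@cap (tag p)) (tagged p).1.1 (tagged p).1.2 [set Q p])%R)).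
  by move=> p; rewrite ler_pMn2l ?c0_gt0.
apply: pt_le.
  apply: pt_comp (pt_reindex (fun p : Z => tag p) pt_k).
  exact: (pt_expr _ (e := Left (Left (Var 0)))).
apply: (pt_ext (fun p => f_equal (@Atom _) (big_mul_cond _ _ _))).
apply: (pt_sum hl).
  apply: pt_comp (pt_reindex (fun p : Z => tag p) pt_0).
  exact: (pt_expr _ (e := Left (Left (Var 0)))).
have h0 : pt jj (fun p => Atom 0%R).
  apply: pt_comp (pt_reindex (fun p : W => tag (tag p)) pt_0).
  exact: (pt_expr _ (e := Left (Left (Left (Var 0))))).
apply: pt_ext (pt_ite (pt_not (pt_eqb (eqQ _ hs) (eqQ _ ht)))
  (pt_expr _ (e := Right (Right (Right (Var 0)))) isT) h0) => p /=.
by rewrite !inE -negb_eqb /=; case: ifP.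
Qed.

Lemma pt_mincut_test : pt iC (fun q => tbool (R (tag q))
  (mincut_test (@cap (tag q)) (k (tag q)) (d (tag q)) (tagged q).1 (tagged q).2)).
Proof.
pose lt (q : XC) := [seq Atom (av v) | v <- sends q].
pose A (q : XC) := mcst (tag q).
pose eA (q : XC) (a : A q) := mcenc a.
pose f (q : XC) : A q -> A q := @smc_step (tag q).
pose a0 (q : XC) : A q := (tagged q, true).
have h : pt iC (fun q => eA q (iter (size (lt q)) (f q) (a0 q))).
  apply: (@pt_iterf XC (fun q => R (tag q)) iC lt A eA).
  - exact: pt_sends.
  - by apply: pt_pair (pt_true _); exact: (pt_expr _ (e := Right (Var 0))).
  - pose g (p : {q : XC & A q}) : {x & mcst x} := Tagged mcst (tagged p).
    apply: pt_comp (pt_reindex g pt_mc_step).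
    exact: (pt_expr _ (e := ENode (Left (Left (Var 0))) (Right (Var 0)))).
  - have hl : pt iC (fun q => tlist [seq eenc (tagged q) e | e <- enum (E (tag q))]).
      exact: (pt_expr _ (e := Right (Var 0))).
    have [D hD] := @table_size_poly XC (fun q => R (tag q)) iC (fun q => E (tag q)) A
      (fun q => enum (E (tag q))) (fun q e => eenc (tagged q) e) (fun q a e => eenc a.1 e) 0 hl
      ltac:(by []).
    exists (D + 3) => q a; have := hD q a; have := tbool_size (R (tag q)) a.2.
    have := pw_mulX (tree_size (iC q)) D 3; have := pw_gt0 (tree_size (iC q)) D.
    by rewrite /eA /mcenc /etab /=; lia.
apply: pt_ext (pt_snd h) => -[x [s t]].
by rewrite /mincut_test /a0 /f /lt size_map.
Qed.

End PtMinCut.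

(** * Numbers and preprocessing of the instance *)

Fixpoint pos_bits (q : positive) : seq bool :=
  match q with
  | xH => [:: true]
  | xO q => false :: pos_bits q
  | xI q => true :: pos_bits q
  end.

Definition nat_bits (n : nat) : seq bool :=
  if bin_of_nat n is Npos q then pos_bits q else [::].

Lemma tnatE (R : realFieldType) n : tnat R n = tlist [seq tbool R b | b <- nat_bits n].
Proof.
rewrite /tnat /nat_bits; case: (bin_of_nat n) => // q.
by elim: q => //= q ->.
Qed.

(** The bits come least significant first; the second component is the unit times the current power
    of two, doubled by an addition. *)
Definition horner_step (R : realFieldType) (s : R * R) (b : bool) :=
  ((if b then s.1 + s.2 else s.1), s.2 + s.2)%R.

Lemma foldl_bits (R : realFieldType) (y : R) n :
  ((foldl (@horner_step R) (0, y) (nat_bits n)).1 = y *+ n)%R.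
Proof.
rewrite -{2}(bin_of_natK n) /nat_bits; case: (bin_of_nat n) => [|q] //=.
suff H (a z : R) : ((foldl (@horner_step R) (a, z) (pos_bits q)).1 = a + z *+ nat_of_pos q)%R.
  by rewrite H add0r.
elim: q a z => [q IHq|q IHq|] a z //=; rewrite ?IHq ?natTrecE.
- by rewrite mulrSr -muln2 mulrnA mulr2n mulrnDl -addrA; congr (_ + _)%R; rewrite addrC.
- by rewrite -muln2 mulrnA mulr2n mulrnDl.
Qed.

Section Numbers.
Variables (X : Type) (R : X -> realFieldType) (i : forall x, tree (R x)) (c0 : forall x, R x).
Hypothesis pt_c0 : pt i (fun x => Atom (c0 x)).

(** Programs contain no constant of the field, so 0 is produced as a difference. *)
Lemma pt_zero : pt i (fun x => Atom 0%R).
Proof. by apply: pt_ext (pt_sub pt_c0 pt_c0) => x; rewrite subrr. Qed.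

Lemma pt_num (n : X -> nat) : pt i (fun x => tnat (R x) (n x)) ->
  pt i (fun x => Atom (c0 x *+ n x)%R).
Proof.
move=> hn; have hl : pt i (fun x => tlist [seq tbool (R x) b | b <- nat_bits (n x)]).
  by apply: pt_ext hn => x; rewrite tnatE.
pose A x : Type := (R x * R x)%type.
pose eA x (a : A x) := Node (Atom a.1) (Atom a.2).
have h : pt i (fun x => eA x (foldl (@horner_step (R x)) (0%R, c0 x) (nat_bits (n x)))).
  apply: (@pt_foldl X R (fun=> bool) i (fun x => nat_bits (n x)) (fun x => tbool (R x)) hl A eA).
  - exact: pt_pair pt_zero pt_c0.
  - pose Z := {x & (A x * bool)%type}.
    pose j (p : Z) := Node (Node (i (tag p)) (tbool (R (tag p)) (tagged p).2)) (eA (tag p) (tagged p).1).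
    have h1 : pt j (fun p => Atom (tagged p).1.1) by exact: (pt_expr _ (e := Left (Right (Var 0)))).
    have h2 : pt j (fun p => Atom (tagged p).1.2) by exact: (pt_expr _ (e := Right (Right (Var 0)))).
    have hb : pt j (fun p => tbool (R (tag p)) (tagged p).2).
      exact: (pt_expr _ (e := Right (Left (Var 0)))).
    apply: pt_pair (pt_add h2 h2).
    by apply: pt_ext (pt_ite hb (pt_add h1 h2) h1) => p; rewrite /horner_step /=; case: ifP.
  (* Atoms do not grow, so the pair has size 3 throughout. *)
  - by exists 2 => x t; rewrite /eA /= /pw; lia.
by apply: pt_ext (pt_fst h) => x; rewrite foldl_bits.
Qed.

(** The input list carries no numbering; a counter, increased by [c0] in every round, supplies it in
    a form in which numbers can be compared. *)
Lemma pt_enum (l : forall x, seq (tree (R x))) : pt i (fun x => tlist (l x)) ->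
  pt i (fun x => tlist [seq Node (Atom (c0 x *+ t)%R) (nth Leaf (l x) t) | t <- iota 0 (size (l x))]).
Proof.
move=> hl.
pose L x j := [seq Node (Atom (c0 x *+ t)%R) (nth Leaf (l x) t) | t <- iota 0 j].
pose st x j := Node (Atom (c0 x *+ j)%R) (tlist (rev (L x j))).
suff h : pt i (fun x => st x (size (l x))).
  by apply: pt_ext (pt_rev (pt_snd h)) => x; rewrite revK.
apply: (pt_iter hl).
- exact: (pt_pair pt_zero (pt_leaf i)).
- pose Z := {x & 'I_(size (l x))}.
  pose j (p : Z) := Node (Node (i (tag p)) (nth Leaf (l (tag p)) (tagged p))) (st (tag p) (tagged p)).
  have h1 : pt j (fun p => Atom (c0 (tag p) *+ (tagged p : nat))%R).
    exact: (pt_expr _ (e := Left (Right (Var 0)))).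
  have h2 : pt j (fun p => Atom (c0 (tag p))).
    apply: pt_comp (pt_reindex (fun p : Z => tag p) pt_c0).
    exact: (pt_expr _ (e := Left (Left (Var 0)))).
  apply: (@pt_ext _ _ _ (fun p : Z => Node (Atom (c0 (tag p) *+ (tagged p : nat) + c0 (tag p))%R)
    (Node (Node (Atom (c0 (tag p) *+ (tagged p : nat))%R) (nth Leaf (l (tag p)) (tagged p)))
      (tlist (rev (L (tag p) (tagged p))))))).
    move=> p; rewrite /st /L -[in RHS]addn1 iotaD map_cat rev_cat /= add0n.
    by rewrite addn1 mulrSr.
  apply: pt_pair (pt_add h1 h2) _; apply: pt_pair.
    by apply: pt_pair h1 _; exact: (pt_expr _ (e := Right (Left (Var 0)))).
  exact: (pt_expr _ (e := Right (Right (Var 0)))).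
- have [d hd] := pt_size hl; exists (d + 3) => x j jl.
  have : tree_size (tlist (L x j)) <= 3 * tree_size (tlist (take j (l x))).
    rewrite -(map_nth_iota0 Leaf jl); apply: (tlist_map_size (K := 2)) => t /=; lia.
  have := tlist_take_size (l x) j; have := hd x.
  have := pw_mulX (tree_size (i x)) d 3; have := pw_gt0 (tree_size (i x)) d.
  by rewrite /st /= tlist_rev_size; lia.
Qed.

Lemma pt_enum_ord (n : X -> nat) (g : forall x, 'I_(n x) -> tree (R x)) :
  pt i (fun x => tlist [seq g x e | e <- enum 'I_(n x)]) ->
  pt i (fun x => tlist [seq Node (Atom (c0 x *+ (e : nat))%R) (g x e) | e : 'I_(n x) <- enum 'I_(n x)]).
Proof.
move=> /pt_enum; apply: pt_ext => x; rewrite size_map size_enum_ord.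
have <- : [seq val e | e <- enum 'I_(n x)] = iota 0 (n x) by rewrite val_enum_ord.
rewrite -[X in tlist X = _]map_comp; congr tlist; apply: eq_map => e /=; congr Node.
by rewrite (nth_map e) ?size_enum_ord // nth_ord_enum.
Qed.

End Numbers.

(** * Translation of the input into atoms *)

Section Preprocess.
Variables (X : Type) (R : X -> realFieldType) (I : forall x, instance (R x)).

Definition inst x := tinstance (I x).
Definition renc0 x (e : 'I_(ne (I x))) :=
  tlist [:: tnat (R x) (src e); tnat (R x) (tgt e); tnat (R x) (cap e); Atom (ecost e)].

Lemma pt_edges0 : pt inst (fun x => tlist [seq renc0 e | e <- enum 'I_(ne (I x))]).
Proof. exact: (pt_expr _ (e := Left (Right (Right (Var 0))))). Qed.

Lemma pt_cost0 : pt (fun p : {x & 'I_(ne (I x))} => Node (inst (tag p)) (renc0 (tagged p)))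
  (fun p => Atom (ecost (tagged p))).
Proof. exact: (pt_expr _ (e := Left (Right (Right (Right (Right (Var 0))))))). Qed.

Definition npos x (e : 'I_(ne (I x))) := (ecost e <= 0)%R.

Lemma pt_npos : pt (fun p : {x & 'I_(ne (I x))} => Node (inst (tag p)) (renc0 (tagged p)))
  (fun p => tbool (R (tag p)) (npos (tagged p))).
Proof.
(* Zero is the difference of the cost with itself; no positive unit is available yet. *)
apply: pt_ext (pt_le pt_cost0 (pt_sub pt_cost0 pt_cost0)) => p.
by rewrite subrr.
Qed.

Definition unit_cost x : R x := head 0%R [seq ecost e | e <- enum 'I_(ne (I x)) & ~~ npos e].

Hypothesis some_pos : forall x, ~~ all (@npos x) (enum 'I_(ne (I x))).

Lemma unit_cost_gt0 x : (0 < unit_cost x)%R.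
Proof.
rewrite /unit_cost; have := some_pos x; rewrite -has_predC has_filter.
case E : (filter _ _) => [//|e s] _ /=.
have : e \in [seq e <- enum 'I_(ne (I x)) | ~~ npos e] by rewrite [filter _ _]E mem_head.
by rewrite mem_filter /npos -ltNge => /andP[].
Qed.

Lemma pt_unit_cost : pt inst (fun x => Atom (unit_cost x)).
Proof.
have h : pt inst (fun x => tlist [seq renc0 e | e <- enum 'I_(ne (I x)) & ~~ npos e]).
  exact: (pt_filter pt_edges0 (q := fun x e => ~~ npos e) (pt_not pt_npos)).
have h' : pt inst (fun x => tlist [seq Atom (ecost e) | e <- enum 'I_(ne (I x)) & ~~ npos e]).
  exact: (pt_map h pt_cost0).
apply: pt_ext (pt_left h') => x.
rewrite /unit_cost; have := some_pos x; rewrite -has_predC has_filter.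
by case E : (filter _ _).
Qed.

Definition venc1 x (v : 'I_(nv (I x))) : tree (R x) := Atom (unit_cost x *+ (v : nat))%R.

(** The index of the edge tells parallel edges apart, which may agree in everything else. *)
Definition eenc1 x (e : 'I_(ne (I x))) := Node (Atom (unit_cost x *+ (e : nat))%R)
  (Node (venc1 (src e)) (Node (venc1 (tgt e)) (Node (Atom (unit_cost x *+ cap e)%R)
     (Atom (ecost e))))).

Definition env1 x := Node (Atom (unit_cost x)) (Node (Atom (unit_cost x *+ kconn (I x))%R)
  (tlist [seq eenc1 e | e <- enum 'I_(ne (I x))])).

Lemma pt_env1 : pt inst env1.
Proof.
apply: pt_pair pt_unit_cost _; apply: pt_pair.
  by apply: (pt_num pt_unit_cost); exact: (pt_expr _ (e := Left (Right (Var 0)))).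
apply: (pt_enum_ord pt_unit_cost).
apply: (pt_map pt_edges0).
have hc := pt_weak renc0 pt_unit_cost.
apply: pt_pair; first by apply: (pt_num hc); exact: (pt_expr _ (e := Left (Right (Var 0)))).
apply: pt_pair; first by apply: (pt_num hc); exact: (pt_expr _ (e := Left (Right (Right (Var 0))))).
apply: pt_pair; last exact: pt_cost0.
by apply: (pt_num hc); exact: (pt_expr _ (e := Left (Right (Right (Right (Var 0)))))).
Qed.

End Preprocess.

(** * The bottleneck algorithm *)

Section Instance.
Variables (R : realFieldType) (I : instance R).

Lemma nv_gt0 : 0 < nv I. Proof. by case: I. Qed.
Lemma kconn_gt0 : 0 < kconn I. Proof. by case: I. Qed.
Lemma ecost_ge0 (e : 'I_(ne I)) : (0 <= ecost e)%R. Proof. by case: I e. Qed.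
Lemma src_neq_tgt (e : 'I_(ne I)) : src e != tgt e. Proof. by case: I e. Qed.

Lemma inst_connect (x y : 'I_(nv I)) :
  connect [rel a b | [exists e : 'I_(ne I), ((src e == a) && (tgt e == b))
                                   || ((src e == b) && (tgt e == a))]] x y.
Proof. by case: I x y. Qed.

Definition root : 'I_(nv I) := Ordinal nv_gt0.

(** By connectivity there is a path from [v] to an end of some edge; either it is trivial or its
    first step is an edge at [v]. *)
Lemma mem_ends (v : 'I_(nv I)) : 0 < ne I -> v \in ends (@src _ I) (@tgt _ I).
Proof.
move=> m0; have sE e : src e \in ends (@src _ I) (@tgt _ I) by rewrite mem_cat map_f ?mem_enum.
have tE e : tgt e \in ends (@src _ I) (@tgt _ I) by rewrite mem_cat map_f ?orbT ?mem_enum.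
have /connectP[[|a p] /=] := inst_connect v (src (Ordinal m0)); first by move=> _ <-.
by case/andP => /existsP[e /orP[/andP[/eqP <- _]|/andP[_ /eqP <-]]] _ _.
Qed.

Lemma nv_gt1 : 0 < ne I -> 1 < nv I.
Proof.
move=> m0; have := src_neq_tgt (Ordinal m0); case: (nv I) (src _) (tgt _) => [[]//|[|//]] a b.
by rewrite !ord1.
Qed.

(** Edges outside [F] keep their ends and lose their capacity, so [ends] still lists every vertex,
    and a set [F] that misses a vertex is rejected. *)
Definition cap_in (F : {set 'I_(ne I)}) e := if e \in F then cap e else 0.

Lemma cutval_delta F S :
  cutval (cap_in F) (@src _ I) (@tgt _ I) S = \sum_(e in delta S :&: F) cap e.
Proof.
rewrite /cutval (eq_bigr (fun e => if e \in F then cap e else 0)) // -big_mkcondr /=.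
by apply: eq_bigl => e; rewrite !inE.
Qed.

Definition feas_test F := mincut_test (cap_in F) (kconn I) root (@src _ I) (@tgt _ I).

Lemma feas_testE F : 0 < ne I -> feas_test F = feasible F.
Proof.
move=> m0; apply/mincut_testP/forallP => [|g S|h X [a [b [_ _ aX bX]]]].
- by rewrite card_ord.
- apply/implyP => /set0Pn[a aS]; apply/implyP => /properP[_ [b _ bS]].
  by rewrite -cutval_delta; apply: g; exists a, b; rewrite !mem_ends.
- rewrite cutval_delta; have /implyP/(_ _)/implyP := h X; apply.
    by apply/set0Pn; exists a.
  by apply/properP; split; [apply: subsetT | exists b].
Qed.

Lemma feasible_mono (F F' : {set 'I_(ne I)}) : F \subset F' -> feasible F -> feasible F'.
Proof.
move=> FF /forallP h; apply/forallP => S; apply/implyP => S0; apply/implyP => ST.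
have := h S; rewrite S0 ST /= => /leq_trans; apply.
rewrite [leqRHS](bigID (mem F)) /=; apply: leq_trans (leq_addr _ _); apply: eq_leq.
apply: eq_bigl => e; rewrite !inE.
by case: (boolP (e \in F)) => [/(subsetP FF) ->|]; rewrite ?andbT ?andbF.
Qed.

Definition below (y : R) : {set 'I_(ne I)} := [set e | ecost e <= y]%R.

Definition bottleneck : R := head 0%R [seq ecost e | e <- enum 'I_(ne I) &
  feas_test (below (ecost e)) &&
  all (fun e' => ~~ feas_test (below (ecost e')) || (ecost e <= ecost e')%R) (enum 'I_(ne I))].

(* The last edge of a feasible set, in the order of the costs, pays for each of
   the edges below the bottleneck. *)
Lemma bottleneckP : 0 < ne I -> (exists F : {set 'I_(ne I)}, feasible F) ->
  feasible (below bottleneck) /\ (cost (below bottleneck) <= (ne I)%:R * OPT I)%R.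
Proof.
move=> m0 ex; have n1 := nv_gt1 m0; have [[F fF cF] _] := OPT_min ex.
(* An empty [F] would leave the root without capacity, although there are at least two vertices and
   [kconn] is positive. *)
have [e0 e0F] : exists e0, e0 \in F.
  apply/set0Pn; apply: contraTneq fF => ->; apply/forallPn; exists [set root].
  have S0 : [set root] != set0 :> {set 'I_(nv I)} by apply/set0Pn; exists root; rewrite inE.
  have ST : [set root] \proper [set: 'I_(nv I)].
    apply/properP; split; first exact: subsetT.
    by exists (Ordinal n1); rewrite // inE; apply/eqP => /(congr1 val).
  by rewrite S0 ST /= -ltnNge setI0 big_set0 kconn_gt0.
have [e1 e1F e1max] := arg_maxP (@ecost _ I) e0F.
have {}e1F : e1 \in F := e1F.
have good1 : feas_test (below (ecost e1)).
  rewrite feas_testE //; apply: feasible_mono fF; apply/subsetP => e eF.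
  by rewrite inE; apply: e1max.
pose s := [seq e <- enum 'I_(ne I) | feas_test (below (ecost e)) &&
  all (fun e' => ~~ feas_test (below (ecost e')) || (ecost e <= ecost e')%R) (enum 'I_(ne I))].
have [e2 e2s e2E] : exists2 e2, e2 \in s & bottleneck = ecost e2.
  have [e3 g3 m3] := arg_minP (P := fun e => feas_test (below (ecost e))) (@ecost _ I) good1.
  have : e3 \in s.
    rewrite mem_filter g3 mem_enum andbT; apply/allP => e' _.
    by case: (boolP (feas_test _)) => //= /m3.
  by rewrite /bottleneck -/s; case: s => //= a s' _; exists a; rewrite ?mem_head.
move: e2s; rewrite mem_filter => /andP[/andP[g2 /allP m2] _].
rewrite e2E; split; first by rewrite -feas_testE.
have c21 : (ecost e2 <= OPT I)%R.
  have := m2 e1; rewrite mem_enum good1 /= => /(_ isT) h; apply: le_trans h _.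
  rewrite -cF /cost (bigD1 e1) //= lerDl sumr_ge0 // => e _; exact: ecost_ge0.
rewrite /cost; apply: (@le_trans _ _ (\sum_(e in below (ecost e2)) OPT I)%R).
  by apply: ler_sum => e; rewrite inE => h; apply: le_trans h c21.
rewrite sumr_const mulr_natl; apply: ler_wpMn2l.
  by apply: le_trans c21; apply: ecost_ge0.
by apply: leq_trans (max_card _) _; rewrite card_ord.
Qed.

End Instance.

Section PtBottleneck.
Variables (X : Type) (R : X -> realFieldType) (I : forall x, instance (R x)).
Hypothesis some_pos : forall x, ~~ all (@npos X R I x) (enum 'I_(ne (I x))).

Notation env := (env1 I).
Notation c0 := (unit_cost I).

Lemma pt_unit : pt env (fun x => Atom (c0 x)).
Proof. exact: (pt_expr _ (e := Left (Var 0))). Qed.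

Lemma pt_edges : pt env (fun x => tlist [seq eenc1 e | e <- enum 'I_(ne (I x))]).
Proof. exact: (pt_expr _ (e := Right (Right (Var 0)))). Qed.

Lemma unit_mul_inj x : injective (fun n : nat => (c0 x *+ n)%R).
Proof.
move=> a b h; apply/eqP; rewrite eqn_leq.
by rewrite -!(ler_pMn2l (unit_cost_gt0 some_pos x)) h lexx.
Qed.

Lemma ne_gt0 x : 0 < ne (I x).
Proof.
have := some_pos x; rewrite -has_predC => /hasP[e _ _].
exact: leq_ltn_trans (ltn_ord e).
Qed.

Definition vatom x (v : 'I_(nv (I x))) : R x := (c0 x *+ (v : nat))%R.

Lemma vatom_inj x : injective (@vatom x).
Proof. by move=> u v /unit_mul_inj /val_inj. Qed.

Notation XE := {x & 'I_(ne (I x))}.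
Notation inE1 := (fun p : XE => Node (env (tag p)) (eenc1 (tagged p))).

(** The cut test is run on a family indexed by an instance with one of its edges; the capacities of
    all dearer edges are replaced by 0. *)
Lemma pt_feas_below : pt inE1 (fun p => tbool (R (tag p)) (feas_test (below (I (tag p)) (ecost (tagged p))))).
Proof.
pose V (p : XE) : finType := 'I_(nv (I (tag p))).
pose E (p : XE) : finType := 'I_(ne (I (tag p))).
pose capF (p : XE) (e : E p) := cap_in (below (I (tag p)) (ecost (tagged p))) e.
pose envE (p : XE) := env (tag p).
have hc : pt envE (fun p => Atom (c0 (tag p))) by exact: (pt_reindex (fun p : XE => tag p) pt_unit).
have h0 := pt_zero hc.
have hk : pt envE (fun p => Atom (c0 (tag p) *+ kconn (I (tag p)))%R).
  exact: (pt_expr _ (e := Left (Right (Var 0)))).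
have hd : pt envE (fun p => Atom (vatom (root (I (tag p))))).
  by apply: pt_ext h0 => p; rewrite /vatom mulr0n.
have H := @pt_mincut_test XE (fun p => R (tag p)) V E capF (fun p => kconn (I (tag p)))
  (fun p => root (I (tag p))) (fun p => c0 (tag p)) (fun p => @vatom (tag p)) envE
  (fun p => unit_cost_gt0 some_pos (tag p)) (fun p => @vatom_inj (tag p)) h0 hk hd.
pose g (p : XE) : XC V E := Tagged (ep V E) (@src _ (I (tag p)), @tgt _ (I (tag p))).
apply: pt_comp (pt_reindex g H); apply: pt_pair.
  exact: (pt_expr _ (e := Left (Var 0))).
have hl := pt_weak (fun x => @eenc1 X R I x) pt_edges.
apply: (pt_map hl).
pose Z := {p : XE & 'I_(ne (I (tag p)))}.
pose j (p : Z) := Node (Node (env (tag (tag p))) (eenc1 (tagged (tag p)))) (eenc1 (tagged p)).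
apply: pt_pair; first exact: (pt_expr _ (e := Left (Right (Right (Var 0))))).
apply: pt_pair; first exact: (pt_expr _ (e := Left (Right (Right (Right (Var 0)))))).
have h1 : pt j (fun p => Atom (ecost (tagged p))).
  exact: (pt_expr _ (e := Right (Right (Right (Right (Right (Var 0))))))).
have h2 : pt j (fun p => Atom (ecost (tagged (tag p)))).
  exact: (pt_expr _ (e := Right (Right (Right (Right (Right (Left (Var 0)))))))).
have h3 : pt j (fun p => Atom (c0 (tag (tag p)) *+ cap (tagged p))%R).
  exact: (pt_expr _ (e := Left (Right (Right (Right (Right (Var 0))))))).
have h4 : pt j (fun p => Atom 0%R).
  apply: pt_comp (pt_reindex (fun p : Z => tag p) h0).
  exact: (pt_expr _ (e := Left (Left (Var 0)))).
apply: pt_ext (pt_ite (pt_le h1 h2) h3 h4) => p.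
by rewrite /capF /cap_in inE /=; case: ifP => //; rewrite mulr0n.
Qed.

Lemma pt_bottleneck : pt env (fun x => tset (R x) (below (I x) (bottleneck (I x)))).
Proof.
pose fe x (e : 'I_(ne (I x))) := feas_test (below (I x) (ecost e)).
pose fenc x (e : 'I_(ne (I x))) := Node (eenc1 e) (tbool (R x) (fe x e)).
have hf : pt env (fun x => tlist [seq fenc x e | e <- enum 'I_(ne (I x))]).
  by apply: (pt_map pt_edges); apply: pt_pair pt_feas_below; exact: (pt_expr _ (e := Right (Var 0))).
pose q x (e : 'I_(ne (I x))) := fe x e &&
   all (fun e' => ~~ fe x e' || (ecost e <= ecost e')%R) (enum 'I_(ne (I x))).
have hq : pt env (fun x => tlist [seq fenc x e | e <- enum 'I_(ne (I x)) & q x e]).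
  have hf' : pt (fun x => Node (env x) (tlist [seq fenc x e | e <- enum 'I_(ne (I x))]))
      (fun x => tlist [seq fenc x e | e <- enum 'I_(ne (I x))]).
    exact: (pt_expr _ (e := Right (Var 0))).
  apply: pt_comp (pt_pair (pt_id _) hf) _.
  apply: (pt_filter hf' (q := q)); apply: pt_and; first exact: (pt_expr _ (e := Right (Right (Var 0)))).
  pose j (p : XE) := Node (Node (env (tag p)) (tlist [seq fenc _ e | e <- enum 'I_(ne (I (tag p)))]))
    (fenc _ (tagged p)).
  have hl : pt j (fun p => tlist [seq fenc (tag p) e | e <- enum 'I_(ne (I (tag p)))]).
    exact: (pt_expr _ (e := Right (Left (Var 0)))).
  apply: (pt_all hl); apply: pt_or.
    by apply: pt_not; exact: (pt_expr _ (e := Right (Right (Var 0)))).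
  apply: pt_le; last exact: (pt_expr _ (e := Right (Right (Right (Right (Left (Right (Var 0)))))))).
  exact: (pt_expr _ (e := Right (Right (Right (Right (Left (Right (Left (Var 0))))))))).
have hb : pt env (fun x => Atom (bottleneck (I x))).
  have hl : pt env (fun x => tlist [seq Atom y | y <- [seq ecost e | e <- enum 'I_(ne (I x)) & q x e]]).
    apply: (@pt_ext _ _ _ (fun x => tlist [seq Atom (ecost e) | e <- enum 'I_(ne (I x)) & q x e])).
      by move=> x; rewrite -[in RHS]map_comp.
    by apply: (pt_map hq); exact: (pt_expr _ (e := Right (Right (Right (Right (Left (Right (Var 0)))))))).
  exact: (@pt_head X R (fun x => R x) env _ (fun x y => Atom y) hl (fun x => 0%R) (pt_zero pt_unit)).
pose j x := Node (env x) (Atom (bottleneck (I x))).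
have hj : pt env j by exact: pt_pair (pt_id _) hb.
apply: (pt_comp hj).
have hl : pt j (fun x => tlist [seq eenc1 e | e <- enum 'I_(ne (I x))]).
  exact: (pt_expr _ (e := Right (Right (Left (Var 0))))).
apply: (pt_map hl).
apply: (@pt_ext _ _ _ (fun p : XE => tbool (R (tag p)) (ecost (tagged p) <= bottleneck (I (tag p)))%R)).
  by move=> p; rewrite inE.
apply: pt_le; first exact: (pt_expr _ (e := Right (Right (Right (Right (Right (Var 0))))))).
exact: (pt_expr _ (e := Right (Left (Var 0)))).
Qed.

End PtBottleneck.

(** * The matroid intersection algorithm *)

Lemma filter_iota_lt k n : k <= n -> [seq t <- iota 0 n | t < k] = iota 0 k.
Proof.
move=> kn; rewrite -(subnKC kn) iotaD filter_cat add0n.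
have -> : [seq t <- iota 0 k | t < k] = iota 0 k.
  by apply/all_filterP/allP => t; rewrite mem_iota add0n.
rewrite -[RHS]cats0; congr (_ ++ _).
by apply/eqP/negPn; rewrite -has_filter; apply/hasPn => t; rewrite mem_iota -leqNgt => /andP[].
Qed.

Section CaseA.
Variables (X : Type) (R : X -> realFieldType) (I : forall x, instance (R x)).
Hypothesis some_pos : forall x, ~~ all (@npos X R I x) (enum 'I_(ne (I x))).
Hypothesis k_small : forall x, kconn (I x) <= ne (I x) * ne (I x).

Notation env := (env1 I).
Notation c0 := (unit_cost I).
Notation eE := (@eenc1 X R I _).
Notation va := (@vatom X R I _).

(** [kconn] is binary, so there is no list of length [kconn] to loop over. The pairs of edges give
    [ne * ne] cells; they are numbered, and by [k_small] the numbers below [kconn] are all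
    present. *)
Lemma pt_colours : pt env (fun x => tlist [seq Atom (c0 x *+ (j : nat))%R |
   j : 'I_(kconn (I x)) <- enum 'I_(kconn (I x))]).
Proof.
have hu := pt_unit I; have he := pt_edges I.
pose ys x := pairs (enum 'I_(ne (I x))).
have hp : pt env (fun x => tlist [seq Leaf : tree (R x) | p <- ys x]).
  apply: (@pt_flatten X R (fun x => 'I_(ne (I x))) env _ _ (fun x => 'I_(ne (I x)) * 'I_(ne (I x)))%type
    (fun x p => Leaf) (fun x a => [seq (a, b) | b <- enum 'I_(ne (I x))]) he).
  apply: (@pt_ext _ _ _ (fun p : {x & 'I_(ne (I x))} => tlist [seq Leaf | b <- enum 'I_(ne (I (tag p)))])).
    by move=> p; rewrite -[in RHS]map_comp.
  have hl := pt_weak (fun x => @eenc1 X R I x) he.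
  by apply: (pt_map hl); apply: pt_leaf.
have hN := pt_enum hu hp.
pose Y (x : X) := nat.
pose nenc x (t : Y x) : tree (R x) := Node (Atom (c0 x *+ t)%R) (nth Leaf [seq Leaf | p <- ys x] t).
have hk : pt env (fun x => Atom (c0 x *+ kconn (I x))%R).
  exact: (pt_expr _ (e := Left (Right (Var 0)))).
have hF : pt env (fun x => tlist [seq nenc x t | t <- iota 0 (size [seq Leaf : tree (R x) | p <- ys x])
     & t < kconn (I x)]).
  apply: (@pt_filter X R Y env _ nenc hN (fun x t => t < kconn (I x))).
  apply: (@pt_ext _ _ _ (fun p : {x & Y x} => tbool (R (tag p))
    (~~ (c0 (tag p) *+ kconn (I (tag p)) <= c0 (tag p) *+ (tagged p : nat))%R))).
    by move=> p; rewrite ler_pMn2l ?unit_cost_gt0 // -ltnNge.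
  apply: pt_not; apply: pt_le; first exact: (pt_weak nenc hk).
  exact: (pt_expr _ (e := Left (Right (Var 0)))).
have hM : pt env (fun x => tlist [seq Atom (c0 x *+ t)%R | t <- iota 0 (size [seq Leaf : tree (R x) | p <- ys x])
     & t < kconn (I x)]).
  by apply: (pt_map hF); exact: (pt_expr _ (e := Left (Right (Var 0)))).
apply: pt_ext hM => x; rewrite filter_iota_lt.
  by rewrite -val_enum_ord -[in LHS]map_comp.
rewrite size_map; have -> : size (ys x) = size (enum 'I_(ne (I x))) * size (enum 'I_(ne (I x))).
  exact: size_allpairs.
by rewrite size_enum_ord.
Qed.

Definition elt x : finType := ('I_(kconn (I x)) * ('I_(ne (I x)) * bool))%type.

Definition eT x (t : elt x) :=
  Node (Atom (c0 x *+ (t.1 : nat))%R) (Node (eE t.2.1) (tbool (R x) t.2.2)).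

Definition arcs x := [seq (e, b) | e <- enum 'I_(ne (I x)), b <- [:: true; false]].
Definition elts x : seq (elt x) := [seq (j, a) | j <- enum 'I_(kconn (I x)), a <- arcs x].

Lemma mem_elts x t : t \in elts x.
Proof.
case: t => j [e b]; apply/allpairsP; exists (j, (e, b)); rewrite mem_enum; split=> //.
by apply/allpairsP; exists (e, b); rewrite mem_enum; split=> //; case: b.
Qed.

Lemma uniq_elts x : uniq (elts x).
Proof.
apply: allpairs_uniq; rewrite ?enum_uniq //; last by move=> [? ?] [? ?] _ _ [-> ->].
by apply: allpairs_uniq; rewrite ?enum_uniq // => -[? ?] [? ?] _ _ [-> ->].
Qed.

Definition envA x := Node (env x) (tlist [seq eT t | t <- elts x]).

Lemma pt_arcs : pt env (fun x => tlist [seq Node (eE a.1) (tbool (R x) a.2) | a <- arcs x]).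
Proof.
apply: (@pt_flatten X R (fun x => 'I_(ne (I x))) env _ _ (fun x => 'I_(ne (I x)) * bool)%type
  (fun x a => Node (eE a.1) (tbool (R x) a.2)) (fun x e => [:: (e, true); (e, false)]) (pt_edges I)).
pose j (p : {x & 'I_(ne (I x))}) := Node (env (tag p)) (eE (tagged p)).
have h : pt j (fun p => eE (tagged p)) by exact: (pt_expr _ (e := Right (Var 0))).
exact: pt_pair (pt_pair h (pt_true _)) (pt_pair (pt_pair h (pt_false _)) (pt_leaf _)).
Qed.

Lemma pt_envA : pt env envA.
Proof.
apply: pt_pair (pt_id _) _.
apply: (@pt_flatten X R (fun x => 'I_(kconn (I x))) env _ _ elt
  (fun x t => eT t) (fun x j => [seq (j, a) | a <- arcs x]) pt_colours).
apply: (@pt_ext _ _ _ (fun p : {x & 'I_(kconn (I x))} => tlist [seq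
    Node (Atom (c0 (tag p) *+ (tagged p : nat))%R) (Node (eE a.1) (tbool (R (tag p)) a.2)) | a <- arcs (tag p)])).
  by move=> p; rewrite -[in RHS]map_comp.
pose j (p : {x & 'I_(kconn (I x))}) := Node (env (tag p)) (Atom (c0 (tag p) *+ (tagged p : nat))%R).
have hl : pt j (fun p => tlist [seq Node (eE a.1) (tbool (R (tag p)) a.2) | a <- arcs (tag p)]).
  exact: (pt_weak (fun x (j : 'I_(kconn (I x))) => Atom (c0 x *+ (j : nat))%R) pt_arcs).
by apply: (pt_map hl); exact: (pt_expr _ (e := ENode (Right (Left (Var 0))) (Right (Var 0)))).
Qed.

Notation XT := {x & elt x}.
Notation inT := (fun p : XT => eT (tagged p)).

Definition tl x (t : elt x) := atail (@src _ (I x)) (@tgt _ (I x)) t.2.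
Definition hd x (t : elt x) := ahead (@src _ (I x)) (@tgt _ (I x)) t.2.

Lemma pt_tl : pt inT (fun p => Atom (va (tl (tagged p)))).
Proof.
have hb : pt inT (fun p => tbool (R (tag p)) (tagged p).2.2).
  exact: (pt_expr _ (e := Right (Right (Var 0)))).
apply: pt_ext (pt_ite hb (pt_expr _ (e := Left (Right (Left (Right (Var 0))))) isT)
  (pt_expr _ (e := Left (Right (Right (Left (Right (Var 0)))))) isT)) => p.
by rewrite /tl /atail; case: ifP.
Qed.

Lemma pt_hd : pt inT (fun p => Atom (va (hd (tagged p)))).
Proof.
have hb : pt inT (fun p => tbool (R (tag p)) (tagged p).2.2).
  exact: (pt_expr _ (e := Right (Right (Var 0)))).
apply: pt_ext (pt_ite hb (pt_expr _ (e := Left (Right (Right (Left (Right (Var 0)))))) isT)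
  (pt_expr _ (e := Left (Right (Left (Right (Var 0))))) isT)) => p.
by rewrite /hd /ahead; case: ifP.
Qed.

Lemma pt_ordeq (Z : Type) (g : Z -> X) (j : forall z, tree (R (g z))) (n : Z -> nat)
    (a b : forall z, 'I_(n z)) :
  pt j (fun z => Atom (c0 (g z) *+ (a z : nat))%R) -> pt j (fun z => Atom (c0 (g z) *+ (b z : nat))%R) ->
  pt j (fun z => tbool (R (g z)) (a z == b z)).
Proof.
move=> ha hb; apply: pt_ext (pt_eq ha hb) => z.
by rewrite (inj_eq (unit_mul_inj some_pos (x := _))).
Qed.

Lemma pt_eqelt : pt (fun p : {x & (elt x * elt x)%type} => Node (eT (tagged p).1) (eT (tagged p).2))
  (fun p => tbool (R (tag p)) ((tagged p).1 == (tagged p).2)).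
Proof.
pose Z := {x & (elt x * elt x)%type}.
apply: (@pt_ext _ _ _ (fun p : Z => tbool (R (tag p)) (((tagged p).1.1 == (tagged p).2.1) &&
   (((tagged p).1.2.1 == (tagged p).2.2.1) && ((tagged p).1.2.2 == (tagged p).2.2.2))))).
  by move=> [x [[j [e b]] [j' [e' b']]]]; rewrite !xpair_eqE.
apply: pt_and.
  apply: (@pt_ordeq Z (fun p => tag p) _ (fun p => kconn (I (tag p)))
    (fun p => (tagged p).1.1) (fun p => (tagged p).2.1)).
    exact: (pt_expr _ (e := Left (Left (Var 0)))).
  exact: (pt_expr _ (e := Left (Right (Var 0)))).
apply: pt_and.
  apply: (@pt_ordeq Z (fun p => tag p) _ (fun p => ne (I (tag p)))
    (fun p => (tagged p).1.2.1) (fun p => (tagged p).2.2.1)).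
    exact: (pt_expr _ (e := Left (Left (Right (Left (Var 0)))))).
  exact: (pt_expr _ (e := Left (Left (Right (Right (Var 0)))))).
apply: pt_eqb; first exact: (pt_expr _ (e := Right (Right (Left (Var 0))))).
exact: (pt_expr _ (e := Right (Right (Right (Var 0))))).
Qed.

Lemma pt_ecostT : pt inT (fun p => Atom (ecost (tagged p).2.1)).
Proof. exact: (pt_expr _ (e := Right (Right (Right (Right (Left (Right (Var 0)))))))). Qed.

Definition vends x := ends (@src _ (I x)) (@tgt _ (I x)).

Lemma pt_vends : pt env (fun x => tlist [seq Atom (va v) | v <- vends x]).
Proof.
apply: pt_cat.
  apply: (@pt_ext _ _ _ (fun x => tlist [seq Atom (va (src e)) | e <- enum 'I_(ne (I x))])).
    by move=> x; rewrite -[in RHS]map_comp.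
  by apply: (pt_map (pt_edges I)); exact: (pt_expr _ (e := Left (Right (Right (Var 0))))).
apply: (@pt_ext _ _ _ (fun x => tlist [seq Atom (va (tgt e)) | e <- enum 'I_(ne (I x))])).
  by move=> x; rewrite -[in RHS]map_comp.
by apply: (pt_map (pt_edges I)); exact: (pt_expr _ (e := Left (Right (Right (Right (Var 0)))))).
Qed.

Definition Fm x := forests (kconn (I x)) (@src _ (I x)) (@tgt _ (I x)).
Definition Lm x := laminar (kconn (I x)) (@src _ (I x)) (@tgt _ (I x)) (root (I x)) (@cap _ (I x)).

Notation XJ := {x & {set elt x}}.
Definition senc (p : XJ) (t : elt (tag p)) := Node (eT t) (tbool (R (tag p)) (t \in tagged p)).
Definition iJ (p : XJ) := Node (envA (tag p)) (tlist [seq senc t | t <- elts (tag p)]).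
Definition XJT := {p : XJ & elt (tag p)}.
Definition iJT (p : XJT) := Node (iJ (tag p)) (senc (tagged p)).

(** Independence is tested in the form [is_forest]: for each element of the set, the component of
    its tail in its colour without it is computed, and its head is looked up there. *)
Lemma pt_forests : pt_oracle (@eT) elts envA Fm.
Proof.
pose Vz (z : XJT) : finType := 'I_(nv (I (tag (tag z)))).
pose aj (z : XJT) : rel (Vz z) := adj (@src _ (I (tag (tag z)))) (@tgt _ (I (tag (tag z))))
   (tagged (tag z) :\ tagged z) (tagged z).1.
pose ac (z : XJT) : {set Vz z} := rch (aj z) [set tl (tagged z)].
apply: (@pt_ext _ _ _ (fun p : XJ => tbool (R (tag p))
  (all (fun t => ~~ (t \in tagged p) || ~~ (hd t \in ac (Tagged (fun p : XJ => elt (tag p)) t)))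
     (elts (tag p))))).
  move=> p; rewrite /Fm forestsE /is_forest (forallb_all _ (mem_elts (x := _))).
  by congr (tbool _ _); apply: eq_all => t; rewrite implybE.
have hl : pt iJ (fun p => tlist [seq senc t | t <- elts (tag p)]).
  exact: (pt_expr _ (e := Right (Var 0))).
apply: (pt_all hl); apply: pt_or; first by apply: pt_not; exact: (pt_expr _ (e := Right (Right (Var 0)))).
apply: pt_not.
have hv : pt iJT (fun z => tlist [seq Atom (va v) | v <- vends (tag (tag z))]).
  apply: pt_comp (pt_reindex (fun z : XJT => tag (tag z)) pt_vends).
  exact: (pt_expr _ (e := Left (Left (Left (Var 0))))).
have callT (o : forall p : XT, tree (R (tag p))) : pt inT o ->
    pt iJT (fun z => o (Tagged elt (tagged z))).
  move=> ho; apply: pt_comp (pt_reindex (fun z : XJT => Tagged elt (tagged z)) ho).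
  exact: (pt_expr _ (e := Left (Right (Var 0)))).
have hc : pt iJT (fun z => tlist [seq Node (Atom (va v)) (tbool (R (tag (tag z))) (v \in ac z))
    | v <- vends (tag (tag z))]).
  apply: (@pt_rch XJT (fun z => R (tag (tag z))) Vz iJT (fun z v => Atom (va v))
    (fun z => vends (tag (tag z))) aj (fun z => [set tl (tagged z)])).
  - by move=> z v; apply: mem_ends; apply: ne_gt0.
  - exact: hv.
  - pose Z2 := {z : XJT & (Vz z * Vz z)%type}.
    pose j2 (q : Z2) := Node (iJT (tag q)) (Node (Atom (va (tagged q).1)) (Atom (va (tagged q).2))).
    apply: (@pt_ext _ _ _ (fun q : Z2 => tbool (R (tag (tag (tag q))))
      (has (fun t => (~~ (t == tagged (tag q)) && (t \in tagged (tag (tag q)))) &&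
         ((t.1 == (tagged (tag q)).1) &&
          ((tl t == (tagged q).1) && (hd t == (tagged q).2) ||
           (tl t == (tagged q).2) && (hd t == (tagged q).1)))) (elts (tag (tag (tag q))))))).
      move=> q; rewrite /aj /adj /= (existsb_has _ (mem_elts (x := _))).
      by congr (tbool _ _); apply: eq_has => t; rewrite !inE.
    have hl2 : pt j2 (fun q => tlist [seq senc t | t <- elts (tag (tag (tag q)))]).
      exact: (pt_expr _ (e := Right (Left (Left (Var 0))))).
    apply: (pt_has hl2).
    pose Z3 := {q : Z2 & elt (tag (tag (tag q)))}.
    pose j3 (q : Z3) := Node (j2 (tag q)) (senc (tagged q)).
    have call3 (o : forall p : XT, tree (R (tag p))) : pt inT o ->
        pt j3 (fun z => o (Tagged elt (tagged z))).
      move=> ho; apply: pt_comp (pt_reindex (fun z : Z3 => Tagged elt (tagged z)) ho).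
      exact: (pt_expr _ (e := Left (Right (Var 0)))).
    have h1 : pt j3 (fun q => Atom (va (tagged (tag q)).1)).
      exact: (pt_expr _ (e := Left (Right (Left (Var 0))))).
    have h2 : pt j3 (fun q => Atom (va (tagged (tag q)).2)).
      exact: (pt_expr _ (e := Right (Right (Left (Var 0))))).
    have veq (a b : forall q : Z3, 'I_(nv (I (tag (tag (tag (tag q))))))) :
        pt j3 (fun q => Atom (va (a q))) -> pt j3 (fun q => Atom (va (b q))) ->
        pt j3 (fun q => tbool (R (tag (tag (tag (tag q))))) (a q == b q)).
      exact: (@pt_ordeq Z3 (fun q => tag (tag (tag (tag q)))) j3).
    apply: pt_and; first apply: pt_and.
    + apply: pt_not.
      apply: (pt_comp _ (pt_reindex (fun q : Z3 => Tagged (fun x => elt x * elt x)%type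
        (tagged q, tagged (tag (tag q)))) pt_eqelt)).
      exact: (pt_expr _ (e := ENode (Left (Right (Var 0))) (Left (Right (Left (Left (Var 0))))))).
    + exact: (pt_expr _ (e := Right (Right (Var 0)))).
    + apply: pt_and.
        apply: (@pt_ordeq Z3 (fun q => tag (tag (tag (tag q)))) j3 (fun q => kconn (I (tag (tag (tag (tag q))))))
          (fun q => (tagged q).1) (fun q => (tagged (tag (tag q))).1)).
          exact: (pt_expr _ (e := Left (Left (Right (Var 0))))).
        exact: (pt_expr _ (e := Left (Left (Right (Left (Left (Var 0))))))).
      have ht := call3 _ pt_tl; have hh := call3 _ pt_hd.
      apply: pt_or; apply: pt_and; by apply: veq.
  - pose Z2 := {z : XJT & Vz z}.
    apply: (@pt_ext _ _ _ (fun q : Z2 => tbool (R (tag (tag (tag q)))) (tagged q == tl (tagged (tag q))))).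
      by move=> q; rewrite inE.
    apply: (@pt_ordeq Z2 (fun q => tag (tag (tag q))) _ (fun q => nv (I (tag (tag (tag q)))))
      (fun q => tagged q) (fun q => tl (tagged (tag q)))).
      exact: (pt_expr _ (e := Right (Var 0))).
    exact: (pt_weak (fun (z : XJT) (v : Vz z) => Atom (va v)) (callT _ pt_tl)).
apply: (@pt_ext _ _ _ (fun z : XJT => tbool (R (tag (tag z)))
   (has (fun v => (v == hd (tagged z)) && (v \in ac z)) (vends (tag (tag z)))))).
  move=> z; congr (tbool _ _); apply/hasP/idP => [[v _ /andP[/eqP <-]]|h].
    by case: z v => [? ?] v.
  exists (hd (tagged z)); first by apply: mem_ends; apply: ne_gt0.
  by rewrite eqxx; case: z h.
apply: (pt_has hc); apply: pt_and; last exact: (pt_expr _ (e := Right (Right (Var 0)))).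
apply: (@pt_ordeq {z : XJT & Vz z} (fun q => tag (tag (tag q))) _ (fun q => nv (I (tag (tag (tag q)))))
      (fun q => tagged q) (fun q => hd (tagged (tag q)))).
  exact: (pt_expr _ (e := Left (Right (Var 0)))).
exact: (pt_weak (fun (z : XJT) (v : Vz z) =>
  Node (Atom (va v)) (tbool (R (tag (tag z))) (v \in ac z))) (callT _ pt_hd)).
Qed.

Lemma count_sum (fT : finType) (s : seq fT) (Rr : realFieldType) (y : Rr) (Q : pred fT) :
  uniq s -> (forall t, t \in s) -> (\sum_(t <- s) (if Q t then y else 0) = y *+ #|[set t | Q t]|)%R.
Proof.
move=> us sT; rewrite (perm_big (enum fT)) /=; last first.
  by apply: uniq_perm; rewrite ?enum_uniq // => t; rewrite sT mem_enum.
rewrite big_enum -big_mkcond /= -sumr_const; apply: eq_bigl => t.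
by rewrite inE.
Qed.

(** Cardinals become sums of copies of [c0], comparable with the capacities and [kconn] stored in
    the same unit. *)
Lemma pt_count (Z : Type) (g : Z -> XJ) (j : forall z, tree (R (tag (g z))))
    (P : forall z, pred (elt (tag (g z)))) :
  pt j (fun z => iJ (g z)) ->
  pt (fun q : {z & elt (tag (g z))} => Node (j (tag q)) (senc (tagged q)))
    (fun q => tbool (R (tag (g (tag q)))) (P (tag q) (tagged q))) ->
  pt j (fun z => Atom (c0 (tag (g z)) *+ #|[set t in tagged (g z) | P z t]|)%R).
Proof.
move=> hj hP.
have hl : pt j (fun z => tlist [seq senc t | t <- elts (tag (g z))]) by exact: pt_snd hj.
have hc : pt j (fun z => Atom (c0 (tag (g z)))).
  exact: pt_fst (pt_fst (pt_fst hj)).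
apply: (@pt_ext _ _ _ (fun z => Atom (\sum_(t <- elts (tag (g z)))
   (if (t \in tagged (g z)) && P z t then c0 (tag (g z)) else 0))%R)).
  move=> z; rewrite count_sum ?uniq_elts //; exact: mem_elts.
apply: (pt_sum hl (pt_zero hc)).
have hw := pt_weak (fun z (t : elt (tag (g z))) => senc t) hc.
have hJ : pt (fun q : {z & elt (tag (g z))} => Node (j (tag q)) (senc (tagged q)))
   (fun q => tbool (R (tag (g (tag q)))) (tagged q \in tagged (g (tag q)))).
  exact: (pt_expr _ (e := Right (Right (Var 0)))).
by apply: pt_ext (pt_ite (pt_and hJ hP) hw (pt_zero hw)) => q; case: ifP.
Qed.

Lemma pt_laminar : pt_oracle (@eT) elts envA Lm.
Proof.
pose Ec (p : XJ) (b : bool) (e : 'I_(ne (I (tag p)))) := #|arcs_of (tagged p) (e, b)|.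
pose Hc (p : XJ) (v : 'I_(nv (I (tag p)))) :=
  #|heads_of (@src _ (I (tag p))) (@tgt _ (I (tag p))) (tagged p) v|.
apply: (@pt_ext _ _ _ (fun p : XJ => tbool (R (tag p))
  (all (fun e => (Ec p true e <= cap e) && (Ec p false e <= cap e)) (enum 'I_(ne (I (tag p)))) &&
   all (fun v => Hc p v <= if v == root (I (tag p)) then 0 else kconn (I (tag p))) (vends (tag p))))).
  move=> p; rewrite /Lm /= /lam; congr (tbool _ (_ && _)).
    apply/allP/forallP => [h [e b]|h e _]; last by rewrite !h.
    by have := h e; rewrite mem_enum => /(_ isT) /andP[? ?]; case: b.
  rewrite -forallb_all // => v; exact: mem_ends (ne_gt0 some_pos _).
apply: pt_and.
  have he : pt iJ (fun p => tlist [seq eE e | e <- enum 'I_(ne (I (tag p)))]).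
    exact: (pt_expr _ (e := Right (Right (Left (Left (Var 0)))))).
  pose Z := {p : XJ & 'I_(ne (I (tag p)))}.
  pose j (z : Z) := Node (iJ (tag z)) (eE (tagged z)).
  have hb b : pt j (fun z => tbool (R (tag (tag z))) (Ec (tag z) b (tagged z) <= cap (tagged z))).
    apply: (@pt_ext _ _ _ (fun z : Z => tbool (R (tag (tag z)))
      (c0 (tag (tag z)) *+ Ec (tag z) b (tagged z) <= c0 (tag (tag z)) *+ cap (tagged z))%R)).
      by move=> z; rewrite ler_pMn2l ?unit_cost_gt0.
    apply: pt_le; last exact: (pt_expr _ (e := Left (Right (Right (Right (Right (Var 0))))))).
    apply: (@pt_count Z (fun z => tag z) j (fun z t => t.2 == (tagged z, b))).
      exact: (pt_expr _ (e := Left (Var 0))).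
    apply: (@pt_ext _ _ _ (fun q : {z : Z & elt (tag (tag z))} => tbool (R (tag (tag (tag q))))
      (((tagged q).2.1 == tagged (tag q)) && ((tagged q).2.2 == b)))).
      by move=> [z [l [e b']]]; rewrite /= xpair_eqE.
    apply: pt_and.
      apply: (@pt_ordeq _ (fun q : {z : Z & elt (tag (tag z))} => tag (tag (tag q))) _
        (fun q => ne (I (tag (tag (tag q))))) (fun q => (tagged q).2.1) (fun q => tagged (tag q))).
        exact: (pt_expr _ (e := Left (Left (Right (Left (Right (Var 0))))))).
      exact: (pt_expr _ (e := Left (Right (Left (Var 0))))).
    apply: pt_eqb; first exact: (pt_expr _ (e := Right (Right (Left (Right (Var 0)))))).
    by case: b; [apply: pt_true | apply: pt_false].
  by apply: (pt_all he); apply: pt_and; apply: hb.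
have hv : pt iJ (fun p => tlist [seq Atom (va v) | v <- vends (tag p)]).
  apply: pt_comp (pt_reindex (fun z : XJ => tag z) pt_vends).
  exact: (pt_expr _ (e := Left (Left (Var 0)))).
apply: (pt_all hv).
pose Z := {p : XJ & 'I_(nv (I (tag p)))}.
pose j (z : Z) := Node (iJ (tag z)) (Atom (va (tagged z))).
have hc : pt j (fun z => Atom (c0 (tag (tag z)))).
  exact: (pt_expr _ (e := Left (Left (Left (Left (Var 0)))))).
have h0 := pt_zero hc.
apply: (@pt_ext _ _ _ (fun z : Z => tbool (R (tag (tag z)))
  (c0 (tag (tag z)) *+ Hc (tag z) (tagged z) <=
   if tagged z == root (I (tag (tag z))) then 0 else c0 (tag (tag z)) *+ kconn (I (tag (tag z))))%R)).
  (* The bound 0 at the root is read as [c0 *+ 0], so that both cases are multiples of the unit. *)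
  move=> z; rewrite -[X in if _ then X else _](mulr0n (c0 (tag (tag z)))).
  by rewrite -(fun_if (fun n => c0 (tag (tag z)) *+ n)%R) ler_pMn2l ?unit_cost_gt0.
apply: pt_le.
  apply: (@pt_count Z (fun z => tag z) j (fun z t => hd t == tagged z)).
    exact: (pt_expr _ (e := Left (Var 0))).
  apply: (@pt_ordeq _ (fun q : {z : Z & elt (tag (tag z))} => tag (tag (tag q))) _
     (fun q => nv (I (tag (tag (tag q))))) (fun q => hd (tagged q)) (fun q => tagged (tag q))).
    apply: (pt_comp _ (pt_reindex (fun q : {z : Z & elt (tag (tag z))} => Tagged elt (tagged q)) pt_hd)).
    exact: (pt_expr _ (e := Left (Right (Var 0)))).
  exact: (pt_expr _ (e := Right (Left (Var 0)))).
have hr : pt j (fun z => tbool (R (tag (tag z))) (tagged z == root (I (tag (tag z))))).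
  apply: (@pt_ordeq Z (fun z => tag (tag z)) j (fun z => nv (I (tag (tag z))))
    (fun z => tagged z) (fun z => root (I (tag (tag z))))).
    exact: (pt_expr _ (e := Right (Var 0))).
  by apply: pt_ext h0 => z; rewrite mulr0n.
have hk : pt j (fun z => Atom (c0 (tag (tag z)) *+ kconn (I (tag (tag z))))%R).
  exact: (pt_expr _ (e := Left (Right (Left (Left (Left (Var 0))))))).
by apply: pt_ext (pt_ite hr h0 hk) => z; case: ifP.
Qed.

Definition base x : {set elt x} :=
  wmi (Fm x) (Lm x) (fun t : elt x => ecost t.2.1) (size (elts x)).+1 (size (elts x)) (elts x).

Definition outA x : {set 'I_(ne (I x))} := edges_of (base x).

Lemma pt_outA : pt env (fun x => tset (R x) (outA x)).
Proof.
have hl : pt envA (fun x => tlist [seq eT t | t <- elts x]) by exact: (pt_expr _ (e := Right (Var 0))).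
have h0 : pt envA (fun x => Atom 0%R).
  by apply: pt_zero (fun x => c0 x) _; exact: (pt_expr _ (e := Left (Left (Var 0)))).
have hw := pt_wmi (c := fun x (t : elt x) => ecost t.2.1) mem_elts hl pt_ecostT pt_eqelt pt_forests pt_laminar h0.
pose j x := Node (env x) (tlist [seq Node (eT t) (tbool (R x) (t \in base x)) | t <- elts x]).
have hj : pt env j by apply: pt_pair (pt_id _) (pt_comp pt_envA hw).
apply: (pt_comp hj).
have he : pt j (fun x => tlist [seq eE e | e <- enum 'I_(ne (I x))]).
  exact: (pt_expr _ (e := Right (Right (Left (Var 0))))).
apply: (pt_map he).
pose Z := {x & 'I_(ne (I x))}.
pose jj (z : Z) := Node (j (tag z)) (eE (tagged z)).
apply: (@pt_ext _ _ _ (fun z : Z => tbool (R (tag z))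
  (has (fun t => (t \in base (tag z)) && (t.2.1 == tagged z)) (elts (tag z))))).
  by move=> z; rewrite inE (existsb_has _ (mem_elts (x := _))).
have hl2 : pt jj (fun z => tlist [seq Node (eT t) (tbool (R (tag z)) (t \in base (tag z))) | t <- elts (tag z)]).
  exact: (pt_expr _ (e := Right (Left (Var 0)))).
apply: (pt_has hl2); apply: pt_and; first exact: (pt_expr _ (e := Right (Right (Var 0)))).
apply: (@pt_ordeq _ (fun q : {z : Z & elt (tag z)} => tag (tag q)) _
  (fun q => ne (I (tag (tag q)))) (fun q => (tagged q).2.1) (fun q => tagged (tag q))).
  exact: (pt_expr _ (e := Left (Left (Right (Left (Right (Var 0))))))).
exact: (pt_expr _ (e := Left (Right (Left (Var 0))))).
Qed.

End CaseA.

(** * The approximation guarantee *)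

Section PackingCost.
Variables (R : realFieldType) (I : instance R) (F : {set 'I_(ne I)}).
Hypothesis fF : feasible F.

Notation arc := ('I_(ne I) * bool)%type.
Notation Sr := (@src _ I).
Notation Tg := (@tgt _ I).

Lemma sum_arcs (Rr : nmodType) (P : pred arc) (f : 'I_(ne I) -> Rr) :
  (\sum_(a | P a) f a.1 = \sum_e ((if P (e, true) then f e else 0) + (if P (e, false) then f e else 0)))%R.
Proof.
rewrite big_mkcond /= (eq_bigr (fun a : arc => (fun e b => if P (e, b) then f e else 0) a.1 a.2)%R); last by case.
by rewrite -(pair_bigA _ (fun e b => if P (e, b) then f e else 0)%R) /=; apply: eq_bigr => e _; rewrite big_bool.
Qed.

(** Each edge of a cut enters [S] in exactly one of its orientations, so the arcs entering [S] have
    the capacity of the cut. *)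
Lemma cut_of_feasible (S : {set 'I_(nv I)}) : S != set0 -> root I \notin S ->
  kconn I <= \sum_(a | enters Sr Tg S a) cap_in F a.1.
Proof.
move=> S0 rS; have ST : S \proper setT.
  by apply/properP; split; [apply: subsetT | exists (root I)].
have := forallP fF S; rewrite S0 ST /= -cutval_delta => /leq_trans; apply.
rewrite /cutval (@sum_arcs nat) big_mkcond /=; apply: leq_sum => e _.
by rewrite /enters /ahead /atail /=; do 2!case: (_ \in S); rewrite //= ?addr0 ?add0r.
Qed.

Variable B : {set 'I_(kconn I) * arc}.
Hypothesis fB : ind (forests (kconn I) Sr Tg) B.
Hypothesis lB : lam Sr Tg (root I) (cap_in F) B.

Lemma packing_in t : t \in B -> t.2.1 \in F.
Proof.
move=> tB; apply/negPn/negP => tF; have /andP[/forallP/(_ t.2) + _] := lB.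
rewrite /cap_in (negbTE tF) leqn0 cards_eq0 => /eqP/setP/(_ t).
by rewrite !inE tB eqxx.
Qed.

(** Within a colour an edge occurs in at most one orientation, so elements of [B] are determined by
    colour and edge; each of the [kconn] colours costs at most [cost F]. *)
Lemma packing_cost_k : (\sum_(t in B) ecost t.2.1 <= (kconn I)%:R * cost F)%R.
Proof.
pose h (t : 'I_(kconn I) * arc) := (t.1, t.2.1).
have hinj : {in B &, injective h}.
  move=> [j [e b]] [j' [e' b']] tB tB' [jj ee]; rewrite -{}jj -{}ee in tB' *.
  case: b tB; case: b' tB' => // h1 h2.
    by have := forests_flip fB h2; rewrite h1.
  by have := forests_flip fB h1; rewrite h2.
rewrite (_ : (\sum_(t in B) _ = \sum_(p in h @: B) ecost p.2)%R); last by rewrite big_imset.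
apply: (@le_trans _ _ (\sum_(p : 'I_(kconn I) * 'I_(ne I) | p.2 \in F) ecost p.2)%R).
  rewrite big_mkcond [leRHS]big_mkcond; apply: ler_sum => p _ /=.
  case: ifP => [/imsetP[t tB ->]|_]; first by rewrite /= packing_in.
  by case: ifP => // _; apply: ecost_ge0.
rewrite -(pair_big predT (fun e => e \in F) (fun _ e => ecost e)) /= sumr_const card_ord.
by rewrite mulr_natl.
Qed.

(** Elements are grouped by arc: the two arcs of an edge [e] of [F] are used at most [cap e] times
    each. *)
Lemma packing_cost_u : (\sum_(t in B) ecost t.2.1 <= (2 * umax I)%:R * cost F)%R.
Proof.
rewrite (partition_big (fun t => t.2) predT) //=.
have /andP[/forallP cB _] := lB.
apply: (@le_trans _ _ (\sum_(a : arc) ecost a.1 *+ cap_in F a.1)%R).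
  apply: ler_sum => a _; rewrite (eq_bigr (fun=> ecost a.1)); last by move=> t /andP[_ /eqP->].
  rewrite sumr_const; apply: ler_wpMn2l; first exact: ecost_ge0.
  apply: leq_trans (cB a); apply: eq_leq; apply: eq_card => t.
  by rewrite !inE.
rewrite (sum_arcs predT (fun e => ecost e *+ cap_in F e)%R) /= mulr_natl /cost.
rewrite -sumrMnl [leRHS]big_mkcond; apply: ler_sum => e _; rewrite /cap_in.
case: ifP => _; last by rewrite mulr0n addr0.
rewrite -mulrnDr; apply: ler_wpMn2l; first exact: ecost_ge0.
by rewrite addnn -mul2n leq_mul2l /= /umax (leq_bigmax e).
Qed.

End PackingCost.

Section OutA.
Variables (X : Type) (R : X -> realFieldType) (I : forall x, instance (R x)) (x : X).
Hypothesis ne0 : 0 < ne (I x).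
Hypothesis ex : exists F : {set 'I_(ne (I x))}, feasible F.

(** The packing in an optimal [F] respects the capacities of the instance as well, and by
    [forests_card] it is as large as any forest, so it is an admissible competitor for the
    intersection algorithm. Passing from the base to its edges can only lower the cost, as an edge
    is then paid once. *)
Lemma outA_correct : feasible (outA I x) /\
  (cost (outA I x) <= (minn (kconn (I x)) (2 * umax (I x)))%:R * OPT (I x))%R.
Proof.
have [[F fF cF] _] := OPT_min ex.
have [B [fB lB cB]] := arborescence_packing (cut_of_feasible fF).
have lB' : ind (Lm I x) B.
  have /andP[/forallP h1 h2] := lB; apply/andP; split; last exact: h2.
  apply/forallP => a; apply: leq_trans (h1 a) _; rewrite /cap_in.
  by case: ifP.
have szT : #|elt I x| <= size (elts I x).
  have <- : #|elts I x| = #|elt I x| by apply: eq_card => t; rewrite mem_elts.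
  exact: card_size.
have maxB (A : {set elt I x}) : ind (Fm I x) A -> #|A| <= #|B|.
  by move=> fA; rewrite cB; apply: forests_card fA; apply: nv_gt0.
have [i1 i2 cI le] := wmi_correct (n := (size (elts I x)).+1) (fun t : elt I x => ecost t.2.1)
  (@mem_elts _ _ I x) szT (leq_trans (max_card (mem B)) szT) fB lB' maxB.
rewrite -/(base I x) in i1 i2 cI le; split.
  apply/forallP => S; apply/implyP => S0; apply/implyP => ST.
  apply: (common_base_cut i1 i2); rewrite ?cI //.
  by apply: contraTneq ST => ->; rewrite properxx.
have le' : (cost (outA I x) <= \sum_(t in B) ecost t.2.1)%R.
  apply: le_trans le; rewrite /cost.
  rewrite [leRHS](partition_big (fun t => t.2.1) (fun e => e \in outA I x)) /=; last first.
    by move=> t tB; rewrite inE; apply/exists_inP; exists t.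
  apply: ler_sum => e; rewrite inE => /exists_inP[t tB /eqP te].
  rewrite (bigD1 t) /=; last by rewrite tB te eqxx.
  by rewrite te lerDl sumr_ge0 // => t' _; apply: ecost_ge0.
apply: le_trans le' _; rewrite -cF /minn; case: ifP => _.
  exact: packing_cost_k fB lB.
exact: packing_cost_u lB.
Qed.

End OutA.

(** For a graph with edges, the negation of [ne <= minn kconn (2 * umax)], in a form that needs only
    sums and comparisons. Under it, [kconn] copies of the arcs are affordable in a feasible
    instance. *)
Definition cond_unary (R : realFieldType) (I : instance R) :=
  ~~ (ne I <= kconn I) || all (fun e : 'I_(ne I) => ~~ (ne I <= cap e + cap e)) (enum 'I_(ne I)).

(** In the second alternative every capacity is at most [ne], so the cut around the root, which
    feasibility forces to have capacity at least [kconn], has capacity at most [ne * ne]. *)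
Lemma cond_unary_k (R : realFieldType) (I : instance R) : 0 < ne I ->
  (exists F : {set 'I_(ne I)}, feasible F) -> cond_unary I -> kconn I <= ne I * ne I.
Proof.
move=> m0 [F fF]; rewrite /cond_unary -ltnNge => /orP[km|/allP h].
  by apply: leq_trans (ltnW km) _; rewrite leq_pmulr.
have S0 : [set root I] != set0 by apply/set0Pn; exists (root I); rewrite inE.
have ST : [set root I] \proper setT.
  apply/properP; split; first exact: subsetT.
  by exists (Ordinal (nv_gt1 m0)); rewrite // inE; apply/eqP => /(congr1 val).
have := forallP fF [set root I]; rewrite S0 ST /= => /leq_trans; apply.
apply: (@leq_trans (\sum_(e : 'I_(ne I)) ne I)); last by rewrite sum_nat_const card_ord.
rewrite big_mkcond; apply: leq_sum => e _; case: ifP => // _.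
have := h e; rewrite mem_enum -ltnNge => /(_ isT) /ltnW; apply: leq_trans.
exact: leq_addr.
Qed.

Lemma cond_unaryN (R : realFieldType) (I : instance R) : ~~ cond_unary I ->
  ne I <= minn (kconn I) (2 * umax I).
Proof.
rewrite /cond_unary negb_or negbK => /andP[km /allPn[e _]]; rewrite negbK => me.
rewrite leq_min km (leq_trans me) // addnn -mul2n leq_mul2l /= /umax.
exact: (leq_bigmax e).
Qed.

Section PtCond.
Variables (X : Type) (R : X -> realFieldType) (I : forall x, instance (R x)).
Hypothesis some_pos : forall x, ~~ all (@npos X R I x) (enum 'I_(ne (I x))).

Lemma pt_cond_unary : pt (env1 I) (fun x => tbool (R x) (cond_unary (I x))).
Proof.
have hc := pt_unit I; have he := pt_edges I.
have hm : pt (env1 I) (fun x => Atom (unit_cost I x *+ ne (I x))%R).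
  apply: pt_ext (pt_sum he (g := fun x _ => unit_cost I x) (pt_zero hc)
    (pt_weak (fun x => @eenc1 X R I x) hc)) => x.
  by rewrite big_const_seq count_predT size_enum_ord iter_addr_0.
apply: pt_or.
  apply: (@pt_ext _ _ _ (fun x => tbool (R x)
    (~~ (unit_cost I x *+ ne (I x) <= unit_cost I x *+ kconn (I x))%R))).
    by move=> x; rewrite ler_pMn2l ?unit_cost_gt0.
  by apply: pt_not; apply: (pt_le hm); exact: (pt_expr _ (e := Left (Right (Var 0)))).
apply: (pt_all he).
pose j (p : {x & 'I_(ne (I x))}) := Node (env1 I (tag p)) (@eenc1 X R I _ (tagged p)).
have h2 : pt j (fun p => Atom (unit_cost I (tag p) *+ cap (tagged p))%R).
  exact: (pt_expr _ (e := Left (Right (Right (Right (Right (Var 0))))))).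
apply: (@pt_ext _ _ _ (fun p : {x & 'I_(ne (I x))} => tbool (R (tag p))
  (~~ (unit_cost I (tag p) *+ ne (I (tag p)) <= unit_cost I (tag p) *+ cap (tagged p)
     + unit_cost I (tag p) *+ cap (tagged p))%R))).
  by move=> p; rewrite -mulrnDr ler_pMn2l ?unit_cost_gt0.
apply: pt_not; apply: pt_le (pt_add h2 h2).
exact: (pt_weak (fun x => @eenc1 X R I x) hm).
Qed.

End PtCond.

(** The field is part of the index, so that [pt] yields a single program for all fields. *)
Definition fin_instance := {R : realFieldType & {I : instance R | exists F : {set 'I_(ne I)}, feasible F}}.

Definition fi_ring (x : fin_instance) : realFieldType := tag x.
Definition fi_inst (x : fin_instance) : instance (fi_ring x) := sval (tagged x).

Definition all_free (x : fin_instance) := all (@npos _ _ fi_inst x) (enum 'I_(ne (fi_inst x))).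

Definition solution (x : fin_instance) : {set 'I_(ne (fi_inst x))} :=
  if all_free x then setT
  else if cond_unary (fi_inst x) then outA fi_inst x
  else below (fi_inst x) (bottleneck (fi_inst x)).

(** The unit exists only if some cost is positive, and the list of colours is built only if
    [cond_unary] holds; hence the nested subtypes, over which the family of instances is
    restated. *)
Lemma pt_solution : pt (fun x => tinstance (fi_inst x)) (fun x => tset (fi_ring x) (solution x)).
Proof.
have h0 := @pt_edges0 _ _ fi_inst.
apply: (pt_if (q := all_free)).
- exact: (pt_all h0 (@pt_npos _ _ fi_inst)).
- have h : pt (fun x => tinstance (fi_inst x)) (fun x => tset (fi_ring x) [set: 'I_(ne (fi_inst x))]).
    by apply: (pt_map h0); apply: pt_ext (pt_true _) => p; rewrite inE.
  refine (pt_ext _ (pt_reindex (fun y : {x | all_free x} => sval y) h)) => -[x ax].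
  by rewrite /solution /= ax.
pose X1 := {x | ~~ all_free x}.
pose R1 (y : X1) := fi_ring (sval y).
pose I1 (y : X1) : instance (R1 y) := fi_inst (sval y).
have sp1 (y : X1) : ~~ all (@npos X1 R1 I1 y) (enum 'I_(ne (I1 y))) by exact: (svalP y).
apply: (pt_comp (pt_env1 sp1)).
apply: (pt_if (pt_cond_unary sp1)).
- pose X2 := {y : X1 | cond_unary (I1 y)}.
  pose R2 (z : X2) := R1 (sval z).
  pose I2 (z : X2) : instance (R2 z) := I1 (sval z).
  have sp2 (z : X2) : ~~ all (@npos X2 R2 I2 z) (enum 'I_(ne (I2 z))) by exact: (sp1 (sval z)).
  have ks (z : X2) : kconn (I2 z) <= ne (I2 z) * ne (I2 z).
    apply: cond_unary_k; first exact: (ne_gt0 sp2).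
      exact: (svalP (tagged (sval (sval z)))).
    exact: (svalP z).
  have H := pt_outA sp2 ks.
  refine (pt_ext _ H) => -[[x nx] cx]; rewrite /solution /=.
  by rewrite (negbTE nx) ifT.
- have H := pt_bottleneck sp1.
  refine (pt_ext _ (pt_reindex (fun z : {y : X1 | ~~ cond_unary (I1 y)} => sval z) H)).
  by move=> -[[x nx] cx]; rewrite /solution /= (negbTE nx) ifN.
Qed.

Lemma solution_correct x : feasible (solution x) /\
  (cost (solution x) <= (minn (kconn (fi_inst x)) (2 * umax (fi_inst x)))%:R * OPT (fi_inst x))%R.
Proof.
have ex : exists F : {set 'I_(ne (fi_inst x))}, feasible F := svalP (tagged x).
have OPT0 : (0 <= OPT (fi_inst x))%R.
  by have [[F _ <-] _] := OPT_min ex; apply: sumr_ge0 => e _; apply: ecost_ge0.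
rewrite /solution; case: ifP => [/allP af|/negbT naf].
  split; first by case: ex => F; apply: feasibleT.
  rewrite /cost big1 ?mulr_ge0 ?ler0n // => e _; apply/le_anti.
  by rewrite ecost_ge0 andbT; apply: af; rewrite mem_enum.
have m0 : 0 < ne (fi_inst x).
  by move: naf; rewrite /all_free -has_predC => /hasP[e _ _]; apply: leq_ltn_trans (ltn_ord e).
case: ifP => [_|/negbT cu]; first exact: outA_correct.
have [fb cb] := bottleneckP m0 ex; split=> //; apply: le_trans cb _.
by apply: ler_wpM2r => //; rewrite ler_nat cond_unaryN.
Qed.

Local Open Scope ring_scope.

Theorem theorem3 :
  exists (P : prog) (C d : nat),
  forall (R : realFieldType) (I : instance R),
    (exists F : {set 'I_(ne I)}, feasible F) ->
    exists (F : {set 'I_(ne I)}) (t : nat),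
      [/\ computes P (tinstance I) (tset R F) t,
          (t <= C * tree_size (tinstance I) ^ d)%N,
          feasible F &
          cost F <= (minn (kconn I) (2 * umax I)%N)%:R * OPT I].
Proof.
have [P [n [c H]]] := pt_solution.
(* [n.+2 <= 3 * n] for [n > 0], and the size of a tree is positive. *)
exists P, (3 ^ c)%N, c => R I ex.
pose x : fin_instance := Tagged (fun R => {I : instance R | exists F : {set 'I_(ne I)}, feasible F})
  (exist _ I ex).
have [s' [t [e o _ ht _]]] := H x (update (fun=> Leaf) 0 (tinstance I)) erefl.
exists (solution x), t; have [fs cs] := solution_correct x; split=> //.
- by exists s'.
- apply: leq_trans ht _; rewrite /pw -expnMn; apply: leq_expl.
  by have := tree_size_gt0 (tinstance I); rewrite /fi_inst /=; lia.
Qed.
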